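(* Let $(X,(p_j)_{j\ge 1})$ be a Fréchet space. If for every $j\ge 1$ and every closed subspace $E$ of $X$ of finite codimension, $p_j$ and $p_{j+1}$ are not equivalent on $E$, then $X$ does not satisfy the Hereditary Invariant Subset Property.
   Context: A Fréchet space $(X,(p_j)_{j\ge1})$ (over $\mathbb{K}=\mathbb{R}$ or $\mathbb{C}$) is a topological vector space whose topology is induced by a non-decreasing and separating sequence of seminorms $(p_j)_{j\ge 1}$ such that the metric $d(x,y)=\sum_{j\ge 1}2^{-j}\min\{1,p_j(x-y)\}$ is complete; $(p_j)$ is always assumed non-decreasing and separating. Two seminorms $p,q$ are equivalent on $E$ if there are constants $c,C>0$ with $c\,p(x)\le q(x)\le C\,p(x)$ for all $x\in E$. A continuous linear operator $T:Y\to Y$ on a Fréchet space $Y$ possesses a non-trivial invariant subset if there exists a non-empty closed subset $M$ of $Y$, different from $\{0\}$ and $Y$, such that $TM\subset M$. The space $Y$ satisfies the Invariant Subset Property if every continuous linear operator on $Y$ possesses a non-trivial invariant subset. The space $X$ satisfies the Hereditary Invariant Subset Property if every closed infinite-dimensional subspace of $X$ satisfies the Invariant Subset Property. *)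

(* Defs.v *)
From HB Require Import structures.
From mathcomp Require Import all_boot all_order all_algebra.
From mathcomp Require Import complex.
From mathcomp Require Import all_classical all_reals all_analysis.

Set Implicit Arguments.
Unset Strict Implicit.
Unset Printing Implicit Defensive.

Import Order.TTheory GRing.Theory Num.Theory.
Import numFieldNormedType.Exports.

Local Open Scope classical_set_scope.
Local Open Scope ring_scope.

Variant scalars := RealScalars | ComplexScalars.

Definition scalar_field (R : realType) (s : scalars) : numFieldType :=
  match s with
  | RealScalars => R
  | ComplexScalars => R[i]%C
  end.

(* The norm of R[i] is R[i]-valued; normc is the R-valued modulus. *)
Definition modulus (R : realType) (s : scalars) : scalar_field R s -> R :=
  match s with
  | RealScalars => fun a : R => `|a|
  | ComplexScalars => fun a : R[i]%C => ComplexField.Normc.normc a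
  end.

Section frechet.
Variables (R : realType) (s : scalars).
Let K := scalar_field R s.

Definition seminorm (V : lmodType K) (q : V -> R) : Prop :=
  [/\ forall x, 0 <= q x,
      forall (a : K) x, q (a *: x) = modulus a * q x
    & forall x y, q (x + y) <= q x + q y].

Definition equivalent_on (V : lmodType K) (E : {pred V}) (q r : V -> R) : Prop :=
  exists c C : R,
    [/\ 0 < c, 0 < C & forall x, x \in E -> c * q x <= r x <= C * q x].

Definition induces_topology (X : topologicalLmodType K) (p : nat -> X -> R) : Prop :=
  forall (x : X) (U : set X), nbhs x U <->
    exists n (e : R), 0 < e /\
      [set y | forall j, (j < n)%N -> p j (y - x) < e] `<=` U.

(* Sequences of seminorms are indexed from 0: p j stands for p_(j+1), whence
   the weights 2^-(j+1). *)
Definition frechet_dist (V : lmodType K) (p : nat -> V -> R) (x y : V) : R :=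
  limn (series (fun j => 2^-1 ^+ j.+1 * Num.min 1 (p j (x - y)))).

Definition complete_dist (T : Type) (d : T -> T -> R) : Prop :=
  forall u : nat -> T,
    (forall e : R, 0 < e -> exists N, forall m n,
       (N <= m)%N -> (N <= n)%N -> d (u m) (u n) < e) ->
    exists l, forall e : R, 0 < e -> exists N, forall n,
      (N <= n)%N -> d (u n) l < e.

Record frechet_space (X : topologicalLmodType K) (p : nat -> X -> R) : Prop := {
  frechet_seminorm : forall j, seminorm (p j);
  frechet_nondecreasing : forall j x, p j x <= p j.+1 x;
  frechet_separating : forall x, (forall j, p j x = 0) -> x = 0;
  frechet_topology : induces_topology p;
  frechet_complete : complete_dist (frechet_dist p)
}.

End frechet.

Definition finite_dimensional (K : numFieldType) (V : lmodType K) : Prop :=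
  exists n (v : 'I_n -> V), forall x : V,
    exists a : 'I_n -> K, x = \sum_i a i *: v i.

(* The classes of finitely many vectors span V / E. *)
Definition finite_codimensional (K : numFieldType) (V : lmodType K)
    (E : submodClosed V) : Prop :=
  exists n (v : 'I_n -> V), forall x : V,
    exists a : 'I_n -> K, x - \sum_i a i *: v i \in E.

(* A linear subspace E of X as a topological vector space in its own right, for
   the topology induced by X. *)
Section linear_subspace.
Context {K : numFieldType} {X : topologicalLmodType K}.

Record linear_subspace (E : submodClosed X) := LinearSubspace {
  linear_subspace_val : X;
  _ : linear_subspace_val \in E
}.

Variable E : submodClosed X.

HB.instance Definition _ :=
  [isSub of linear_subspace E for @linear_subspace_val E].
HB.instance Definition _ := [Choice of linear_subspace E by <:].
HB.instance Definition _ := [SubChoice_isSubLmodule of linear_subspace E by <:].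
HB.instance Definition _ := Topological.copy (linear_subspace E)
  (initial_topology (@linear_subspace_val E)).

Let vE : continuous (@linear_subspace_val E).
Proof. exact: initial_continuous. Qed.

Let vP (T : topologicalType) (f : T -> linear_subspace E) :
  continuous (fun t => linear_subspace_val (f t)) -> continuous f.
Proof. exact: continuous_comp_initial. Qed.

Let linear_subspace_add_continuous :
  continuous (fun x : linear_subspace E * linear_subspace E => x.1 + x.2).
Proof.
refine (vP _) => x.
apply: (@continuous_comp _ _ _
  (fun x : linear_subspace E * linear_subspace E => (\val x.1, \val x.2))
  (fun z : X * X => z.1 + z.2)); last exact: add_continuous.
by apply: cvg_pair; (apply: cvg_comp; last exact: vE);
  [exact: cvg_fst|exact: cvg_snd].
Qed.

Let linear_subspace_scale_continuous :
  continuous (fun z : K^o * linear_subspace E => z.1 *: z.2).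
Proof.
refine (vP _) => x.
rewrite [X in continuous_at _ X](_ : _ = (fun z : K^o * X => z.1 *: z.2) \o
  (fun z : K^o * linear_subspace E => (z.1, linear_subspace_val z.2))).
  refine (continuous_comp _ (@scale_continuous K X _)).
  have h1 : (fun z : K^o * linear_subspace E => z.1) @ x --> x.1 by exact: cvg_fst.
  have h2 : (fun z : K^o * linear_subspace E => linear_subspace_val z.2) @ x -->
    linear_subspace_val x.2.
    apply: (@continuous_comp _ _ _ snd (@linear_subspace_val E)); last exact: vE.
    exact: cvg_snd.
  exact: (cvg_pair h1 h2).
by apply: funext => z.
Qed.

HB.instance Definition _ := PreTopologicalNmodule_isTopologicalNmodule.Build
  (linear_subspace E) linear_subspace_add_continuous.
HB.instance Definition _ := TopologicalNmodule_isTopologicalLmodule.Build K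
  (linear_subspace E) linear_subspace_scale_continuous.

End linear_subspace.

Definition nontrivial_invariant_subset (K : numFieldType)
    (Y : topologicalLmodType K) (T : Y -> Y) (M : set Y) : Prop :=
  [/\ M !=set0, closed M, M <> [set 0], M <> setT & T @` M `<=` M].

Definition invariant_subset_property (K : numFieldType)
    (Y : topologicalLmodType K) : Prop :=
  forall T : {linear Y -> Y}, continuous T ->
    exists M : set Y, nontrivial_invariant_subset T M.

Definition hereditary_invariant_subset_property (K : numFieldType)
    (X : topologicalLmodType K) : Prop :=
  forall E : submodClosed X, closed [set` E] ->
    ~ finite_dimensional (linear_subspace E) ->
    invariant_subset_property (linear_subspace E).

(* Main.v *)
Require Import Defs.
From HB Require Import structures.
From mathcomp Require Import all_boot all_order all_algebra.
From mathcomp Require Import complex.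
From mathcomp Require Import all_classical all_reals all_analysis.
From mathcomp Require Import ring lra zify.

(** The space contains an infinite-dimensional closed subspace E with a continuous
    operator T all of whose non-zero vectors have a dense orbit in E; a closed
    invariant set that contains a non-zero vector is then all of E. The operator is
    a shift: vectors e_0, e_1, ... are constructed, E is their closed span and T e_l
    = e_(l+1). Writing Phi(P) for P(T) e_0, the operator T is multiplication by X on
    polynomials, and everything is decided by the sizes of the vectors u_m =
    Phi(U_m), for one basis U_0, U_1, ... of the polynomials, with U_m monic of
    degree m.

    Where the vectors come from. On a closed subspace of finite codimension p_(j+1)
    is not bounded by a multiple of p_j, so this subspace contains vectors as small
    as desired for p_j and as large as desired for p_(j+1) ([cofinite_select]).
    Taking the subspace in the kernels of finitely many norming functionals makes
    such a vector almost orthogonal, for finitely many seminorms, to all the vectors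
    chosen before ([almost_orthogonal]), whence bounds for the coordinates along the
    u_m. These two facts, together with simple stability properties, are recorded in
    [selection_system], and the construction uses nothing else from the space.

    Events. The basis is built in consecutive blocks of degrees d <= m < d'. The
    block comes with a polynomial q of degree less than d and an exponent c between
    d and d': U_m is X^m for d <= m < c, and X^(m-c) (X^c - q) for c <= m < d'. The
    vectors u_m with m just above c are tiny for some seminorm p_s, which makes T^c
    almost equal to q(T) for p_s on the span of u_0, ..., u_(c-1)
    ([seminorm_return]). In order that T be continuous, the smallness of u_m is lost
    slowly: u_m has a level, which drops by one only when the degree has increased
    by d (by c, beyond c); u_m is tiny for p_j when j is at most the level, whereas
    p_(j+1)(u_m) exceeds by an enormous factor every p_j(u_t) with t < 2d' when j is
    at least the level ([event_vectors]). Multiplication by X^i with i <= d lowers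
    the level by at most one. So X^i U_m is a basis element that is still tiny for
    p_j, or else p_(j+1)(u_m) is so large that it dominates p_j(X^i U_m) whatever
    that vector is ([seminorm_shift]). Hence T is continuous, with a loss of one
    seminorm, and the powers of T up to d, or the polynomials q(T), are negligible
    on the blocks after the one under consideration.

    Stages. Stage nu starts with an event for q = 1, with an exponent a: thus T^a
    Phi(f) is close to Phi(f) for f of moderate size. If P is a bounded polynomial
    with some coordinate of modulus at least 1/nu on u_0, ..., u_(d-1), then some q
    in a finite list, which does not depend on P, satisfies q P = X^a f up to a
    small error ([transfer_net]). Every q in the list then gets its own event, say
    with exponent c; so T^c Phi(P) is close to q(T) Phi(P), to T^a Phi(f), and
    finally to Phi(f), the part of P of degree at least a being negligible
    ([stage_estimate]). The seminorm p_s of a stage is given by the 2-adic valuation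
    s of nu, so that each seminorm is served by arbitrarily late stages.

    There is an apparent circle: the first vectors of a stage have to be chosen huge
    in terms of the size of the polynomials q, and the polynomials q depend on the
    vectors. It is broken by choosing positive lower bounds of the p_0(u_m) before
    anything else: they bound the coefficients of P, hence those of q, because q
    solves the equation exactly in the degrees at least d and with an error in the
    degrees below d only, where the e_l are known already ([transfer_poly]).

    Finally a non-zero x in E is close to vectors Phi(P) to which the stages apply
    with a finite list of exponents c ([transitive_shift_exists]); as the
    corresponding T^c are finitely many continuous operators, T^c x is close to
    Phi(f) for one of them, and the vectors Phi(f) are dense in E ([orbit_dense]). *)

Set Implicit Arguments.
Unset Strict Implicit.
Unset Printing Implicit Defensive.

Import Order.TTheory GRing.Theory Num.Theory.
Import numFieldNormedType.Exports.

Local Open Scope classical_set_scope.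
Local Open Scope ring_scope.

(** * The modulus of a scalar *)

Section modulus.
Variables (R : realType) (s : scalars).
Local Notation K := (scalar_field R s).

Lemma modulus_ge0 (a : K) : 0 <= modulus a.
Proof.
case: s a => [a|[a b]] /=; [exact: normr_ge0|exact: sqrtr_ge0].
Qed.

Lemma modulusM (a b : K) : modulus (a * b) = modulus a * modulus b.
Proof. by case: s a b => a b; [exact: normrM|exact: ComplexField.Normc.normcM]. Qed.

Lemma modulusD (a b : K) : modulus (a + b) <= modulus a + modulus b.
Proof. by case: s a b => a b; [exact: ler_normD|exact: le_normcD]. Qed.

Lemma modulus0 : modulus (0 : K) = 0.
Proof. by case: s; [exact: normr0|exact: ComplexField.Normc.normc0]. Qed.

Lemma modulus1 : modulus (1 : K) = 1.
Proof. by case: s; [exact: normr1|exact: ComplexField.Normc.normc1]. Qed.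

Lemma modulus_eq0 (a : K) : modulus a = 0 -> a = 0.
Proof. by case: s a => a; [exact: normr0_eq0|exact: ComplexField.Normc.eq0_normc]. Qed.

Lemma modulusN (a : K) : modulus (- a) = modulus a.
Proof. by case: s a => a; [exact: normrN|exact: normcN]. Qed.

Lemma modulus_surj (r : R) : 0 <= r -> exists a : K, modulus a = r.
Proof.
move=> r0; case: s => /=; first by exists r; rewrite ger0_norm.
by exists (r%:C)%C => /=; rewrite expr0n addr0 sqrtr_sqr ger0_norm.
Qed.

Lemma modulus_sum (I : Type) (r : seq I) (P : pred I) (F : I -> K) :
  modulus (\sum_(i <- r | P i) F i) <= \sum_(i <- r | P i) modulus (F i).
Proof.
elim/big_rec2: _ => [|i x y _ le]; first by rewrite modulus0.
by apply: le_trans (modulusD _ _) _; rewrite lerD2l.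
Qed.

(** The total boundedness of the balls of the scalar field is the source of all the
    finite lists of polynomials used below. *)
Lemma modulus_net (B e : R) : 0 < e ->
  exists l : seq K, forall a : K, modulus a <= B ->
    exists2 b, b \in l & modulus (a - b) <= e.
Proof.
have net1 (B' e' : R) : 0 < e' -> exists l : seq R, forall a : R, `|a| <= B' ->
    exists2 b, b \in l & `|a - b| <= e'.
  move=> e0; pose n := Num.truncn (2 * B' / e').
  exists [seq - B' + i%:R * e' | i <- iota 0 n.+1] => a aB.
  have [ha1 ha2] : - B' <= a /\ a <= B' by move: aB; rewrite ler_norml => /andP[].
  have t0 : 0 <= (a + B') / e' by apply: divr_ge0; lra.
  have /andP[k1 k2] := truncn_itv t0.
  set k := Num.truncn ((a + B') / e') in k1 k2.
  exists (- B' + k%:R * e').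
    apply/mapP; exists k => //; rewrite mem_iota /= add0n ltnS.
    apply: le_truncn; rewrite ler_pM2r ?invr_gt0//; lra.
  move: k1 k2; rewrite ler_pdivlMr// ltr_pdivrMr// -natr1 mulrDl mul1r => k1 k2.
  by rewrite ler_norml; apply/andP; split; lra.
move=> e0; case: s => /=; first exact: net1.
have [l hl] := net1 B (e / 2) (divr_gt0 e0 (ltr0n _ 2)).
exists [seq (x +i* y)%C | x <- l, y <- l] => -[a b] ab.
have hab : `|a| <= B /\ `|b| <= B.
  by split; apply: le_trans ab; rewrite /= -sqrtr_sqr ler_wsqrtr// ?lerDl ?lerDr sqr_ge0.
have [x xl hx] := hl a hab.1; have [y yl hy] := hl b hab.2.
exists (x +i* y)%C; first by apply/allpairsP; exists (x, y).
have -> : ((a +i* b) - (x +i* y) = ((a - x)%:C + (0 +i* (b - y))))%C.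
  by apply/eqP; rewrite eq_complex /= add0r addr0 !eqxx.
apply: le_trans (le_normcD _ _) _; rewrite /= !expr0n !add0r !addr0 !sqrtr_sqr.
by move: hx hy; lra.
Qed.

End modulus.

(** * Norming functionals *)

Section hahn_banach.
Variables (R : realType) (s : scalars).
Local Notation K := (scalar_field R s).

Definition real_scalar (t : R) : K :=
  match s with
  | RealScalars => t
  | ComplexScalars => (t%:C)%C
  end.

Lemma real_scalarD t u : real_scalar (t + u) = real_scalar t + real_scalar u.
Proof.
by rewrite /real_scalar; case: s => //=; apply/eqP; rewrite eq_complex /= addr0 !eqxx.
Qed.

Lemma real_scalarM t u : real_scalar (t * u) = real_scalar t * real_scalar u.
Proof. by rewrite /real_scalar; case: s => //=; rewrite -rmorphM. Qed.

Lemma real_scalar1 : real_scalar 1 = 1.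
Proof. by rewrite /real_scalar; case: s. Qed.

Lemma modulus_real t : modulus (real_scalar t) = `|t|.
Proof.
by rewrite /real_scalar; case: s => //=; rewrite expr0n addr0 sqrtr_sqr.
Qed.

Variable V : lmodType K.
Implicit Types (q g : V -> R).

Definition sublinear q :=
  (forall x y, q (x + y) <= q x + q y) /\
  (forall t x, 0 <= t -> q (real_scalar t *: x) <= t * q x).

Lemma real_scalar0 : real_scalar 0 = 0.
Proof. by apply: (addrI (real_scalar 0)); rewrite -real_scalarD !addr0. Qed.

Lemma sublinear0 q : sublinear q -> q 0 = 0.
Proof.
move=> [qD qZ]; apply/eqP; rewrite eq_le; apply/andP; split.
  by have := qZ 0 0 (lexx _); rewrite mul0r scaler0.
by have := qD 0 0; rewrite addr0; lra.
Qed.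

Lemma seminorm_sublinear q : seminorm q -> sublinear q.
Proof.
by move=> [_ qZ qD]; split=> // t x t0; rewrite qZ modulus_real ger0_norm.
Qed.

(** The largest sublinear minorant of [q] that is additive in the direction [w]. *)
Definition flatten_along q w x :=
  inf [set q (x + real_scalar t *: w) - t * q w | t in [set t | 0 <= t]].

Lemma flatten_along_le q w x t : sublinear q -> 0 <= t ->
  flatten_along q w x <= q (x + real_scalar t *: w) - t * q w.
Proof.
move=> [qD qZ] t0; apply: ge_inf; last by exists t.
exists (- q (- x)) => _ [u u0 <-].
suff : u * q w <= q (x + real_scalar u *: w) + q (- x) by lra.
apply: le_trans (qD _ _); rewrite addrAC subrr add0r.
have [->|un0] := eqVneq u 0.
  by rewrite mul0r real_scalar0 scale0r sublinear0.
have u1 : 0 < u by rewrite lt0r un0.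
rewrite mulrC -ler_pdivlMr // mulrC.
apply: le_trans (qZ _ _ _); last by rewrite invr_ge0.
by rewrite scalerA -real_scalarM mulVf // real_scalar1 scale1r.
Qed.

Lemma le_flatten_along q w x m : sublinear q ->
  (forall t, 0 <= t -> m <= q (x + real_scalar t *: w) - t * q w) ->
  m <= flatten_along q w x.
Proof.
move=> hq hm; apply: lb_le_inf; last by move=> _ [t t0 <-]; exact: hm.
by exists (q (x + real_scalar 0 *: w) - 0 * q w); exists 0 => //=.
Qed.

Lemma flatten_along_sublinear q w : sublinear q -> sublinear (flatten_along q w).
Proof.
move=> hq; have [qD qZ] := hq; split=> [x y|t x t0].
  rewrite -lerBlDr; apply: le_flatten_along => // t t0.
  rewrite lerBlDl -lerBlDr; apply: le_flatten_along => // u u0.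
  rewrite lerBlDr.
  apply: le_trans (flatten_along_le _ _ hq (addr_ge0 t0 u0)) _.
  rewrite mulrDl real_scalarD scalerDl.
  have := qD (x + real_scalar t *: w) (y + real_scalar u *: w).
  by rewrite addrACA; lra.
have [->|tn0] := eqVneq t 0.
  have := flatten_along_le w 0 hq (lexx 0).
  by rewrite real_scalar0 !scale0r !mul0r addr0 subr0 (sublinear0 hq).
have t1 : 0 < t by rewrite lt0r tn0.
rewrite mulrC -ler_pdivrMr //; apply: le_flatten_along => // u u0.
rewrite ler_pdivrMr //.
apply: le_trans (flatten_along_le _ _ hq (mulr_ge0 t0 u0)) _.
rewrite real_scalarM -scalerA -scalerDr.
by have := qZ t (x + real_scalar u *: w) t0; lra.
Qed.

Lemma flatten_along_id q w x : sublinear q -> flatten_along q w x <= q x.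
Proof.
move=> hq; have := flatten_along_le w x hq (lexx 0).
by rewrite real_scalar0 scale0r mul0r addr0 subr0.
Qed.

(** Complex functionals are represented by their real parts. *)
Definition real_linear g :=
  (forall x y, g (x + y) = g x + g y) /\
  (forall t x, g (real_scalar t *: x) = t * g x).

(** Minimal sublinear functionals are linear, because flattening one of them cannot
    decrease it; Zorn's lemma provides one below [q]. *)
Lemma linear_minorant q : sublinear q ->
  exists g, real_linear g /\ forall x, g x <= q x.
Proof.
move=> hq.
pose T := {p : V -> R | sublinear p /\ forall x, p x <= q x}.
pose below (p r : T) := `[< forall x, sval r x <= sval p x >].
have lbP (p : T) x : - q (- x) <= sval p x.
  case: p => p [hp pq] /=; have := hp.1 x (- x); rewrite subrr sublinear0 //.
  by have := pq (- x); lra.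
have [| | | |m hm] := @Zorn T below.
- by move=> p; apply/asboolP.
- move=> p r t /asboolP pr /asboolP rt; apply/asboolP => x.
  exact: le_trans (rt x) (pr x).
- move=> [p hp] [r hr] /asboolP pr /asboolP rp; apply: eq_exist.
  by apply/funext => x; apply/eqP; rewrite eq_le; apply/andP; split; [exact: rp|exact: pr].
- move=> A totA.
  have [[p0 Ap0]|nA] := pselect (exists p, A p); last first.
    exists (exist _ q (conj hq (fun x => lexx _))) => p Ap.
    by exfalso; apply: nA; exists p.
  pose r x := inf [set sval p x | p in A].
  have rle p x : A p -> r x <= sval p x.
    move=> Ap; apply: ge_inf; last by exists p.
    by exists (- q (- x)) => _ [p' _ <-].
  have rge m x : (forall p, A p -> m <= sval p x) -> m <= r x.
    move=> h; apply: lb_le_inf; first by exists (sval p0 x), p0.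
    by move=> _ [p Ap <-]; exact: h.
  have hr : sublinear r /\ forall x, r x <= q x.
    split; last by move=> x; apply: le_trans (rle _ _ Ap0) _; exact: (svalP p0).2.
    split=> [x y|t x t0].
      rewrite -lerBlDr; apply: (rge) => p Ap.
      rewrite lerBlDl -lerBlDr; apply: (rge) => p' Ap'; rewrite lerBlDr.
      have [/asboolP h|/asboolP h] := totA _ _ Ap Ap'.
        apply: le_trans (rle _ _ Ap') _; rewrite [leRHS]addrC.
        by apply: le_trans ((svalP p').1.1 _ _) _; rewrite lerD2r.
      apply: le_trans (rle _ _ Ap) _; rewrite [leRHS]addrC.
      by apply: le_trans ((svalP p).1.1 _ _) _; rewrite lerD2l.
    have [->|tn0] := eqVneq t 0.
      apply: le_trans (rle _ _ Ap0) _; rewrite real_scalar0 scale0r mul0r.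
      by rewrite sublinear0 //; exact: (svalP p0).1.
    have t1 : 0 < t by rewrite lt0r tn0.
    rewrite mulrC -ler_pdivrMr //; apply: (rge) => p Ap.
    rewrite ler_pdivrMr // mulrC; apply: le_trans (rle _ _ Ap) _.
    exact: (svalP p).1.2.
  by exists (exist _ r hr) => p Ap; apply/asboolP => x; exact: rle.
have gsub := (svalP m).1; have gq := (svalP m).2; set g := sval m in gsub gq.
have gflat w : flatten_along g w = g.
  have hw : sublinear (flatten_along g w) /\ forall x, flatten_along g w x <= q x.
    split; first exact: flatten_along_sublinear.
    by move=> x; apply: le_trans (flatten_along_id _ _ gsub) (gq x).
  pose f : T := exist (fun p => sublinear p /\ forall x, p x <= q x) _ hw.
  rewrite -[LHS]/(sval f); congr sval; apply: hm.
  by apply/asboolP => x /=; exact: flatten_along_id.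
have gD x y : g (x + y) = g x + g y.
  apply/eqP; rewrite eq_le gsub.1 /=.
  have := flatten_along_le y x gsub (ler01); rewrite gflat real_scalar1 scale1r mul1r.
  lra.
have gN x : g (- x) = - g x.
  by have := gD x (- x); rewrite subrr sublinear0 //; lra.
have gZ t x : 0 <= t -> g (real_scalar t *: x) = t * g x.
  move=> t0; apply/eqP; rewrite eq_le gsub.2 //=.
  by have := gsub.2 t (- x) t0; rewrite scalerN !gN; lra.
exists g; split => //; split => // t x; have [t0|t0] := leP 0 t; first exact: gZ.
have -> : real_scalar t *: x = - (real_scalar (- t) *: x).
  rewrite -scaleNr; congr (_ *: _); apply: (addIr (real_scalar (- t))).
  by rewrite -real_scalarD subrr real_scalar0 addNr.
by rewrite gN gZ; lra.
Qed.

(** A linear minorant of [flatten_along q w] rather than of [q] takes the value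
    [q w] at [w]. *)
Lemma norming_functional q w : seminorm q ->
  exists g, [/\ real_linear g, forall x, g x <= q x & g w = q w].
Proof.
move=> /seminorm_sublinear hq.
have [g [gl gq]] := linear_minorant (flatten_along_sublinear w hq).
have gle x : g x <= q x by apply: le_trans (gq x) (flatten_along_id _ _ hq).
exists g; split=> //; apply/eqP; rewrite eq_le gle /=.
have := le_trans (gq (- w)) (flatten_along_le w (- w) hq ler01).
rewrite real_scalar1 scale1r addNr sublinear0 // mul1r.
have := gl.1 w (- w); rewrite subrr.
by have := gl.2 0 0; rewrite scaler0 mul0r; lra.
Qed.

End hahn_banach.

(** * Seminorms and Frechet spaces *)

Section seminorm_facts.
Variables (R : realType) (s : scalars).
Local Notation K := (scalar_field R s).
Variables (V : lmodType K) (q : V -> R).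
Hypothesis hq : seminorm q.

Lemma seminorm_ge0 x : 0 <= q x. Proof. by case: hq. Qed.
Lemma seminormZ (a : K) x : q (a *: x) = modulus a * q x. Proof. by case: hq. Qed.
Lemma seminormD x y : q (x + y) <= q x + q y. Proof. by case: hq. Qed.
Lemma seminorm0 : q 0 = 0.
Proof. by rewrite -(scale0r 0) seminormZ modulus0 mul0r. Qed.
Lemma seminormN x : q (- x) = q x.
Proof. by rewrite -scaleN1r seminormZ modulusN modulus1 mul1r. Qed.
Lemma seminormB x y : q (x - y) <= q x + q y.
Proof. by rewrite -(seminormN y) seminormD. Qed.
Lemma seminorm_distC x y : q (x - y) = q (y - x).
Proof. by rewrite -seminormN opprB. Qed.
Lemma seminorm_leB x y : q x - q y <= q (x - y).
Proof. by have := seminormD (x - y) y; rewrite subrK; lra. Qed.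
Lemma seminorm_sum (I : Type) (r : seq I) (P : pred I) (F : I -> V) :
  q (\sum_(i <- r | P i) F i) <= \sum_(i <- r | P i) q (F i).
Proof.
elim/big_rec2: _ => [|i x y _ le]; first by rewrite seminorm0.
by apply: le_trans (seminormD _ _) _; rewrite lerD2l.
Qed.
End seminorm_facts.

Section frechet.
Variables (R : realType) (s : scalars).
Local Notation K := (scalar_field R s).
Variables (X : topologicalLmodType K) (p : nat -> X -> R).
Hypothesis hX : frechet_space p.

Let hp j : seminorm (p j). Proof. exact: frechet_seminorm hX j. Qed.

Lemma frechet_le i j x : (i <= j)%N -> p i x <= p j x.
Proof.
elim: j => [|j IH]; first by rewrite leqn0 => /eqP ->.
rewrite leq_eqVlt => /orP[/eqP -> //|ij].
by apply: le_trans (IH ij) _; exact: frechet_nondecreasing hX j x.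
Qed.

Local Notation term x y := (fun j => 2^-1 ^+ j.+1 * Num.min 1 (p j (x - y)) : R).

Let half_gt0 n : 0 < 2^-1 ^+ n :> R. Proof. by rewrite exprn_gt0 // invr_gt0. Qed.

Let halfS n : 2^-1 ^+ n = 2^-1 ^+ n.+1 + 2^-1 ^+ n.+1 :> R.
Proof. by rewrite exprS; lra. Qed.

Let term_ge0 x y j : 0 <= term x y j.
Proof.
by apply: mulr_ge0; [exact: ltW|rewrite le_min ler01 (seminorm_ge0 (hp j))].
Qed.

Let dist_cvg x y : cvgn (series (term x y)).
Proof.
apply: nondecreasing_is_cvgn; first by apply: nondecreasing_series => i _ _; exact: term_ge0.
exists 1 => _ [n _ <-]; rewrite /series /=.
suff : \sum_(0 <= j < n) term x y j <= 1 - 2^-1 ^+ n.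
  by move=> /le_trans; apply; have := half_gt0 n; lra.
elim: n => [|n IH]; first by rewrite big_geq // expr0 subrr.
rewrite big_nat_recr //=.
have : term x y n <= 2^-1 ^+ n.+1 by rewrite /= ler_piMr // ge_min lexx.
by move: IH; rewrite (halfS n) /=; lra.
Qed.

Lemma frechet_dist_ge x y j :
  2^-1 ^+ j.+1 * Num.min 1 (p j (x - y)) <= frechet_dist p x y.
Proof.
have nd : nondecreasing_seq (series (term x y)).
  by apply: nondecreasing_series => i _ _; exact: term_ge0.
rewrite /frechet_dist; apply: le_trans (nondecreasing_cvgn_le nd (@dist_cvg x y) j.+1).
by rewrite /series /= big_nat_recr //= lerDr; apply: sumr_ge0 => i _; exact: term_ge0.
Qed.

(** The terms before [N] add up to at most [e], since the seminorms do not decrease,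
    and the others to at most the tail of the geometric series. *)
Lemma frechet_dist_le x y N (e : R) : 0 <= e -> p N (x - y) <= e ->
  frechet_dist p x y <= e + 2^-1 ^+ N.
Proof.
move=> e0 he; apply: limr_le; first exact: dist_cvg.
apply: nearW => n; rewrite /series /=.
have lt n' : (n' <= N)%N -> \sum_(0 <= j < n') term x y j <= e * (1 - 2^-1 ^+ n').
  elim: n' => [|k IH] kN; first by rewrite big_geq // expr0 subrr mulr0.
  rewrite big_nat_recr //=.
  have : term x y k <= 2^-1 ^+ k.+1 * e.
    rewrite /= ler_wpM2l //.
    rewrite ge_min; apply/orP; right.
    by apply: le_trans he; apply: frechet_le; exact: ltnW.
  by move: (IH (ltnW kN)); rewrite (halfS k) /=; lra.
have gt k : \sum_(0 <= j < N + k) term x y j <= e + 2^-1 ^+ N - 2^-1 ^+ (N + k).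
  elim: k => [|k IH].
    rewrite addn0 addrK; apply: le_trans (lt _ (leqnn N)) _.
    by rewrite ler_piMr // gerBl ltW.
  rewrite addnS big_nat_recr //=.
  have : term x y (N + k)%N <= 2^-1 ^+ (N + k).+1 by rewrite /= ler_piMr // ge_min lexx.
  by move: IH; rewrite (halfS (N + k)) /=; lra.
have [nN|Nn] := leqP n N.
  apply: le_trans (lt _ nN) _; have := half_gt0 n; have := half_gt0 N.
  have : 0 <= e * 2^-1 ^+ n by rewrite mulr_ge0 // ltW.
  by lra.
rewrite -(subnKC (ltnW Nn)); apply: le_trans (gt _) _.
by have := half_gt0 (N + (n - N))%N; lra.
Qed.

Lemma half_small (e : R) : 0 < e -> exists n, 2^-1 ^+ n < e.
Proof.
move=> e0; have := @cvg_geometric R 1 2^-1.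
rewrite ger0_norm ?invr_ge0 // => /(_ _) /cvgrPdist_lt => /(_ _ e e0).
case; first by lra.
move=> N _ /(_ N (leqnn N)) /=; rewrite sub0r normrN mul1r ger0_norm ?ltW //.
by exists N.
Qed.

(** Sequential completeness for the seminorms instead of the metric. *)
Lemma frechet_cauchy_cvg (u : nat -> X) :
  (forall j (e : R), 0 < e -> exists N, forall m n,
     (N <= m)%N -> (N <= n)%N -> p j (u m - u n) < e) ->
  exists l, forall j (e : R), 0 < e -> exists N, forall n,
    (N <= n)%N -> p j (u n - l) < e.
Proof.
move=> hu; have [|l hl] := @frechet_complete _ _ _ _ hX u.
  move=> e e0; have e2 : 0 < e / 2 by rewrite divr_gt0.
  have [k hk] := half_small e2; have [N hN] := hu k _ e2.
  exists N => m n Nm Nn; apply: le_lt_trans (frechet_dist_le _ (ltW (hN m n Nm Nn))) _.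
    exact: ltW.
  by move: hk; lra.
exists l => j e e0.
have [|N hN] := hl (2^-1 ^+ j.+1 * Num.min 1 e).
  by rewrite mulr_gt0 // lt_min ltr01.
exists N => n /hN /(le_lt_trans (frechet_dist_ge (u n) l j)).
rewrite ltr_pM2l // lt_min => /andP[].
by rewrite !gt_min ltxx /= => p1 /orP[|//]; exact: lt_trans.
Qed.

Lemma frechet_nbhsP (x : X) (U : set X) : nbhs x U <->
  exists j (e : R), 0 < e /\ forall y, p j (y - x) < e -> U y.
Proof.
rewrite (frechet_topology hX x U); split=> -[n [e [e0 h]]].
  exists n, e; split=> // y hy; apply: h => j jn /=.
  by apply: le_lt_trans hy; apply: frechet_le; exact: ltnW.
by exists n.+1, e; split=> // y /= hy; apply: h; exact: hy.
Qed.

Lemma frechet_closedP (F : set X) : closed F <->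
  forall x, (forall j (e : R), 0 < e -> exists2 y, F y & p j (y - x) < e) -> F x.
Proof.
split=> [cF x hx|hF x clx].
  apply: cF => U /frechet_nbhsP[j [e [e0 h]]].
  by have [y Fy hy] := hx j e e0; exists y; split=> //; exact: h.
apply: hF => j e e0.
have [|y [Fy hy]] := clx [set y | p j (y - x) < e]; last by exists y.
by apply/frechet_nbhsP; exists j, e.
Qed.

End frechet.

(** * Closed subspaces of finite codimension *)

Section kernels.
Variables (R : realType).

(** The kernel of the scalar functional whose real part is [g]. *)
Definition kernel s (V : lmodType (scalar_field R s)) (g : V -> R) : set V :=
  [set y | forall a : scalar_field R s, g (a *: y) = 0].

(** Over the complex numbers the coefficient [a] solves two real equations, one for
    [g] and one for [g] composed with the multiplication by i; their determinant is
    g(v)^2 + g(iv)^2. *)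
Lemma kernel_codim1 s (V : lmodType (scalar_field R s)) (g : V -> R) (v x : V) :
  real_linear g -> ~ kernel g v -> exists a, kernel g (x - a *: v).
Proof.
case: s V g v x => V g v x [gD gZ] nv; rewrite /real_scalar /= in gZ.
  have v0 : g v != 0 by apply/eqP => gv; apply: nv => a; rewrite gZ gv mulr0.
  exists (g x / g v) => b; rewrite gZ -scaleNr gD gZ mulNr divfK // subrr mulr0 //.
pose I : R[i] := (0 +i* 1)%C.
have gC (b : R[i]) y : g (b *: y) = complex.Re b * g y + complex.Im b * g (I *: y).
  rewrite -!gZ -gD scalerA -scalerDl; congr (g (_ *: _)).
  case: b => b1 b2; apply/eqP; rewrite eq_complex /=.
  by apply/andP; split; apply/eqP; ring.
have gI y : g (I *: (I *: y)) = - g y by rewrite gC /= mul0r add0r mul1r scalerA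
  (_ : I * I = (-1)%:C)%C ?gZ ?mulN1r //; apply/eqP; rewrite eq_complex /=;
  apply/andP; split; apply/eqP; ring.
pose P := g v; pose Q := g (I *: v); pose S := P ^+ 2 + Q ^+ 2.
have S0 : S != 0.
  apply/eqP => /eqP; rewrite paddr_eq0 ?sqr_ge0 // !sqrf_eq0 => /andP[/eqP P0 /eqP Q0].
  by apply: nv => a; rewrite gC -/P -/Q P0 Q0 !mulr0 addr0.
pose G := g x; pose H := g (I *: x).
pose a : R[i] := ((G * P + H * Q) / S +i* ((G * Q - H * P) / S))%C.
have gB y z : g (y - z) = g y - g z.
  by rewrite gD; congr (_ + _); rewrite -scaleN1r gC /= oppr0 mul0r addr0 mulN1r.
have h1 : g (x - a *: v) = 0.
  by rewrite gB (gC a) /= -/P -/Q -/G; move: S0; rewrite /S => S0; field.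
have h2 : g (I *: (x - a *: v)) = 0.
  rewrite scalerBr gB scalerA mulrC -scalerA (gC a) gI /= -/P -/Q -/H.
  by move: S0; rewrite /S => S0; field.
by exists a => b; rewrite gC h1 h2 !mulr0 addr0.
Qed.

End kernels.

Section cofinite.
Variables (R : realType) (s : scalars).
Local Notation K := (scalar_field R s).
Variables (X : topologicalLmodType K) (p : nat -> X -> R).
Hypothesis hX : frechet_space p.

Let hp j : seminorm (p j). Proof. exact: frechet_seminorm hX j. Qed.

(** The finite intersections of kernels of continuous functionals. The inductive
    form makes closedness and finite codimension a matter of adding one functional
    at a time. *)
Inductive cofinite : set X -> Prop :=
| cofinite_setT : cofinite setT
| cofinite_kernel F g j : real_linear g -> (forall x, g x <= p j x) ->
    cofinite F -> cofinite (F `&` kernel g).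

Lemma cofiniteI F G : cofinite F -> cofinite G -> cofinite (F `&` G).
Proof.
move=> hF; elim=> [|{}G g j gl gp _ IH]; first by rewrite setIT.
by rewrite setIA; exact: cofinite_kernel gl gp IH.
Qed.

Lemma cofinite0 F : cofinite F -> F 0.
Proof.
elim=> // {}F g j gl gp _ F0; split=> // a.
by rewrite scaler0; have := gl.2 0 0; rewrite scaler0 mul0r.
Qed.

Lemma cofinite_lin F (a : K) x y : cofinite F -> F x -> F y -> F (a *: x + y).
Proof.
elim=> // {}F g j gl gp _ IH [Fx gx] [Fy gy]; split; first exact: IH.
by move=> b; rewrite scalerDr scalerA gl.1 gx gy addr0.
Qed.

Lemma cofiniteZ F (a : K) x : cofinite F -> F x -> F (a *: x).
Proof. by move=> hF Fx; rewrite -(addr0 (_ *: _)); apply: cofinite_lin => //; exact: cofinite0. Qed.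

Lemma real_linear_bounded g q x : seminorm q -> real_linear g ->
  (forall y : X, g y <= q y) -> `|g x| <= q x.
Proof.
move=> hq [gD gZ] gq; rewrite ler_norml gq andbT.
have := gq (- x); rewrite (seminormN hq).
have := gD x (- x); rewrite subrr.
by have h := gZ 0 0; rewrite scaler0 mul0r in h; lra.
Qed.

Lemma cofinite_closed F : cofinite F -> closed F.
Proof.
move=> hF; apply/(frechet_closedP hX) => x.
elim: hF => // {}F g j gl gp _ IH hx; split.
  by apply: IH => i e e0; have [y [Fy _] hy] := hx i e e0; exists y.
move=> a; apply/normr0_eq0/eqP; rewrite eq_le normr_ge0 andbT.
apply/ler_addgt0Pl => e e0; rewrite addr0.
have ma : 0 < modulus a + 1 by have := modulus_ge0 a; lra.
have [y [_ gy] hy] := hx j (e / (modulus a + 1)) (divr_gt0 e0 ma).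
have -> : g (a *: x) = g (a *: (x - y)).
  rewrite scalerBr gl.1 -(scaleN1r (a *: y)) scalerA mulN1r gy addr0 //.
apply: le_trans (real_linear_bounded _ (hp j) gl gp) _.
rewrite (seminormZ (hp j)) (seminorm_distC (hp j)).
have m0 := modulus_ge0 a.
have /(ler_wpM2l m0) : p j (y - x) <= e / (modulus a + 1) by exact: ltW.
move=> /le_trans; apply; rewrite mulrCA ler_piMr ?(ltW e0) //.
by rewrite ler_pdivrMr // mul1r lerDl.
Qed.

Lemma cofinite_codim F : cofinite F -> exists n (v : 'I_n -> X),
  forall x, exists a : 'I_n -> K, F (x - \sum_i a i *: v i).
Proof.
elim=> [|{}F g j gl gp hF [n [v hv]]].
  by exists 0%N, (fun=> 0) => x; exists (fun=> 0).
have [sub|/existsNP[w /not_implyP[Fw nw]]] := pselect (forall w, F w -> kernel g w).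
  by exists n, v => x; have [a ha] := hv x; exists a; split=> //; exact: sub.
exists n.+1, (fun i => if unlift ord0 i is Some k then v k else w) => x.
have [a ha] := hv x; have [b hb] := kernel_codim1 (x - \sum_i a i *: v i) gl nw.
exists (fun i => if unlift ord0 i is Some k then a k else b).
rewrite big_ord_recl unlift_none (eq_bigr (fun i => a i *: v i)); last first.
  by move=> i _; rewrite liftK.
rewrite opprD addrCA addrC; split=> //.
by rewrite -scaleNr addrC; exact: cofinite_lin.
Qed.

Hypothesis hne : forall (j : nat) (E : submodClosed X),
  closed [set` E] -> finite_codimensional E -> ~ equivalent_on E (p j) (p j.+1).

(** Otherwise [p j] and [p j.+1] would be equivalent on [F], because [p j <= p j.+1]
    holds everywhere. *)
Lemma cofinite_ratio F j (C : R) : cofinite F -> exists2 y, F y & C * p j y < p j.+1 y.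
Proof.
move=> hF.
pose P : {pred X} := fun x => `[<F x>].
have hP : GRing.submod_closed P.
  split; first by apply/asboolP; exact: cofinite0.
  by move=> a x y /asboolP Fx /asboolP Fy; apply/asboolP; exact: cofinite_lin.
pose E := HB.pack_for (submodClosed X) P (GRing.isSubmodClosed.Build K X P hP).
have memE x : (x \in E) <-> F x by split=> /asboolP.
apply: contrapT => nex; apply: (hne (j := j) (E := E)).
- rewrite (_ : [set` E] = F); first exact: cofinite_closed.
  by rewrite predeqE => x; exact: memE.
- have [n [v hv]] := cofinite_codim hF; exists n, v => x.
  by have [a ha] := hv x; exists a; apply/memE.
exists 1, (Num.max C 1); split=> //; first by rewrite lt_max ltr01 orbT.
move=> x /memE Fx; rewrite mul1r (frechet_nondecreasing hX) /=.
rewrite leNgt; apply/negP => hlt; apply: nex; exists x => //.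
apply: le_lt_trans hlt; rewrite ler_wpM2r ?(seminorm_ge0 (hp j)) //.
by rewrite le_max lexx.
Qed.

Local Notation pi j := (p j.+1).

(** A suitable multiple of a vector given by [cofinite_ratio] satisfies the two
    estimates; if [p 1] vanishes on it, a small multiple of a vector of [F] on which
    [p 1] does not vanish is added. Such a vector exists because of the pair [p 0],
    [p 1], which is why the seminorms are renumbered from [p 1] on. *)
Lemma cofinite_select F i (e M : R) : cofinite F -> 0 < e ->
  exists w, [/\ F w, 0 < pi 0 w, pi i w <= e & M <= pi i.+1 w].
Proof.
move=> hF e0.
have hpi j : seminorm (pi j) by exact: hp.
pose M1 := Num.max M 0 + 1.
have M1p : 0 < M1 by rewrite ltr_wpDl // le_max lexx orbT.
have [y [Fy py1 py2]] : exists y, [/\ F y, pi i y <= e / 2 & M1 <= pi i.+1 y].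
  have [y Fy hy] := cofinite_ratio i.+1 (2 * M1 / e) hF.
  have py0 := seminorm_ge0 (hpi i) y.
  have pp : 0 < pi i.+1 y.
    by apply: le_lt_trans hy; rewrite mulr_ge0 // divr_ge0 ?mulr_ge0 // ltW.
  have [b hb] := modulus_surj s (divr_ge0 (ltW M1p) (ltW pp)).
  exists (b *: y); split; first exact: cofiniteZ.
    rewrite (seminormZ (hpi i)) hb mulrAC ler_pdivrMr //.
    move: hy; rewrite mulrAC ltr_pdivrMr // => hy.
    by move: hy; lra.
  by rewrite (seminormZ (hpi i.+1)) hb divfK // lt0r_neq0.
have MM1 : M + 1 <= M1 by rewrite lerD2r le_max lexx.
have [y0|ny0] := ltP 0 (pi 0 y).
  by exists y; split=> //; [lra|apply: le_trans py2; lra].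
have [g Fg hg] := cofinite_ratio 0 0 hF; rewrite mul0r in hg.
(* Any seminorm of index at most [i.+1] of [g] is less than [m]. *)
pose m := 1 + pi i.+1 g.
have m0 : 0 < m by have := seminorm_ge0 (hpi i.+1) g; rewrite /m; lra.
pose b0 := Num.min 1 (e / 2) / m.
have b00 : 0 < b0 by rewrite divr_gt0 // lt_min ltr01 divr_gt0.
have [b hb] := modulus_surj s (ltW b00).
have small j : (j <= i.+1)%N -> pi j (b *: g) <= Num.min 1 (e / 2).
  move=> ji; rewrite (seminormZ (hpi j)) hb.
  apply: (@le_trans _ _ (b0 * m)); last by rewrite divfK // lt0r_neq0.
  apply: ler_wpM2l; first exact: ltW.
  have /(frechet_le hX g) : (j.+1 <= i.+2)%N by [].
  by rewrite /m; lra.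
exists (y + b *: g); split.
- by rewrite addrC; exact: cofinite_lin.
- have := seminormB (hpi 0%N) (y + b *: g) y; rewrite addrAC subrr add0r.
  have := seminorm_ge0 (hpi 0%N) y.
  by rewrite (seminormZ (hpi 0%N)) hb; have := mulr_gt0 b00 hg; lra.
- apply: le_trans (seminormD (hpi i) _ _) _.
  by have := small i (leqnSn i); rewrite le_min => /andP[_]; lra.
- have := seminormB (hpi i.+1) (y + b *: g) (b *: g); rewrite addrK.
  by have := small i.+1 (leqnn _); rewrite le_min => /andP[h _]; lra.
Qed.

End cofinite.

(** * Selection of almost independent vectors *)

Section finite_bounds.
Variable R : realType.

Lemma fin_bound (f : nat -> R) N : exists2 M, 1 <= M & forall t, (t < N)%N -> f t <= M.
Proof.
elim: N => [|N [M M1 h]]; first by exists 1.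
exists (Num.max M (f N)); first by rewrite le_max M1.
move=> t; rewrite ltnS leq_eqVlt => /orP[/eqP ->|/h tM]; rewrite le_max ?lexx ?orbT //.
by rewrite tM.
Qed.

Lemma fin_pos (f : nat -> R) N : (forall t, (t < N)%N -> 0 < f t) ->
  exists2 e, 0 < e <= 1 & forall t, (t < N)%N -> e <= f t.
Proof.
move=> fp; have [M M1 hM] := fin_bound (fun t => (f t)^-1) N.
have M0 : 0 < M by lra.
exists M^-1; first by rewrite invr_gt0 M0 invf_le1.
by move=> t tN; rewrite -[leRHS]invrK lef_pV2 ?posrE ?invr_gt0 ?fp // hM.
Qed.

Lemma small_against (l : seq R) (r : R) : 0 < r ->
  exists2 z, 0 < z & forall w, w \in l -> z * w <= r.
Proof.
move=> r0; elim: l => [|a l [z z0 hz]]; first by exists 1.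
pose b := Num.max 1 a.
have b0 : 0 < b by rewrite lt_max ltr01.
exists (Num.min z (r / b)); first by rewrite lt_min z0 divr_gt0.
move=> w; rewrite in_cons => /orP[/eqP ->|wl].
  have : Num.min z (r / b) * b <= r.
    have : Num.min z (r / b) <= r / b by rewrite ge_min lexx orbT.
    by move/(ler_wpM2r (ltW b0)); rewrite divfK // lt0r_neq0.
  apply: le_trans; apply: ler_wpM2l; last by rewrite le_max lexx orbT.
  by rewrite le_min (ltW z0) divr_ge0 // ltW.
have [w0|w0] := leP 0 w.
  by apply: le_trans (hz w wl); rewrite ler_wpM2r // ge_min lexx.
apply: le_trans (ltW r0); rewrite mulr_ge0_le0 //; last exact: ltW.
by rewrite le_min (ltW z0) divr_ge0 // ltW.
Qed.

End finite_bounds.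

Section selection.
Variables (R : realType) (s : scalars).
Local Notation K := (scalar_field R s).

Lemma coef_net N (B e : R) : 0 < e -> exists l : seq {poly K},
  forall a : nat -> K, (forall i, (i < N)%N -> modulus (a i) <= B) ->
  exists2 Q, Q \in l & (size Q <= N)%N /\
    forall i, (i < N)%N -> modulus (a i - Q`_i) <= e.
Proof.
move=> e0; have [l0 h0] := modulus_net s B e0.
elim: N => [|N [l h]].
  exists [:: 0] => a _; exists 0; first by rewrite mem_head.
  by rewrite size_poly0.
exists [seq Q + b *: 'X^N | Q <- l, b <- l0] => a ha.
have [Q Ql [sQ hQ]] := h a (fun i iN => ha i (ltnW iN)).
have [b bl hb] := h0 (a N) (ha N (leqnn _)).
exists (Q + b *: 'X^N); first by apply/allpairsP; exists (Q, b).
split.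
  apply: leq_trans (size_polyD _ _) _; rewrite geq_max (leq_trans sQ) //=.
  by apply: leq_trans (size_scale_leq _ _) _; rewrite size_polyXn.
move=> i; rewrite ltnS leq_eqVlt coefD coefZ coefXn => /orP[/eqP ->|iN].
  by rewrite eqxx mulr1 nth_default // add0r.
by rewrite ltn_eqF // mulr0 addr0; exact: hQ.
Qed.

Variable V : lmodType K.

(** What the construction of the orbit uses of the space. In the application [cof]
    consists of closed subspaces of finite codimension and [pi] of the seminorms
    from the second one on. *)
Record selection_system (pi : nat -> V -> R) (cof : set V -> Prop) := {
  sel_seminorm : forall j, seminorm (pi j);
  sel_nondecreasing : forall i j x, (i <= j)%N -> pi i x <= pi j x;
  sel_setT : cof setT;
  sel_inter : forall F G, cof F -> cof G -> cof (F `&` G);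
  sel_zero : forall F, cof F -> F 0;
  sel_linear : forall F (a : K) x y, cof F -> F x -> F y -> F (a *: x + y);
  sel_norming : forall j w, exists F g, [/\ cof F, forall y, F y -> g y = 0,
    forall x y, g (x + y) = g x + g y, forall x, `|g x| <= pi j x & g w = pi j w];
  sel_select : forall F i (e M : R), cof F -> 0 < e ->
    exists w, [/\ F w, 0 < pi 0 w, pi i w <= e & M <= pi i.+1 w]
}.

Definition lincomb (v : nat -> V) (a : nat -> K) N := \sum_(k < N) a k *: v k.

Lemma lincomb_split (u : nat -> V) (a : nat -> K) k N :
  lincomb u a (k + N) = lincomb u a k + lincomb (fun i => u (k + i)%N) (fun i => a (k + i)%N) N.
Proof. by rewrite /lincomb big_split_ord. Qed.

Variables (pi : nat -> V -> R) (cof : set V -> Prop).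
Hypothesis sel : selection_system pi cof.

Let hpi j : seminorm (pi j). Proof. exact: sel_seminorm sel j. Qed.
Let pi_ge0 j x : 0 <= pi j x. Proof. exact: seminorm_ge0. Qed.

Lemma sel_bigI (T : eqType) (l : seq T) (G : T -> set V) :
  (forall b, b \in l -> cof (G b)) ->
  cof [set y | forall b, b \in l -> G b y].
Proof.
elim: l => [|b l IH] h.
  by rewrite (_ : mkset _ = setT) ?predeqE //; exact: sel_setT sel.
rewrite (_ : mkset _ = [set y | forall b, b \in l -> G b y] `&` G b).
  apply: (sel_inter sel); last by apply: h; rewrite mem_head.
  by apply: IH => c cl; apply: h; rewrite in_cons cl orbT.
rewrite predeqE => y; split=> [hy|[h1 h2] c].
  by split; [move=> c cl|]; apply: hy; rewrite in_cons ?cl ?orbT ?eqxx.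
by rewrite in_cons => /orP[/eqP ->|/h1].
Qed.

Lemma sel_add F x y : cof F -> F x -> F y -> F (x + y).
Proof. by move=> hF Fx Fy; rewrite -(scale1r x); exact: sel_linear sel _ _ _ _ hF Fx Fy. Qed.

Lemma sel_scale F (a : K) x : cof F -> F x -> F (a *: x).
Proof.
move=> hF Fx; rewrite -(addr0 (_ *: _)); apply: (sel_linear sel) => //.
exact: sel_zero sel _ hF.
Qed.

Lemma sel_lincomb F v a N : cof F -> (forall t, (t < N)%N -> F (v t)) -> F (lincomb v a N).
Proof.
move=> hF h; apply: big_ind => [|x y|i _]; first exact: sel_zero sel _ hF.
  exact: sel_add.
by apply: sel_scale => //; exact: h.
Qed.

Lemma pi_lincomb j v a N :
  pi j (lincomb v a N) <= \sum_(k < N) modulus (a k) * pi j (v k).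
Proof.
apply: le_trans (seminorm_sum (hpi j) _ _ _) _; apply: ler_sum => k _.
by rewrite seminormZ.
Qed.

(** Mazur's lemma. The unit sphere of the span of [v 0], ..., [v N.-1] is covered by
    finitely many small balls, and on the common kernel of functionals that norm
    their centres adding [y] cannot shrink a vector of the span by more than a
    factor 2. The hypothesis, a bound of the coordinates by the smallest seminorm,
    is what makes the sphere totally bounded. *)
Lemma almost_orthogonal N J v (B : R) :
  (forall a t, (t < N)%N -> modulus (a t) <= B * pi 0 (lincomb v a N)) ->
  exists F, cof F /\ forall a j y, (j <= J)%N -> F y ->
    pi j (lincomb v a N) <= 2 * pi j (lincomb v a N + y).
Proof.
move=> hB; pose m := 1 + \sum_(k < N) pi J (v k).
have m0 : 0 < m.
  by rewrite ltr_wpDr // sumr_ge0.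
have [l hl] := coef_net N B (divr_gt0 ltr01 (mulr_gt0 (ltr0n _ 4) m0)).
pose norming (Q : {poly K}) (F : set V) := exists g : nat -> V -> R,
  [/\ forall j y, (j <= J)%N -> F y -> g j y = 0,
    forall j x y, g j (x + y) = g j x + g j y, forall j x, `|g j x| <= pi j x &
    forall j, g j (lincomb v (fun i => Q`_i) N) = pi j (lincomb v (fun i => Q`_i) N)].
have /choice[G hG] : forall Q, exists F, cof F /\ norming Q F.
  move=> Q; set w := lincomb v (fun i => Q`_i) N.
  have /choice[F /choice[g hg]] := fun j => sel_norming sel j w.
  have [H [cH hH]] : exists H, cof H /\ forall j, (j < J.+1)%N -> H `<=` F j.
    elim: J.+1 => [|n [H [cH hH]]]; first by exists setT; split=> //; exact: sel_setT sel.
    exists (H `&` F n); split; first by apply: sel_inter sel _ _ cH _; case: (hg n).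
    move=> j; rewrite ltnS leq_eqVlt => /orP[/eqP -> y []//|jn y [Hy _]].
    exact: hH jn _ Hy.
  exists H; split=> //; exists g; split=> j.
  - by move=> y jJ Hy; case: (hg j) => _ h _ _ _; apply: h; exact: hH Hy.
  - by case: (hg j).
  - by case: (hg j).
  - by case: (hg j).
exists [set y | forall b, b \in l -> G b y]; split.
  by apply: sel_bigI => b _; case: (hG b).
move=> a j y jJ Fy; set x := lincomb v a N.
have [/eqP x0|x0] := boolP (pi j x == 0).
  by rewrite x0 mulr_ge0.
have xp : 0 < pi j x by rewrite lt0r x0 pi_ge0.
(* Normalization: [b *: x] has seminorm 1, and its coordinates are bounded by [B]. *)
have [b hb] : exists b : K, modulus b = (pi j x)^-1.
  by apply: modulus_surj; rewrite invr_ge0 ltW.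
pose a' i := b * a i.
have xa' : lincomb v a' N = b *: x.
  by rewrite /x /lincomb scaler_sumr; apply: eq_bigr => k _; rewrite scalerA.
have nx' : pi j (b *: x) = 1 by rewrite (seminormZ (hpi j)) hb mulVf.
have B0 : 0 <= B \/ N = 0%N.
  case: (N) hB => [|n] hB; first by right.
  left; have := hB a' 0%N isT; rewrite leNgt => h; rewrite leNgt; apply/negP => Bn.
  move: h; apply/negP; rewrite negbK.
  have := hB (fun=> 1) 0%N isT; rewrite modulus1 => h1.
  have : B * pi 0 (lincomb v (fun=> 1) n.+1) <= 0 by rewrite mulr_le0_ge0 // ltW.
  by lra.
have ha' i : (i < N)%N -> modulus (a' i) <= B.
  move=> iN; apply: le_trans (hB a' i iN) _; rewrite xa'.
  have Bp : 0 <= B by case: B0 => // N0; rewrite N0 in iN.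
  by rewrite ler_piMr // -nx' (sel_nondecreasing sel).
have [Q Ql [sQ hQ]] := hl a' ha'.
have [cG [g [g1 g2 g3 g4]]] := hG Q.
set w := lincomb v (fun i => Q`_i) N in g4.
have close : pi j (b *: x - w) <= 1 / 4.
  rewrite -xa' /w /lincomb -sumrB.
  apply: le_trans (seminorm_sum (hpi j) _ _ _) _.
  apply: (@le_trans _ _ (\sum_(k < N) 1 / (4 * m) * pi J (v k))).
    apply: ler_sum => k _; rewrite -scalerBl (seminormZ (hpi j)).
    apply: ler_pM => //; [exact: modulus_ge0|exact: hQ|exact: sel_nondecreasing sel _ _ _ jJ].
  rewrite -mulr_sumr (_ : \sum_(k < N) _ = m - 1); last by rewrite /m addrC addKr.
  have -> : 1 / (4 * m) * (m - 1) = 1 / 4 - 1 / (4 * m) by field; rewrite lt0r_neq0.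
  by rewrite gerBl divr_ge0 // mulr_ge0 // ltW.
have gby : g j (b *: y) = 0.
  by apply: g1 => //; apply: sel_scale => //; exact: Fy.
have gB u z : g j (u - z) = g j u - g j z.
  by have := g2 j (u - z) z; rewrite subrK; lra.
(* The functional norming [w] sees [b *: x] up to 1/4 and does not see [y]. *)
have e1 : pi j (b *: (x + y)) >= 1 / 2.
  have := g3 j (b *: (x + y)); rewrite ler_norml => /andP[_].
  rewrite scalerDr g2 gby addr0.
  have := g3 j (b *: x - w); rewrite gB g4 ler_norml => /andP[h1 _].
  have := seminorm_leB (hpi j) (b *: x) w; rewrite nx'.
  by move: close h1; lra.
move: e1; rewrite (seminormZ (hpi j)) hb [_^-1 * pi j _]mulrC ler_pdivlMr // -/x.
by lra.
Qed.

Definition coord_bound N J (k : R) v := forall a j t, (j <= J)%N -> (t < N)%N ->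
  modulus (a t) * pi j (v t) <= k * pi j (lincomb v a N).

(** The coordinate bound obtained after [n] successive modifications of the vectors,
    see [coord_bound_update]. *)
Definition kappa n : R := iter n (fun k => 2 * k + 3) 0.

Lemma kappa_ge0 n : 0 <= kappa n.
Proof. by elim: n => //= n; lra. Qed.

Lemma kappa_le m n : (m <= n)%N -> kappa m <= kappa n.
Proof.
elim: n => [|n IH]; first by rewrite leqn0 => /eqP ->.
rewrite leq_eqVlt => /orP[/eqP -> //|/IH] /=.
by have := kappa_ge0 n; rewrite /=; lra.
Qed.

Definition update (v : nat -> V) t0 y t := if t == t0 then v t + y else v t.

Lemma lincomb_update v a N t0 y : (t0 < N)%N ->
  lincomb (update v t0 y) a N = lincomb v a N + a t0 *: y.
Proof.
move=> tN; rewrite /lincomb (bigD1 (Ordinal tN)) //= [in RHS](bigD1 (Ordinal tN)) //=.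
rewrite /update eqxx scalerDr -addrA [a t0 *: y + _]addrC addrA; congr (_ + _ + _).
by apply: eq_bigr => i /negbTE; rewrite -val_eqE /= => ->.
Qed.

(** Adding to one vector a [y] that is almost orthogonal to the whole span changes
    the coordinate bound [k] into [2 * k + 3], whatever the size of [y]: the
    coefficient of [y] is itself controlled. *)
Lemma coord_bound_update N J n v t0 y : (t0 < N)%N -> coord_bound N J (kappa n) v ->
  (forall a j, (j <= J)%N ->
    pi j (lincomb v a N) <= 2 * pi j (lincomb v a N + a t0 *: y)) ->
  coord_bound N J (kappa n.+1) (update v t0 y).
Proof.
move=> tN hv hm a j t jJ tN'; rewrite lincomb_update //.
set S := lincomb v a N; have m := hm a j jJ; rewrite -/S in m.
have k0 := kappa_ge0 n; have ht := hv a j t jJ tN'; rewrite -/S in ht.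
have y0 : modulus (a t0) * pi j y <= 3 * pi j (S + a t0 *: y).
  have := seminorm_leB (hpi j) (a t0 *: y) (- S).
  by rewrite opprK (seminormN (hpi j)) (addrC _ S) (seminormZ (hpi j)); lra.
have : kappa n * pi j S <= kappa n * (2 * pi j (S + a t0 *: y)) by rewrite ler_wpM2l.
have := pi_ge0 j (S + a t0 *: y).
rewrite /update; have [e|_] := eqVneq t t0; last by rewrite /=; lra.
have := ler_wpM2l (modulus_ge0 (a t)) (seminormD (hpi j) (v t) y).
by rewrite e /= in ht *; lra.
Qed.

Lemma coord_bound_ball N J k v : coord_bound N J k v -> 0 <= k ->
  (forall t, (t < N)%N -> 0 < pi 0 (v t)) ->
  exists B, forall a t, (t < N)%N -> modulus (a t) <= B * pi 0 (lincomb v a N).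
Proof.
move=> hv k0 vp; have [e /andP[e0 _] he] := fin_pos vp.
exists (k / e) => a t tN; rewrite mulrAC ler_pdivlMr //.
apply: le_trans (hv a 0%N t (leq0n _) tN).
by rewrite ler_wpM2l ?modulus_ge0 ?he.
Qed.

(** Each vector is chosen tiny for [pi J] with respect to the smallest seminorm of
    the vectors chosen before it. *)
Lemma floor_vectors F N J (e b : R) : cof F -> 0 < e -> 0 < b ->
  exists v, [/\ forall t, (t < N)%N -> F (v t) /\ 0 < pi 0 (v t),
    forall t, (t < N)%N -> pi J (v t) <= e * b,
    forall t m, (t < N)%N -> (m < t)%N -> pi J (v t) <= e * pi 0 (v m),
    forall t, (N <= t)%N -> v t = 0 & coord_bound N J (kappa N) v].
Proof.
move=> cF e0 b0; elim: N => [|N [v [h1 h2 h3 h4 h5]]].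
  by exists (fun=> 0); split=> // a j t.
have h1' t : (t < N)%N -> 0 < pi 0 (v t) by move=> /h1[].
have [B hB] := coord_bound_ball h5 (kappa_ge0 N) h1'.
have [G [cG hG]] := almost_orthogonal J hB.
have [d /andP[d0 _] hd] := fin_pos h1'.
have [|w [[Fw Gw] w0 wJ _]] := sel_select sel J 0 (e := e * Num.min b d) (sel_inter sel cF cG).
  by rewrite mulr_gt0 // lt_min b0.
have {wJ} [wb wd] : pi J w <= e * b /\ pi J w <= e * d.
  by split; apply: le_trans wJ _; rewrite ler_pM2l // ge_min lexx ?orbT.
have uE t : (t < N)%N -> update v N w t = v t by move=> tN; rewrite /update ltn_eqF.
have uN : update v N w N = w by rewrite /update eqxx h4 // add0r.
have lcS a : lincomb v a N.+1 = lincomb v a N.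
  by rewrite /lincomb big_ord_recr /= h4 // scaler0 addr0.
exists (update v N w); split.
- by move=> t; rewrite ltnS leq_eqVlt => /orP[/eqP ->|tN]; rewrite ?uN // uE //; exact: h1.
- by move=> t; rewrite ltnS leq_eqVlt => /orP[/eqP ->|tN]; rewrite ?uN // uE //; exact: h2.
- move=> t m; rewrite ltnS leq_eqVlt => /orP[/eqP ->|tN] mt.
    rewrite uN uE //; apply: le_trans wd _; rewrite ler_pM2l //; exact: hd.
  by rewrite !uE //; [exact: h3|exact: ltn_trans tN].
- by move=> t Nt; rewrite /update gtn_eqF // h4 // ltnW.
- apply: coord_bound_update => //.
    move=> a j t jJ; rewrite lcS ltnS leq_eqVlt => /orP[/eqP ->|tN]; last exact: h5.
    by rewrite h4 // (seminorm0 (hpi j)) mulr0 mulr_ge0 // kappa_ge0.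
  move=> a j jJ; rewrite lcS; apply: hG => //; exact: sel_scale.
Qed.

(** To the vectors selected by [L] are added vectors that are small for [pi i] and
    large for [pi i.+1]; only the seminorms of index above [i] are changed
    noticeably. *)
Lemma level_step F N J n v i (L : pred nat) (e M : R) : cof F -> 0 < e ->
  coord_bound N J (kappa n) v ->
  (forall t, (t < N)%N -> F (v t) /\ 0 < pi 0 (v t)) ->
  exists v', [/\ coord_bound N J (kappa (n + N)) v',
    forall t, (t < N)%N -> F (v' t) /\ 0 < pi 0 (v' t) &
    forall t, (t < N)%N -> exists y, [/\ v' t = v t + y, pi i y <= e,
      ~~ L t -> y = 0 & L t -> M <= pi i.+1 y]].
Proof.
move=> cF e0 hv hp.
suff : forall r, (r <= N)%N -> exists v', [/\ coord_bound N J (kappa (n + r)) v',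
    forall t, (t < N)%N -> F (v' t) /\ 0 < pi 0 (v' t),
    forall t, (r <= t)%N -> v' t = v t &
    forall t, (t < r)%N -> exists y, [/\ v' t = v t + y, pi i y <= e,
      ~~ L t -> y = 0 & L t -> M <= pi i.+1 y]].
  by move=> /(_ N (leqnn N))[v' [h1 h2 h3 h4]]; exists v'.
elim=> [_|r IH rN].
  by exists v; rewrite addn0; split.
have [v' [h1 h2 h3 h4]] := IH (ltnW rN).
have [Lr|nLr] := boolP (L r); last first.
  exists v'; split => //.
  - move=> a j t jJ tN; apply: le_trans (h1 a j t jJ tN) _.
    by rewrite ler_wpM2r // kappa_le // leq_add2l.
  - by move=> t rt; apply: h3; exact: ltnW.
  - move=> t; rewrite ltnS leq_eqVlt => /orP[/eqP ->|]; last exact: h4.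
    exists 0; rewrite addr0 h3 // (seminorm0 (hpi i)); split=> //; first exact: ltW.
    by move=> Lr; rewrite Lr in nLr.
have h2' t : (t < N)%N -> 0 < pi 0 (v' t) by move=> /h2[].
have [B hB] := coord_bound_ball h1 (kappa_ge0 _) h2'.
have [G [cG hG]] := almost_orthogonal J hB.
have [w [[Fw Gw] w0 wi wM]] := sel_select sel i M (sel_inter sel cF cG) e0.
exists (update v' r w); rewrite addnS; split.
- apply: coord_bound_update => //.
  by move=> a j jJ; apply: hG => //; exact: sel_scale.
- move=> t tN; rewrite /update; case: ifP => [/eqP tr|_]; last exact: h2.
  split; first by apply: sel_add => //; case: (h2 t tN).
  have := hG (fun k => if k == t then 1 else 0) 0%N w (leq0n _) Gw.
  rewrite /lincomb (bigD1 (Ordinal tN)) //= eqxx scale1r big1 ?addr0; last first.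
    by move=> k /negbTE; rewrite -val_eqE /= => ->; rewrite scale0r.
  by have := h2' t tN; lra.
- by move=> t rt; rewrite /update gtn_eqF // h3 // ltnW.
- move=> t; rewrite ltnS leq_eqVlt /update => /orP[/eqP ->|tr].
    by rewrite eqxx; exists w; rewrite h3 //; split => //; rewrite Lr.
  by rewrite ltn_eqF //; exact: h4.
Qed.

End selection.

(** * The vectors of one block *)

Section event.
Variables (R : realType) (s : scalars).
Local Notation K := (scalar_field R s).
Variables (V : lmodType K) (pi : nat -> V -> R) (cof : set V -> Prop).
Hypothesis sel : selection_system pi cof.

Let hpi j : seminorm (pi j). Proof. exact: sel_seminorm sel j. Qed.
Let pi_ge0 j x : 0 <= pi j x. Proof. exact: seminorm_ge0. Qed.
Let pi_le i j x : (i <= j)%N -> pi i x <= pi j x.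
Proof. exact: sel_nondecreasing sel i j x. Qed.

(** The vectors of a block, with [lv t] the level of the [t]-th one. One starts from
    [floor_vectors]; then, for i = 0, ..., J, every vector of level at most [i]
    receives a summand that is tiny for [pi i] and huge for [pi i.+1]
    ([level_step]). The summands of step [i] beat for [pi i.+1] everything that is
    already there and do not spoil what the previous steps achieved. The lower
    bounds [g] are known before the factor [e1] is prescribed, because the summands
    change [pi 0] by very little. *)
Lemma event_vectors F N J (lv : nat -> nat) (b M e0 : R) :
  cof F -> 0 < b -> 0 <= M -> 0 < e0 ->
  (forall t, (t < N)%N -> (lv t <= J)%N) ->
  exists g, (forall t, (t < N)%N -> 0 < g t) /\ forall e1, 0 < e1 -> exists v, [/\
    forall t, (t < N)%N -> F (v t) /\ g t <= pi 0 (v t),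
    forall m j, (m < N)%N -> (lv m <= j <= J)%N ->
      M <= e1 * pi j.+1 (v m) /\
      forall t, (t < N)%N -> pi j (v t) <= e1 * pi j.+1 (v m),
    forall t j, (t < N)%N -> (j <= lv t)%N -> pi j (v t) <= e0 * b /\
      forall m, (m < t)%N -> pi j (v t) <= e0 * pi 0 (v m) &
    coord_bound pi N J.+1 (kappa R (N + J.+1 * N)) v].
Proof.
move=> cF b0 M0 e00 lvJ.
have [g [g1 g2 g3 _ g5]] := floor_vectors sel N J.+1 cF (divr_gt0 e00 (ltr0n _ 4)) b0.
have gp t : (t < N)%N -> 0 < pi 0 (g t) by move=> /g1[].
pose gam t := pi 0 (g t) / 2.
have gamp t : (t < N)%N -> 0 < gam t by move=> tN; rewrite divr_gt0 // gp.
exists gam; split=> // eta e1g.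
have [d /andP[d0 _] hd] := fin_pos gp.
(* Total displacement allowed to all the summands: at most half of every
   [pi 0 (g t)], and a quarter of the smallness required. *)
pose sig := Num.min (d / 2) (e0 / 4 * Num.min b d).
have sig0 : 0 < sig by rewrite lt_min divr_gt0 //= mulr_gt0 ?lt_min ?b0 // divr_gt0.
pose th := sig / J.+1%:R.
have th0 : 0 < th by rewrite divr_gt0.
(* Reserve for the steps that are still to come, each of which moves the seminorms
   concerned by at most [th]. *)
pose sl i := (J.+1 - i)%:R * th.
have slS i : (i <= J)%N -> sl i = sl i.+1 + th.
  by move=> iJ; rewrite /sl subSn // subSS -natr1 mulrDl mul1r.
suff : forall i, (i <= J.+1)%N -> exists v, [/\
    coord_bound pi N J.+1 (kappa R (N + i * N)) v,
    forall t, (t < N)%N -> F (v t) /\ 0 < pi 0 (v t),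
    forall t j, (t < N)%N -> (j <= J)%N -> (j <= lv t)%N -> pi j (v t - g t) <= i%:R * th &
    forall m j, (m < N)%N -> (lv m <= j < i)%N ->
      M <= eta * (pi j.+1 (v m) - sl i) /\
      forall t, (t < N)%N -> pi j (v t) + sl i <= eta * (pi j.+1 (v m) - sl i)].
  move=> /(_ J.+1 (leqnn _))[v [v1 v2 v3 v4]].
  have dist t j : (t < N)%N -> (j <= J)%N -> (j <= lv t)%N -> pi j (v t - g t) <= sig.
    by move=> tN jJ jl; apply: le_trans (v3 t j tN jJ jl) _; rewrite /th mulrC divfK.
  have low t : (t < N)%N -> gam t <= pi 0 (v t).
    move=> tN; have := dist t 0%N tN (leq0n _) (leq0n _).
    have : sig <= d / 2 by rewrite ge_min lexx.
    have := seminorm_leB (hpi 0) (g t) (v t); rewrite (seminorm_distC (hpi 0) (g t)) /gam.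
    by have := hd t tN; lra.
  have sbd : sig <= e0 / 4 * b /\ sig <= e0 / 4 * d.
    by split; rewrite ge_min ler_pM2l ?divr_gt0 // ge_min lexx ?orbT.
  exists v; split.
  - by move=> t tN; split; [case: (v2 t tN)|exact: low].
  - move=> m j mN; rewrite -ltnS => jm; have [h1 h2] := v4 m j mN jm.
    move: h1 h2; rewrite /sl subnn mul0r subr0 => h1 h2.
    by split=> // t /h2; rewrite addr0.
  - move=> t j tN jl; have jJ := leq_trans jl (lvJ t tN).
    have vg : pi j (v t) <= pi J.+1 (g t) + sig.
      have := dist t j tN jJ jl; have := pi_le (g t) (leqW jJ).
      by have := seminorm_leB (hpi j) (v t) (g t); lra.
    split; first by move: (g2 t tN); have [h _] := sbd; lra.
    move=> m mt; have mN := ltn_trans mt tN.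
    have := g3 t m tN mt; have := low m mN; rewrite /gam.
    have : e0 * d <= e0 * pi 0 (g m) by rewrite ler_pM2l // hd.
    have [_ h] := sbd => h1 h2.
    have : e0 * (pi 0 (g m) / 2) <= e0 * pi 0 (v m) by rewrite ler_pM2l.
    by lra.
  - exact: v1.
elim=> [_|i IH iJ].
  exists g; split=> [||t j _ _ _|m j _]; rewrite ?mul0n ?addn0 //.
    by rewrite subrr (seminorm0 (hpi j)) mul0r.
  by rewrite andbC.
have [v [v1 v2 v3 v4]] := IH (ltnW iJ).
have [B B1 hB] := fin_bound (fun t => pi i.+1 (v t)) N.
(* Large enough to dominate all the seminorms of the present vectors by the ratio
   [eta], after the loss of [B] by the triangle inequality. *)
pose Q := B + sl i + (M + B + th + sl i) / eta.
have [v' [w1 w2 w3]] := level_step sel i [pred t | (lv t <= i)%N] Q cF th0 v1 v2.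
have slp : 0 <= sl i by rewrite mulr_ge0 // ltW.
have slp' : 0 <= sl i.+1 by rewrite mulr_ge0 // ltW.
have sli := slS i iJ.
have near j t : (j <= i)%N -> (t < N)%N -> pi j (v' t - v t) <= th.
  move=> ji tN; have [y [-> yi _ _]] := w3 t tN; rewrite addrAC subrr add0r.
  exact: le_trans (pi_le _ ji) yi.
have up j t : (j <= i)%N -> (t < N)%N -> pi j (v' t) <= pi j (v t) + th.
  by move=> ji tN; have := near j t ji tN; have := seminorm_leB (hpi j) (v' t) (v t); lra.
have down j t : (j <= i)%N -> (t < N)%N -> pi j (v t) - th <= pi j (v' t).
  move=> ji tN; have := near j t ji tN; rewrite (seminorm_distC (hpi j)).
  by have := seminorm_leB (hpi j) (v t) (v' t); lra.
exists v'; split.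
- by rewrite mulSnr addnA.
- exact: w2.
- move=> t j tN jJ jl; have [y [-> yi y0 _]] := w3 t tN.
  have -> : v t + y - g t = (v t - g t) + y by rewrite addrAC.
  apply: le_trans (seminormD (hpi j) _ _) _; rewrite -natr1 mulrDl mul1r.
  apply: lerD; first exact: v3.
  have [li|li] := leqP (lv t) i; last by rewrite y0 -?ltnNge // (seminorm0 (hpi j)) ltW.
  exact: le_trans (pi_le _ (leq_trans jl li)) yi.
move=> m j mN /andP[mj]; rewrite ltnS leq_eqVlt => /orP[/eqP ji|ji]; last first.
  have [|h1 h2] := v4 m j mN; first by rewrite mj.
  have hm : eta * (pi j.+1 (v m) - sl i) <= eta * (pi j.+1 (v' m) - sl i.+1).
    by rewrite ler_pM2l //; have := down j.+1 m ji mN; lra.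
  split; first lra.
  by move=> t tN; have := h2 t tN; have := up j t (ltnW ji) tN; lra.
have vm : Q - B <= pi i.+1 (v' m).
  have [y [-> _ _]] := w3 m mN; rewrite /= -ji mj => /(_ isT) yQ.
  have := seminorm_leB (hpi i.+1) y (- v m).
  rewrite opprK (addrC y) (seminormN (hpi i.+1)) -ji in yQ *.
  by have := hB m mN; rewrite -ji; lra.
have big : M + B + th + sl i <= eta * (pi j.+1 (v' m) - sl i.+1).
  rewrite mulrC -ler_pdivrMr // ji; move: vm; rewrite /Q; lra.
split; first by lra.
move=> t tN; have := up i t (leqnn _) tN; have := hB t tN; have := pi_le (v t) (leqnSn i).
by rewrite ji in big *; lra.
Qed.

End event.

(** * Polynomial norms and triangular systems *)

Section poly_norm.
Variables (R : realType) (s : scalars).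
Local Notation K := (scalar_field R s).
Implicit Types P Q : {poly K}.

Definition pnorm P : R := \sum_(i < size P) modulus P`_i.

Lemma pnormE P N : (size P <= N)%N -> pnorm P = \sum_(i < N) modulus P`_i.
Proof.
move=> PN; rewrite /pnorm (big_ord_widen _ (fun i => modulus P`_i) PN).
rewrite big_mkcond; apply: eq_bigr => i _; case: ifPn => //.
by rewrite -leqNgt => /(nth_default 0) ->; rewrite modulus0.
Qed.

Lemma pnorm_ge0 P : 0 <= pnorm P.
Proof. by apply: sumr_ge0 => i _; exact: modulus_ge0. Qed.

Lemma pnorm_coef P i : modulus P`_i <= pnorm P.
Proof.
have [iP|Pi] := ltnP i (size P); last first.
  by rewrite nth_default // modulus0 pnorm_ge0.
rewrite /pnorm (bigD1 (Ordinal iP)) //= lerDl.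
by apply: sumr_ge0 => k _; exact: modulus_ge0.
Qed.

Lemma pnormD P Q : pnorm (P + Q) <= pnorm P + pnorm Q.
Proof.
have hP := leq_maxl (size P) (size Q); have hQ := leq_maxr (size P) (size Q).
rewrite (pnormE hP) (pnormE hQ) (pnormE (size_polyD P Q)) -big_split /=.
by apply: ler_sum => i _; rewrite coefD modulusD.
Qed.

Lemma pnorm0 : pnorm 0 = 0.
Proof. by rewrite /pnorm size_poly0 big_ord0. Qed.

Lemma pnormZ c P : pnorm (c *: P) = modulus c * pnorm P.
Proof.
rewrite (pnormE (size_scale_leq c P)) /pnorm mulr_sumr.
by apply: eq_bigr => i _; rewrite coefZ modulusM.
Qed.

Lemma pnormN P : pnorm (- P) = pnorm P.
Proof. by rewrite -scaleN1r pnormZ modulusN modulus1 mul1r. Qed.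

Lemma pnormB P Q : pnorm (P - Q) <= pnorm P + pnorm Q.
Proof. by rewrite -(pnormN Q) pnormD. Qed.

Lemma pnorm_sum (I : Type) (r : seq I) (p : pred I) (F : I -> {poly K}) :
  pnorm (\sum_(i <- r | p i) F i) <= \sum_(i <- r | p i) pnorm (F i).
Proof.
elim/big_rec2: _ => [|i x y _ le]; first by rewrite pnorm0.
by apply: le_trans (pnormD _ _) _; rewrite lerD2l.
Qed.

Lemma pnormMX P : pnorm ('X * P) = pnorm P.
Proof.
have h : (size ('X * P)%R <= (size P).+1)%N.
  by apply: leq_trans (size_polyMleq _ _) _; rewrite size_polyX.
rewrite (pnormE h) big_ord_recl coefXM /= modulus0 add0r.
by apply: eq_bigr => i _; rewrite coefXM.
Qed.

Lemma pnormMXn n P : pnorm ('X^n * P) = pnorm P.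
Proof. by elim: n => [|n IH]; rewrite ?mul1r // exprS -mulrA pnormMX. Qed.

Lemma pnormM P Q : pnorm (P * Q) <= pnorm P * pnorm Q.
Proof.
rewrite -[P in pnorm (P * Q)]coefK poly_def mulr_suml.
apply: le_trans (pnorm_sum _ _ _) _; rewrite /(pnorm P) mulr_suml.
by apply: ler_sum => i _; rewrite -scalerAl pnormZ pnormMXn.
Qed.

Lemma pnorm_le P N (B : R) : (size P <= N)%N -> (forall i, (i < N)%N -> modulus P`_i <= B) ->
  pnorm P <= N%:R * B.
Proof.
move=> PN h; rewrite (pnormE PN).
apply: (@le_trans _ _ (\sum_(i < N) B)); first by apply: ler_sum => i _; exact: h.
by rewrite sumr_const card_ord mulr_natl.
Qed.

(** The coordinates in a triangular basis are bounded by the coefficients of the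
    polynomial, by successive elimination of the leading terms. *)
Lemma basis_expansion (U : nat -> {poly K}) N :
  (forall m, (m < N)%N -> size (U m) = m.+1 /\ U m \is monic) ->
  exists2 M : R, 1 <= M & forall P, (size P <= N)%N ->
    exists x : nat -> K, P = \sum_(t < N) x t *: U t /\
      \sum_(t < N) modulus (x t) <= M * pnorm P.
Proof.
elim: N => [|N IH] hU.
  exists 1 => // P; rewrite leqn0 size_poly_eq0 => /eqP ->.
  by exists (fun=> 0); rewrite !big_ord0 pnorm0 mulr0.
have [|M M1 hM] := IH; first by move=> m mN; apply: hU; exact: ltnW.
have [sU mU] := hU N (leqnn _).
have U0 := pnorm_ge0 (U N).
have M' : 0 <= M * (1 + pnorm (U N)) by rewrite mulr_ge0 //; lra.
exists (M * (1 + pnorm (U N)) + 1) => [|P sP]; first by lra.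
pose Q := P - P`_N *: U N.
have sQ : (size Q <= N)%N.
  apply/leq_sizeP => j; rewrite leq_eqVlt => /orP[/eqP <-|Nj].
    move: mU; rewrite monicE lead_coefE sU /= => /eqP UN.
    by rewrite coefB coefZ UN mulr1 subrr.
  rewrite coefB coefZ (nth_default 0 (leq_trans sP Nj)).
  by rewrite [(U N)`_j]nth_default ?sU // mulr0 subr0.
have [x [Qx hx]] := hM Q sQ.
exists (fun t => if t == N then P`_N else x t).
have e (T : zmodType) (F : K -> nat -> T) :
    \sum_(t < N.+1) F (if nat_of_ord t == N then P`_N else x t) t =
    \sum_(t < N) F (x t) t + F P`_N N.
  rewrite big_ord_recr /= eqxx; congr (_ + _); apply: eq_bigr => i _.
  by rewrite ltn_eqF.
rewrite (e _ (fun c t => c *: U t)) (e _ (fun c _ => modulus c)).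
split; first by rewrite -Qx subrK.
have cP := pnorm_coef P N.
have : pnorm Q <= (1 + pnorm (U N)) * pnorm P.
  apply: le_trans (pnormB _ _) _; rewrite pnormZ.
  have : modulus P`_N * pnorm (U N) <= pnorm P * pnorm (U N) by rewrite ler_wpM2r.
  by lra.
have M0 : 0 <= M by lra.
move=> /(ler_wpM2l M0); lra.
Qed.

End poly_norm.

Section pivot.
Variables (R : realType) (s : scalars).
Local Notation K := (scalar_field R s).
Implicit Types p q f : {poly K}.

(** Forward substitution. *)
Lemma triangular_bound (al A : R) n : 0 < al -> 0 <= A ->
  exists2 G, 0 < G & forall (y : nat -> R) c, 0 <= c ->
    (forall k, (k < n)%N -> al * y k <= c + A * \sum_(i < k) y i) ->
    \sum_(i < n) y i <= G * c.
Proof.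
move=> al0 A0; elim: n => [|n [G G0 IH]].
  by exists 1 => // y c c0 _; rewrite big_ord0 mul1r.
exists (G + (1 + A * G) / al).
  by rewrite addr_gt0 // divr_gt0 // ltr_pwDl // mulr_ge0 // ltW.
move=> y c c0 h; have hn := IH y c c0 (fun k kn => h k (ltnW kn)).
rewrite big_ord_recr /= mulrDl; apply: lerD => //.
rewrite mulrAC ler_pdivlMr // mulrC; apply: le_trans (h n (leqnn _)) _.
by have := ler_wpM2l A0 hn; lra.
Qed.

(** A matrix with a large diagonal and tiny entries on one side of it is invertible,
    with a bound depending on the other entries only through [A]: the tiny entries
    are absorbed by the estimate for the triangular system. *)
Lemma near_triangular (al A : R) n : 0 < al -> 0 <= A ->
  exists G, 0 < G /\ forall M : 'M[K]_n,
    (forall k, al <= modulus (M k k)) ->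
    (forall i k : 'I_n, (i < k)%N -> modulus (M i k) <= A) ->
    (forall i k : 'I_n, (k < i)%N -> modulus (M i k) <= G^-1) ->
    forall t : 'rV[K]_n, exists x : 'rV[K]_n, x *m M = t /\
      \sum_i modulus (x 0 i) <= G * \sum_i modulus (t 0 i).
Proof.
move=> al0 A0; have [G G0 hG] := triangular_bound n al0 A0.
exists (2 * (G * (n%:R + 1))); split; first by rewrite !mulr_gt0 // ltr_wpDl.
move=> M hd hu hl.
pose e := (2 * (G * (n%:R + 1)))^-1.
have e0 : 0 < e by rewrite invr_gt0 !mulr_gt0 // ltr_wpDl.
(* An a priori bound, which also gives the injectivity of the system. *)
have key (x : 'rV[K]_n) :
    \sum_i modulus (x 0 i) <= 2 * (G * (n%:R + 1)) * \sum_i modulus ((x *m M) 0 i).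
  set S := \sum_i modulus (x 0 i); set b := \sum_i modulus ((x *m M) 0 i).
  have S0 : 0 <= S by apply: sumr_ge0 => i _; exact: modulus_ge0.
  have b0 : 0 <= b by apply: sumr_ge0 => i _; exact: modulus_ge0.
  pose y i := if insub i is Some k then modulus (x 0 k) : R else 0.
  have yE (i : 'I_n) : y i = modulus (x 0 i) by rewrite /y valK.
  have Sy : S = \sum_(i < n) y i by apply: eq_bigr => i _; rewrite yE.
  have : S <= G * (b + e * S).
    rewrite Sy; apply: hG; first by rewrite addr_ge0 // -Sy mulr_ge0 // ltW.
    move=> k kn; pose k' := Ordinal kn; rewrite -[k]/(nat_of_ord k') yE.
    have xk : x 0 k' * M k' k' = (x *m M) 0 k' - \sum_(i | i != k') x 0 i * M i k'.
      by rewrite mxE (bigD1 k') //= addrK.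
    apply: (@le_trans _ _ (modulus (x 0 k' * M k' k'))).
      by rewrite modulusM mulrC ler_wpM2l // modulus_ge0.
    rewrite xk; apply: le_trans (modulusD _ _) _; rewrite modulusN -addrA.
    apply: lerD.
      rewrite /b (bigD1 k') //= lerDl; apply: sumr_ge0 => i _; exact: modulus_ge0.
    apply: le_trans (modulus_sum _ _ _) _.
    rewrite (bigID (fun i : 'I_n => (i < k')%N)) /= addrC; apply: lerD.
      rewrite -Sy /S mulr_sumr [leRHS](bigID (fun i : 'I_n => (i != k') && ~~ (i < k')%N)) /=.
      rewrite -[leLHS]addr0; apply: lerD; last first.
        by apply: sumr_ge0 => i _; rewrite mulr_ge0 ?modulus_ge0 // ltW.
      apply: ler_sum => i /andP[ik]; rewrite -leqNgt => ki.
      rewrite modulusM mulrC ler_wpM2r ?modulus_ge0 // hl //.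
      by rewrite ltn_neqAle ki andbT eq_sym.
    have kn' : (k' <= n)%N by exact: ltnW.
    rewrite mulr_sumr (big_ord_widen n (fun i => A * y i) kn').
    rewrite [leRHS](eq_bigl (fun i : 'I_n => (i != k') && (i < k')%N)); last first.
      by move=> i; case: ltnP; rewrite ?andbF // andbT => h; rewrite -val_eqE /= ltn_eqF.
    apply: ler_sum => i /andP[_ ik]; rewrite yE modulusM mulrC.
    by rewrite ler_wpM2r ?modulus_ge0 // hu.
  have eG : G * (e * S) <= S / 2.
    have -> : S / 2 = G * (n%:R + 1) * (e * S).
      by rewrite /e; field; rewrite ?lt0r_neq0 // ltr_wpDl.
    have : 0 <= n%:R * (G * (e * S)) by rewrite !mulr_ge0 // ltW.
    by lra.
  rewrite mulrDr => h; have : S <= 2 * (G * b) by lra.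
  move/le_trans; apply; rewrite -mulrA ler_pM2l // -mulrA ler_pM2l //.
  by rewrite ler_peMl // lerDr.
have uM : M \in unitmx.
  rewrite -row_free_unit -kermx_eq0; apply/eqP/row_matrixP => i.
  have h : row i (kermx M) *m M = 0 by rewrite -row_mul mulmx_ker row0.
  apply/rowP => k; rewrite row0 [RHS]mxE; apply: modulus_eq0; apply/eqP.
  rewrite eq_le modulus_ge0 andbT.
  have := key (row i (kermx M)); rewrite h.
  have -> : \sum_i modulus ((0 : 'rV[K]_n) 0 i) = 0.
    by apply: big1 => j _; rewrite mxE modulus0.
  rewrite mulr0; apply: le_trans.
  by rewrite (bigD1 k) //= lerDl; apply: sumr_ge0 => j _; exact: modulus_ge0.
move=> t; exists (t *m invmx M); have e1 : t *m invmx M *m M = t by rewrite mulmxKV.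
by split=> //; apply: le_trans (key _) _; rewrite e1.
Qed.

End pivot.

(** * The approximate equation q * p = 'X^a * f *)

Section transfer.
Variables (R : realType) (s : scalars).
Local Notation K := (scalar_field R s).
Implicit Types p q f h : {poly K}.

Lemma coefM_small p q l (e : R) : (forall i, (i <= l)%N -> modulus p`_i <= e) ->
  modulus (q * p)`_l <= pnorm q * e.
Proof.
move=> hp; rewrite coefM; apply: le_trans (modulus_sum _ _ _) _.
rewrite (pnormE (leq_maxl (size q) l.+1)) mulr_suml.
rewrite (big_ord_widen (maxn (size q) l.+1) (fun i => modulus (q`_i * p`_(l - i)))) ?leq_maxr //.
rewrite big_mkcond; apply: ler_sum => i _.
have e0 : 0 <= e by apply: le_trans (hp 0%N isT); exact: modulus_ge0.
case: ifP => _; last by rewrite mulr_ge0 // modulus_ge0.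
by rewrite modulusM ler_wpM2l ?modulus_ge0 // hp // leq_subr.
Qed.

(** Power series division by [p] with its coefficient of index [r] as a pivot; the
    coefficients before the pivot are the tiny entries of [near_triangular]. *)
Lemma solve_above_pivot (al A : R) r n : 0 < al -> 0 <= A ->
  exists G, 0 < G /\ forall p, (forall i, modulus p`_i <= A) ->
    al <= modulus p`_r -> (forall i, (i < r)%N -> modulus p`_i <= G^-1) ->
    forall h, exists q, [/\ (size q <= n)%N,
      forall k, (k < n)%N -> (q * p)`_(r + k) = h`_(r + k) &
      pnorm q <= G * pnorm h].
Proof.
move=> al0 A0; have [G [G0 hG]] := near_triangular s n al0 A0.
have n0 : 0 < n%:R + 1 :> R by rewrite ltr_wpDl.
exists (G * (n%:R + 1)); split; first by rewrite mulr_gt0.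
move=> p pA pr psmall h.
pose M := \matrix_(i < n, k < n) if (i <= r + k)%N then p`_(r + k - i) else 0.
have GG : (G * (n%:R + 1))^-1 <= G^-1.
  by rewrite lef_pV2 ?posrE ?mulr_gt0 // ler_peMr ?(ltW G0) // lerDr.
have Gi : 0 <= G^-1 by rewrite invr_ge0 ltW.
have [|||x [xM hx]] := hG M _ _ _ (\row_(k < n) h`_(r + k)).
- by move=> k; rewrite mxE leq_addl addnK.
- move=> i k ik; rewrite mxE; case: ifP => _ //; by rewrite modulus0.
- move=> i k ki; rewrite mxE; case: ifP => [ir|_]; last by rewrite modulus0.
  by apply: le_trans GG; apply: psmall; lia.
pose y i : K := if insub i is Some k then x 0 k else 0.
have yE (i : 'I_n) : y i = x 0 i by rewrite /y valK.
exists (\poly_(i < n) y i); split; first exact: size_poly.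
  move=> k kn; have := congr1 (fun m : 'rV[K]_n => m 0 (Ordinal kn)) xM.
  rewrite !mxE /= => <-; rewrite coefM.
  pose F i := if (i <= r + k)%N then (\poly_(i < n) y i)`_i * p`_(r + k - i) else 0.
  pose m := maxn n (r + k).+1.
  transitivity (\sum_(i < m) F i).
    rewrite (big_ord_widen m (fun i => (\poly_(i < n) y i)`_i * p`_(r + k - i))) ?leq_maxr //.
    by rewrite big_mkcond; apply: eq_bigr => i _; rewrite /F ltnS.
  symmetry; transitivity (\sum_(i < n) F i).
    by apply: eq_bigr => i _; rewrite mxE /F coef_poly ltn_ord yE; case: ifP => //; rewrite mulr0.
  rewrite (big_ord_widen m F (leq_maxl _ _)) big_mkcond; apply: eq_bigr => i _.
  by case: ifPn => // hi; rewrite /F coef_poly (negbTE hi) mul0r if_same.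
rewrite (pnormE (size_poly _ _)) (eq_bigr (fun i : 'I_n => modulus (x 0 i))); last first.
  by move=> i _; rewrite coef_poly ltn_ord yE.
apply: le_trans hx _; rewrite -mulrA ler_pM2l //.
apply: (@le_trans _ _ (\sum_(i < n) pnorm h)).
  by apply: ler_sum => i _; rewrite mxE pnorm_coef.
by rewrite sumr_const card_ord -[leLHS]mulr_natl ler_wpM2r ?pnorm_ge0 // lerDl.
Qed.

(** The pivot is the first coefficient that is not negligible compared to the
    solution that it leads to; such a coefficient is found by going down from [d],
    with a threshold that becomes smaller at each step. The equation is solved
    exactly from the pivot on; below the pivot only the negligible coefficients of
    [p] contribute. The solution is divisible by ['X] because the system is solved
    for ['X^(a.-1) * f] instead of ['X^a * f]. *)
Lemma transfer_poly d a N (A eta : R) : (0 < a)%N -> (d <= a)%N -> (0 < N)%N -> 0 <= A -> 0 < eta ->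
  forall al : R, 0 < al -> exists2 B : R, 0 <= B &
  forall p f, (forall i, modulus p`_i <= A) ->
    (exists2 i, (i < d)%N & al <= modulus p`_i) -> pnorm f <= A ->
    exists q, [/\ (size q <= N)%N, q`_0 = 0, pnorm q <= B &
      forall l, (l < N)%N ->
        modulus (q * p - 'X^a * f)`_l <= if (l < d)%N then eta else 0].
Proof.
move=> a0 da N0 A0 eta0.
suff : forall e, (e <= d)%N -> forall al : R, 0 < al -> exists2 B : R, 0 <= B &
  forall p f, (forall i, modulus p`_i <= A) ->
    (exists2 i, (i < e)%N & al <= modulus p`_i) -> pnorm f <= A ->
    exists q, [/\ (size q <= N)%N, q`_0 = 0, pnorm q <= B &
      forall l, (l < N)%N ->
        modulus (q * p - 'X^a * f)`_l <= if (l < d)%N then eta else 0].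
  by move=> /(_ d (leqnn d)).
elim=> [_|r IH rd] al al0; first by exists 0 => // p f _ [].
have [G [G0 hG]] := solve_above_pivot r (N - r.+1) al0 A0.
have GA0 : 0 <= G * A by rewrite mulr_ge0 // ltW.
have GA : 0 < G * A + 1 by lra.
(* The coefficients before [r] are negligible below this threshold; otherwise one of
   them takes the part of the pivot. *)
pose e := Num.min al (Num.min G^-1 (eta / (G * A + 1))).
have e0 : 0 < e by rewrite !lt_min al0 invr_gt0 G0 divr_gt0.
have [eal eG eeta] : [/\ e <= al, e <= G^-1 & e <= eta / (G * A + 1)].
  by rewrite /e !ge_min !lexx ?orbT.
have [B B0 hB] := IH (ltnW rd) e e0.
exists (Num.max B (G * A)); first by rewrite le_max B0.
move=> p f pA pnz fA.
have [ex|nex] := pselect (exists2 i, (i < r)%N & e <= modulus p`_i).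
  have [q [q1 q2 q3 q4]] := hB p f pA ex fA; exists q; split => //.
  by rewrite le_max q3.
have psmall i : (i < r)%N -> modulus p`_i <= e.
  by move=> ir; rewrite leNgt; apply/negP => h; apply: nex; exists i => //; exact: ltW.
have pr : al <= modulus p`_r.
  have [i ir h] := pnz; move: ir h; rewrite ltnS leq_eqVlt => /orP[/eqP -> //|ir h].
  by exfalso; apply: nex; exists i => //; exact: le_trans h.
have [q [q1 q2 q3]] : exists q, [/\ (size q <= N - r.+1)%N,
      forall k, (k < N - r.+1)%N -> (q * p)`_(r + k) = ('X^(a.-1) * f)`_(r + k) &
      pnorm q <= G * pnorm ('X^(a.-1) * f)].
  by apply: hG => // i ir; exact: le_trans (psmall i ir) eG.
rewrite pnormMXn in q3.
have qA : pnorm q <= G * A by apply: le_trans q3 _; rewrite ler_pM2l.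
exists ('X * q); split.
- have h := size_polyMleq 'X q; rewrite size_polyX in h.
  apply: leq_trans h _; rewrite add2n /=; apply: (leq_ltn_trans q1).
  by rewrite ltn_subrL.
- by rewrite coefXM.
- by rewrite pnormMX le_max qA orbT.
move=> l lN; rewrite -mulrA coefB coefXM coefXnM.
have eta0' := ltW eta0.
case: l lN => [|l] lN /=.
  by rewrite a0 subrr modulus0; case: ifP.
have [rl|lr] := leqP r l.
  have lr : (l - r < N - r.+1)%N by rewrite subnS ltn_predRL -subSn // ltn_sub2r //; exact: leq_ltn_trans rl (ltnW lN).
  have := q2 _ lr; rewrite subnKC // => ->.
  have -> : (l.+1 - a = l - a.-1)%N by rewrite -(prednK a0).
  by rewrite coefXnM ltn_predRL subrr modulus0; case: ifP.
have ld : (l.+1 < d)%N by exact: leq_ltn_trans lr rd.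
rewrite ld (leq_trans ld da) subr0; apply: le_trans (coefM_small q (fun i il => psmall i (leq_ltn_trans il lr))) _.
apply: (@le_trans _ _ ((G * A + 1) * (eta / (G * A + 1)))); last by rewrite mulrC divfK // lt0r_neq0.
by apply: ler_pM => //; [exact: pnorm_ge0|exact: ltW|lra].
Qed.

(** The solutions of [transfer_poly] are approximated by the elements of a finite
    list. The bound [B] does not depend on the accuracy [e] of the list. *)
Lemma transfer_net d a N (A eta al : R) : (0 < a)%N -> (d <= a)%N -> (0 < N)%N ->
  0 <= A -> 0 < eta -> 0 < al -> exists2 B : R, 0 <= B & forall e : R, 0 < e ->
  exists l : seq {poly K},
    (forall q, q \in l -> [/\ (size q <= N)%N, q`_0 = 0 & pnorm q <= B]) /\
    forall p f, pnorm p <= A -> (exists2 i, (i < d)%N & al <= modulus p`_i) ->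
      pnorm f <= A -> exists2 q, q \in l & forall k, (k < N)%N ->
        modulus (q * p - 'X^a * f)`_k <= (if (k < d)%N then eta else 0) + e.
Proof.
move=> a0 da N0 A0 eta0 al0.
have [B B0 hB] := transfer_poly a0 da N0 A0 eta0 al0.
exists (B + 1) => [|e e0]; first by rewrite addr_ge0.
have A1 : 0 < A + 1 by rewrite ltr_wpDl.
have Nr : 0 < N%:R :> R by rewrite ltr0n.
pose de : R := Num.min 1 e / (N%:R * (A + 1)).
have de0 : 0 < de by rewrite divr_gt0 ?mulr_gt0 // lt_min ltr01.
have deN : N%:R * de = Num.min 1 e / (A + 1).
  by rewrite /de; field; rewrite !lt0r_neq0.
have m0 : 0 <= Num.min 1 e by rewrite le_min ler01 ltW.
have deN1 : N%:R * de <= 1.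
  by rewrite deN ler_pdivrMr // mul1r ge_min lerDr A0.
have deNA : N%:R * de * A <= e.
  rewrite deN mulrAC ler_pdivrMr // mulrDr mulr1.
  by apply: ler_wpDr; [exact: ltW|rewrite ler_wpM2r // ge_min lexx orbT].
(* The list approximates the quotients by ['X], to keep the constant terms equal to
   0. *)
have [l hl] := coef_net s N.-1 B de0.
pose good q := [/\ (size q <= N)%N, q`_0 = 0 & pnorm q <= B + 1].
exists [seq q <- [seq 'X * Q | Q <- l] | `[< good q >]]; split.
  by move=> q; rewrite mem_filter => /andP[/asboolP].
move=> p f pA pnz fA.
have pA' i : modulus p`_i <= A by exact: le_trans (pnorm_coef _ _) pA.
have [q [q1 q2 q3 q4]] := hB p f pA' pnz fA.
have [|Q Ql [sQ hQ]] := hl (fun i => q`_i.+1).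
  by move=> i _; exact: le_trans (pnorm_coef _ _) q3.
pose q' := 'X * Q : {poly K}.
have sq' : (size q' <= N)%N.
  have h := size_polyMleq 'X Q; rewrite size_polyX in h.
  by apply: leq_trans h _; rewrite add2n /= -(prednK N0) ltnS.
have close : pnorm (q' - q) <= N%:R * de.
  apply: pnorm_le => [|i iN].
    by apply: leq_trans (size_polyD _ _) _; rewrite size_polyN geq_max sq' q1.
  rewrite coefB coefXM -modulusN opprB; case: i iN => [|i] iN /=.
    by rewrite q2 subrr modulus0 ltW.
  by apply: hQ; rewrite ltn_predRL.
have pq' : pnorm q' <= B + 1.
  rewrite -(subrK q q'); apply: le_trans (pnormD _ _) _.
  by rewrite addrC lerD // (le_trans close).
exists q'.
  rewrite mem_filter; apply/andP; split; last exact: map_f.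
  by apply/asboolP; split => //; rewrite coefXM.
move=> k kN.
have -> : q' * p - 'X^a * f = (q * p - 'X^a * f) + (q' - q) * p.
  by rewrite mulrBl [RHS]addrC addrA subrK.
rewrite coefD; apply: le_trans (modulusD _ _) _; apply: lerD; first exact: q4.
apply: le_trans (coefM_small (q' - q) (fun i _ => pA' i)) _.
by apply: le_trans deNA; rewrite ler_wpM2r.
Qed.

End transfer.

(** * Polynomials applied to an orbit *)

Section cyclic_module.
Variables (R : realType) (s : scalars).
Local Notation K := (scalar_field R s).
Variable V : lmodType K.
Implicit Types (e : nat -> V) (P Q : {poly K}).

(** The value at [e 0] of the polynomial [P] of the operator sending each [e l] to
    [e l.+1]. *)
Definition orbit_eval e P : V := lincomb e (fun l => P`_l) (size P).

Lemma orbit_evalE e P N : (size P <= N)%N ->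
  orbit_eval e P = lincomb e (fun l => P`_l) N.
Proof.
move=> PN; rewrite /orbit_eval /lincomb.
rewrite (big_ord_widen _ (fun l => P`_l *: e l) PN) big_mkcond.
apply: eq_bigr => l _; case: ifPn => //.
by rewrite -leqNgt => /(nth_default 0) ->; rewrite scale0r.
Qed.

Lemma orbit_eval_lin e c P Q :
  orbit_eval e (c *: P + Q) = c *: orbit_eval e P + orbit_eval e Q.
Proof.
pose N := maxn (size P) (size Q).
have h : (size (c *: P + Q)%R <= N)%N.
  apply: leq_trans (size_polyD _ _) _; rewrite geq_max leq_maxr andbT.
  exact: leq_trans (size_scale_leq _ _) (leq_maxl _ _).
rewrite (orbit_evalE e h) (orbit_evalE e (leq_maxl _ _ : (size P <= N)%N)).
rewrite (orbit_evalE e (leq_maxr _ _ : (size Q <= N)%N)) /lincomb scaler_sumr -big_split.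
by apply: eq_bigr => l _; rewrite coefD coefZ scalerDl scalerA.
Qed.

Lemma orbit_eval0 e : orbit_eval e 0 = 0.
Proof. by rewrite /orbit_eval /lincomb size_poly0 big_ord0. Qed.

Lemma orbit_evalD e P Q : orbit_eval e (P + Q) = orbit_eval e P + orbit_eval e Q.
Proof. by have := orbit_eval_lin e 1 P Q; rewrite !scale1r. Qed.

Lemma orbit_evalZ e c P : orbit_eval e (c *: P) = c *: orbit_eval e P.
Proof. by have := orbit_eval_lin e c P 0; rewrite orbit_eval0 !addr0. Qed.

Lemma orbit_evalB e P Q : orbit_eval e (P - Q) = orbit_eval e P - orbit_eval e Q.
Proof. by rewrite orbit_evalD -(scaleN1r Q) orbit_evalZ scaleN1r. Qed.

Lemma orbit_eval_sum e (I : Type) (r : seq I) (p : pred I) (F : I -> {poly K}) :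
  orbit_eval e (\sum_(i <- r | p i) F i) = \sum_(i <- r | p i) orbit_eval e (F i).
Proof. exact: (big_morph _ (orbit_evalD e) (orbit_eval0 e)). Qed.

Lemma orbit_eval_agree e e' P N : (size P <= N)%N ->
  (forall l, (l < N)%N -> e l = e' l) -> orbit_eval e P = orbit_eval e' P.
Proof.
move=> PN h; rewrite !(orbit_evalE _ PN); apply: eq_bigr => l _.
by rewrite h.
Qed.

Lemma orbit_evalXn e n : orbit_eval e 'X^n = e n.
Proof.
have h : (size ('X^n : {poly K}) <= n.+1)%N by rewrite size_polyXn.
rewrite (orbit_evalE e h) /lincomb big_ord_recr /= coefXn eqxx scale1r.
rewrite big1 ?add0r // => i _; by rewrite coefXn ltn_eqF // scale0r.
Qed.

Lemma seminorm_orbit_eval (q : V -> R) e P N : seminorm q -> (size P <= N)%N ->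
  q (orbit_eval e P) <= \sum_(l < N) modulus P`_l * q (e l).
Proof.
move=> hq PN; rewrite (orbit_evalE e PN); apply: le_trans (seminorm_sum hq _ _ _) _.
by apply: ler_sum => l _; rewrite (seminormZ hq).
Qed.

Lemma orbit_eval_lincomb e (U : nat -> {poly K}) (x : nat -> K) N :
  orbit_eval e (\sum_(t < N) x t *: U t) = lincomb (fun m => orbit_eval e (U m)) x N.
Proof. by rewrite orbit_eval_sum; apply: eq_bigr => t _; rewrite orbit_evalZ. Qed.

Definition graded_basis (U : nat -> {poly K}) :=
  forall m, size (U m) = m.+1 /\ U m \is monic.

Lemma size_basis_sum U (x : nat -> K) N : graded_basis U ->
  (size (\sum_(t < N) x t *: U t)%R <= N)%N.
Proof.
move=> hU; elim: N => [|N IH]; first by rewrite big_ord0 size_poly0.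
rewrite big_ord_recr /=; apply: leq_trans (size_polyD _ _) _.
rewrite geq_max (leqW IH) (leq_trans (size_scale_leq _ _)) //.
by have [-> _] := hU N.
Qed.

Lemma basis_unique U (x y : nat -> K) N : graded_basis U ->
  \sum_(t < N) x t *: U t = \sum_(t < N) y t *: U t ->
  forall t, (t < N)%N -> x t = y t.
Proof.
move=> hU; elim: N => [|N IH] // exy.
have [sU mU] := hU N.
have UN : (U N)`_N = 1 by move: mU; rewrite monicE lead_coefE sU /= => /eqP.
have eN : x N = y N.
  have := congr1 (fun P : {poly K} => P`_N) exy; rewrite !big_ord_recr /= !coefD !coefZ UN.
  by rewrite !mulr1 !nth_default ?size_basis_sum // !add0r.
have /IH h : \sum_(t < N) x t *: U t = \sum_(t < N) y t *: U t.
  by move: exy; rewrite !big_ord_recr /= eN => /addIr.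
by move=> t; rewrite ltnS leq_eqVlt => /orP[/eqP ->|/h].
Qed.

(** As [U m] is monic of degree [m], the value at [U m] is corrected through [e m],
    without any effect on the values at the previous polynomials. *)
Lemma orbit_prescribe U e d (w : nat -> V) N : graded_basis U ->
  (forall m, (m < d)%N -> orbit_eval e (U m) = w m) ->
  exists e', (forall l, (l < d)%N -> e' l = e l) /\
    forall m, (m < N)%N -> orbit_eval e' (U m) = w m.
Proof.
move=> hU hd; elim: N => [|N [e' [h1 h2]]]; first by exists e.
have [Nd|dN] := ltnP N d.
  exists e'; split=> // m; rewrite ltnS leq_eqVlt => /orP[/eqP ->|/h2 //].
  rewrite -hd //; apply: (@orbit_eval_agree _ _ _ d); last exact: h1.
  by have [-> _] := hU N.
have [sU mU] := hU N.
pose e2 l := if l == N then w N - orbit_eval e' (U N - 'X^N) else e' l.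
have e2E l : (l < N)%N -> e2 l = e' l by move=> lN; rewrite /e2 ltn_eqF.
exists e2; split=> [l ld|m].
  by rewrite e2E ?h1 //; exact: leq_trans ld dN.
rewrite ltnS leq_eqVlt => /orP[/eqP ->|mN]; last first.
  rewrite -h2 //; apply: (@orbit_eval_agree _ _ _ N); last exact: e2E.
  by have [-> _] := hU m.
rewrite -(subrK 'X^N (U N)) orbit_evalD orbit_evalXn /e2 eqxx addrC.
rewrite (@orbit_eval_agree e2 e' (U N - 'X^N) N) ?subrK //.
apply/leq_sizeP => j; rewrite leq_eqVlt coefB coefXn => /orP[/eqP <-|Nj].
  by move: mU; rewrite monicE lead_coefE sU /= => /eqP ->; rewrite eqxx subrr.
by rewrite nth_default ?sU // gtn_eqF // subrr.
Qed.

End cyclic_module.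

(** * Events *)

Section events.
Variables (R : realType) (s : scalars).
Local Notation K := (scalar_field R s).
Variables (V : lmodType K) (pi : nat -> V -> R) (cof : set V -> Prop).

(** The errors committed at event [n] are bounded by multiples of [rho n]; the ratio
    1/4 makes their sum over all the later events a multiple of [rho n]. *)
Definition rho n : R := 4^-1 ^+ n.

(** The data after [st_n] events: the vectors [st_e] and the polynomials [st_U]
    count below the degree [st_d]; [st_nu] is the number of stages begun and
    [st_que] the list of the polynomials of the current stage that still wait for
    their event; [st_F] is a space of vectors almost orthogonal to the present ones;
    [st_B] bounds the norms of the polynomials of the stage. The constants [st_eta],
    [st_zeta] and [st_Lam] belong to the last event: the ratio of domination from
    the level on, the ratio of smallness up to the level, and the norm of the change
    of basis. *)
Record state := State {
  st_n : nat; st_d : nat; st_nu : nat; st_que : seq {poly K};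
  st_e : nat -> V; st_U : nat -> {poly K}; st_F : set V;
  st_B : R; st_eta : R; st_zeta : R; st_Lam : R }.

Definition vec st m := orbit_eval (st_e st) (st_U st m).

(** An empty queue means that a new stage begins; its first event has the polynomial
    1. *)
Definition ev_poly st := head 1 (st_que st).
Definition ev_nu st := if st_que st is [::] then (st_nu st).+1 else st_nu st.

(** The 2-adic valuation takes every value at infinitely many stages. *)
Definition ev_s st := logn 2 (ev_nu st).

(** The room needed for the level to go down from [st_n] to 0 in steps of length
    [st_d]. *)
Definition ev_c st := ((st_n st).+2 * st_d st)%N.

(** The room needed for the level to go down from [ev_s] to 0 in steps of length
    [ev_c]. *)
Definition ev_d st := ((ev_s st).+2 * ev_c st)%N.
Definition ev_U st m := if (ev_c st <= m < ev_d st)%N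
  then 'X^(m - ev_c st) * ('X^(ev_c st) - ev_poly st) else st_U st m.

(** It goes down from [st_n] to 0 on the degrees from [st_d] to [ev_c], then from
    [ev_s] to 0 on those from [ev_c] to [ev_d]. *)
Definition level st m := if (m < ev_c st)%N
  then ((st_n st).+1 - m %/ st_d st)%N else ((ev_s st).+1 - m %/ ev_c st)%N.

(** The factor 3 pays for the subtraction of the old vectors, see [next_exists], and
    the factor 2 for that of the later ones, see [coord_basis]. *)
Definition coord_const st : R := 6 * kappa R (st_d st * (st_n st).+1).

(** Factor by which an error made on each basis vector of norm at most 1 may grow
    when it is summed over the coordinates of a vector of norm 1. *)
Definition weight st : R :=
  (1 + \sum_(m < st_d st) pnorm (st_U st m)) * (coord_const st * (st_d st)%:R).

Record good st : Prop := {
  g_d : (0 < st_d st)%N;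
  g_nu : (st_nu st <= st_n st)%N;
  g_U : graded_basis (st_U st);
  g_UX : forall m, (st_d st <= m)%N -> st_U st m = 'X^m;
  g_pos : forall m, (m < st_d st)%N -> 0 < pi 0 (vec st m);
  g_ball : exists B : R, forall a t, (t < st_d st)%N ->
    modulus (a t) <= B * pi 0 (lincomb (vec st) a (st_d st));
  g_cof : cof (st_F st);
  g_mazur : forall a j y, (j <= (st_n st).+1)%N -> st_F st y ->
    pi j (lincomb (vec st) a (st_d st)) <= 2 * pi j (lincomb (vec st) a (st_d st) + y);
  g_que : forall q, q \in st_que st ->
    [/\ (size q <= st_d st)%N, q`_0 = 0 & pnorm q <= st_B st];
  g_B : 0 <= st_B st;
  g_eta : 0 < st_eta st }.

(** The effect of one event. [p_big] and [p_tiny] say how the new vectors behave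
    from their level on and up to their level; [p_eta], [p_zeta] and [p_zeta0] make
    the two ratios beat all the constants known when they are chosen. By
    [p_zeta_eta] the first vectors of the next block are small enough for the
    domination [p_big] of this event. [p_net] is the choice of the queue at the
    beginning of a stage. *)
Record step st st' : Prop := {
  p_n : st_n st' = (st_n st).+1;
  p_d : st_d st' = ev_d st;
  p_nu : st_nu st' = ev_nu st;
  p_U : st_U st' = ev_U st;
  p_e : forall l, (l < st_d st)%N -> st_e st' l = st_e st l;
  p_F : st_F st' `<=` st_F st;
  p_uF : forall m, (st_d st <= m < ev_d st)%N -> st_F st (vec st' m);
  p_coord : forall a j t, (j <= (st_n st).+1)%N -> (st_d st <= t < ev_d st)%N ->
    modulus (a t) * pi j (vec st' t) <=
    coord_const st' / 2 * pi j (lincomb (vec st') a (ev_d st));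
  p_Lam : forall P : {poly K}, (size P <= 2 * ev_d st)%N -> exists x : nat -> K,
    P = \sum_(t < 2 * ev_d st) x t *: st_U st' t /\
    \sum_(t < 2 * ev_d st) modulus (x t) <= st_Lam st' * pnorm P;
  p_Lam0 : 0 <= st_Lam st';
  p_big : forall m j t, (st_d st <= m < ev_d st)%N ->
    (level st m <= j <= st_n st)%N -> (t < ev_d st)%N ->
    pi j (vec st' t) <= st_eta st' * pi j.+1 (vec st' m);
  p_eta : st_eta st' * (st_Lam st' * (weight st' * (st_B st' + 1))) <= rho (st_n st);
  p_tiny : forall m j t, (st_d st <= t < ev_d st)%N -> (j <= level st t)%N -> (m < t)%N ->
    pi j (vec st' t) <= st_zeta st' * pi 0 (vec st' m);
  p_zeta_eta : 0 <= st_zeta st' <= st_eta st;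
  p_zeta : st_zeta st' * (weight st' * (st_B st + 1)) <= rho (st_n st);
  p_zeta0 : st_zeta st' * ((st_B st + (ev_nu st)%:R) * pi 0 (vec st 0)) <= rho (st_n st);
  p_que : st_que st <> [::] -> st_que st' = behead (st_que st) /\ st_B st' = st_B st;
  p_net : st_que st = [::] -> forall (x : nat -> K) f,
    (forall m, (m < ev_c st)%N ->
      modulus (x m) * pi 0 (vec st' m) <= coord_const st' * (ev_nu st)%:R) ->
    (exists2 m, (m < st_d st)%N & (ev_nu st)%:R^-1 <= modulus (x m)) ->
    pnorm f <= (ev_nu st)%:R ->
    let D q := q * \sum_(m < ev_c st) x m *: st_U st' m - 'X^(ev_c st) * f in
    exists2 q, q \in st_que st' & pnorm (D q) <= st_B st' /\
      \sum_(l < ev_d st) modulus (D q)`_l * pi (st_n st) (st_e st' l) <= rho (st_n st) }.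

Lemma rho_gt0 n : 0 < rho n. Proof. by rewrite exprn_gt0 // invr_gt0. Qed.

Section one_event.
Variable st : state.
Hypothesis gst : good st.
Local Notation n := (st_n st).
Local Notation d := (st_d st).
Local Notation c := (ev_c st).
Local Notation d' := (ev_d st).

Lemma ev_size_poly : (size (ev_poly st) <= d)%N.
Proof.
rewrite /ev_poly; case e: (st_que st) => [|q l] /=.
  by rewrite size_poly1 (g_d gst).
by have [] := g_que gst (q := q); rewrite ?e ?mem_head.
Qed.

Lemma d_lt_c : (2 * d <= c)%N.
Proof. by rewrite /ev_c leq_mul2r ltnS /= orbT. Qed.

Lemma c_lt_d' : (2 * c <= d')%N.
Proof. by rewrite /ev_d leq_mul2r !ltnS orbT. Qed.

Lemma d_le_c : (d <= c)%N.
Proof. by apply: leq_trans d_lt_c; rewrite leq_pmull. Qed.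

Lemma c_le_d' : (c <= d')%N.
Proof. by apply: leq_trans c_lt_d'; rewrite leq_pmull. Qed.

Lemma c_gt0 : (0 < c)%N.
Proof. by rewrite /ev_c muln_gt0 (g_d gst). Qed.

Lemma d_lt_d' : (d < d')%N.
Proof.
apply: leq_trans c_le_d'; apply: leq_trans d_lt_c.
by rewrite mul2n -addnn -addn1 leq_add2l (g_d gst).
Qed.

Lemma ev_s_le : (ev_s st <= n)%N.
Proof.
rewrite /ev_s; case e: (ev_nu st) => [|k]; first by rewrite logn0.
have kn : (k <= n)%N.
  by have := g_nu gst; move: e; rewrite /ev_nu; case: (st_que st) => [|_ _]; lia.
by apply: leq_trans kn; rewrite -ltnS ltn_logl.
Qed.

Lemma level_le m : (d <= m)%N -> (level st m <= n)%N.
Proof.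
move=> dm; rewrite /level; case: ltnP => mc.
  have : (0 < m %/ d)%N by rewrite divn_gt0 // (g_d gst).
  by lia.
have : (0 < m %/ c)%N by rewrite divn_gt0 // c_gt0.
by have := ev_s_le; lia.
Qed.

Lemma ev_U_graded : graded_basis (ev_U st).
Proof.
move=> m; rewrite /ev_U; case: ifP => [/andP[cm _]|_]; last exact: g_U gst m.
have sq : (size (- ev_poly st) < size ('X^c : {poly K})%R)%N.
  by rewrite size_polyN size_polyXn ltnS (leq_trans ev_size_poly) ?d_le_c.
have mq : 'X^c - ev_poly st \is monic.
  by rewrite monicE lead_coefDl // lead_coefXn.
split; last by rewrite monicMr // monicXn.
rewrite size_Mmonic ?monic_neq0 ?monicXn // size_polyXn size_polyDl //.
by rewrite size_polyXn addSn /= addnS subnK.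
Qed.

Lemma ev_U_old m : (m < c)%N -> ev_U st m = st_U st m.
Proof. by move=> mc; rewrite /ev_U leqNgt mc. Qed.

Lemma ev_U_late m : (d' <= m)%N -> ev_U st m = 'X^m.
Proof.
move=> dm; rewrite /ev_U [(m < d')%N]ltnNge dm andbF.
by apply: (g_UX gst); exact: leq_trans (ltnW d_lt_d') dm.
Qed.

End one_event.
End events.

(** * Existence of the next event *)

Section step.
Variables (R : realType) (s : scalars).
Local Notation K := (scalar_field R s).
Variables (V : lmodType K) (pi : nat -> V -> R) (cof : set V -> Prop).
Hypothesis sel : selection_system pi cof.

Let hpi j : seminorm (pi j). Proof. exact: sel_seminorm sel j. Qed.
Let pi_ge0 j x : 0 <= pi j x. Proof. exact: seminorm_ge0. Qed.
Let pi_le i j x : (i <= j)%N -> pi i x <= pi j x.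
Proof. exact: sel_nondecreasing sel i j x. Qed.

Variable st : state V.
Hypothesis gst : good pi cof st.
Local Notation n := (st_n st).
Local Notation d := (st_d st).
Local Notation c := (ev_c st).
Local Notation d' := (ev_d st).

Definition next_state e' F' B' eta' zeta' Lam' que' : state V :=
  State n.+1 d' (ev_nu st) que' e' (ev_U st) F' B' eta' zeta' Lam'.

(** One event, for any admissible queue. The order of the choices is the point: the
    lower bounds [gam] come first; the norm [B'] of the polynomials in the queue may
    depend on them; then come the vectors, whose ratio of domination takes [B'] into
    account; and the queue itself is chosen last, as its accuracy depends on the
    vectors. *)
Lemma next_exists : exists gam : nat -> R,
  (forall m, (m < d')%N -> 0 < gam m) /\
  forall B' : R, 0 <= B' -> exists e' F' eta' zeta' Lam',
    (forall m, (m < d')%N -> gam m <= pi 0 (orbit_eval e' (ev_U st m))) /\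
    (forall l, (l < d)%N -> e' l = st_e st l) /\
    forall que' : seq {poly K},
    (forall q, q \in que' -> [/\ (size q <= d')%N, q`_0 = 0 & pnorm q <= B']) ->
    let st' := next_state e' F' B' eta' zeta' Lam' que' in
    (st_que st <> [::] -> que' = behead (st_que st) /\ B' = st_B st) ->
    (st_que st = [::] -> forall (x : nat -> K) f,
      (forall m, (m < c)%N ->
        modulus (x m) * pi 0 (vec st' m) <= coord_const st' * (ev_nu st)%:R) ->
      (exists2 m, (m < d)%N & (ev_nu st)%:R^-1 <= modulus (x m)) ->
      pnorm f <= (ev_nu st)%:R ->
      let D q := q * \sum_(m < c) x m *: ev_U st m - 'X^c * f in
      exists2 q, q \in que' & pnorm (D q) <= B' /\
        \sum_(l < d') modulus (D q)`_l * pi n (e' l) <= rho R n) ->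
    good pi cof st' /\ step pi st st'.
Proof.
have dd' := d_lt_d' gst; have d0 := g_d gst.
have hU := ev_U_graded gst.
pose N := (d' - d)%N; have dN : (d + N)%N = d' by rewrite subnKC // ltnW.
have [Lam Lam1 hLam] := basis_expansion (N := (2 * d')%N) (fun m _ => hU m).
have [b /andP[b0 _] hb] := fin_pos (g_pos gst).
have [M M1 hM] := fin_bound (fun t => pi n (vec st t)) d.
(* These are [coord_const] and [weight] of the next state, which are known before
   its vectors. *)
pose cc := 6 * kappa R (d' * n.+2).
pose w0 := (1 + \sum_(m < d') pnorm (ev_U st m)) * (cc * d'%:R).
have [zeta zeta0 hz] := small_against
  [:: w0 * (st_B st + 1); (st_B st + (ev_nu st)%:R) * pi 0 (vec st 0); rho R n / st_eta st]
  (rho_gt0 R n).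
have lvJ t : (t < N)%N -> (level st (d + t) <= n)%N.
  by move=> _; apply: (level_le gst); exact: leq_addr.
have [gv [gv0 hv]] := event_vectors sel (g_cof gst) b0 (le_trans ler01 M1) zeta0 lvJ.
pose gam m := if (m < d)%N then b else gv (m - d)%N.
have gam0 m : (m < d')%N -> 0 < gam m.
  move=> md; rewrite /gam; case: ltnP => // dm; apply: gv0.
  by rewrite ltn_sub2r // (leq_ltn_trans dm md).
exists gam; split=> // B' B'0.
have [eta eta0 he] := small_against [:: Lam * (w0 * (B' + 1))] (rho_gt0 R n).
have [v [v1 v2 v3 v4]] := hv eta eta0.
pose w m := if (m < d)%N then vec st m else v (m - d)%N.
have wN i : w (d + i)%N = v i by rewrite /w ltnNge leq_addr /= addKn.
have wold m : (m < d)%N -> w m = vec st m by rewrite /w => ->.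
have [|e' [e1 e2]] := @orbit_prescribe _ _ _ (ev_U st) (st_e st) d w d' hU.
  move=> m md; rewrite wold // ev_U_old //; exact: leq_trans md (d_le_c st).
have hold a : lincomb w a d = lincomb (vec st) a d.
  by apply: eq_bigr => i _; rewrite wold.
have hsplit a : lincomb w a d' = lincomb (vec st) a d + lincomb v (fun i => a (d + i)%N) N.
  rewrite -dN lincomb_split hold; congr (_ + _); apply: eq_bigr => i _; by rewrite wN.
have Fv t : (t < N)%N -> st_F st (v t) by move=> /v1[].
(* Almost orthogonality of the new vectors to the old ones. *)
have hS a j : (j <= n.+1)%N ->
    pi j (lincomb (vec st) a d) <= 2 * pi j (lincomb w a d').
  move=> jn; rewrite hsplit; apply: (g_mazur gst) => //.
  by apply: (sel_lincomb sel) => //; exact: g_cof gst.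
have hcoord a j i : (j <= n.+1)%N -> (i < N)%N ->
    modulus (a (d + i)%N) * pi j (v i) <= cc / 2 * pi j (lincomb w a d').
  move=> jn iN; have := v4 (fun i => a (d + i)%N) j i jn iN.
  have -> : lincomb v (fun i => a (d + i)%N) N = lincomb w a d' - lincomb (vec st) a d.
    by rewrite hsplit addrAC subrr add0r.
  move/le_trans; apply.
  have h1 := seminormB (hpi j) (lincomb w a d') (lincomb (vec st) a d).
  have {h1}h1 : pi j (lincomb w a d' - lincomb (vec st) a d) <= 3 * pi j (lincomb w a d').
    by have := hS a j jn; lra.
  have -> : cc / 2 * pi j (lincomb w a d') = kappa R (d' * n.+2) * (3 * pi j (lincomb w a d')).
    by rewrite /cc; field.
  apply: ler_pM => //; first exact: kappa_ge0.
  apply: kappa_le; rewrite -mulSn mulnC leq_mul2r leq_subr orbT //.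
have gw m : (m < d')%N -> gam m <= pi 0 (w m).
  move=> md; rewrite /gam /w; case: ltnP => [mo|dm]; first exact: hb.
  by have [|_ ->] // := v1 (m - d)%N; rewrite ltn_sub2r // (leq_ltn_trans dm md).
(* The bound of coordinates needed to choose the next space of almost orthogonal
   vectors. *)
have [B0 hB0] : exists B0, forall a t, (t < d')%N ->
    modulus (a t) <= B0 * pi 0 (lincomb w a d').
  have [B hB] := g_ball gst.
  have [ge /andP[ge0 _] hge] := fin_pos gam0.
  have cc0 : 0 <= cc by rewrite mulr_ge0 // kappa_ge0.
  have h0 : 0 <= cc / 2 / ge by rewrite !divr_ge0 // ltW.
  exists (2 * `|B| + cc / 2 / ge) => a t td; rewrite mulrDl.
  have x0 := pi_ge0 0 (lincomb w a d').
  have [tod|dt] := ltnP t d.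
    apply: ler_wpDr; first by rewrite mulr_ge0.
    apply: le_trans (hB a t tod) _.
    apply: (@le_trans _ _ (`|B| * pi 0 (lincomb (vec st) a d))).
      by rewrite ler_wpM2r // ler_norm.
    by rewrite -mulrA mulrCA ler_wpM2l // hS.
  apply: ler_wpDl; first by rewrite !mulr_ge0.
  rewrite mulrAC ler_pdivlMr //.
  have tN : (t - d < N)%N by rewrite ltn_sub2r // (leq_ltn_trans dt td).
  have := hcoord a 0%N (t - d)%N (leq0n _) tN; rewrite subnKC //.
  apply: le_trans; apply: ler_wpM2l; first exact: modulus_ge0.
  by apply: le_trans (hge t td) _; have := gw t td; rewrite /w ltnNge dt.
have [G [cG hG]] := almost_orthogonal sel n.+2 hB0.
exists e', (st_F st `&` G), eta, zeta, Lam.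
split; first by move=> m md; rewrite e2 // gw.
split=> // que' hque' st' hq hnet.
have vE m : (m < d')%N -> vec st' m = w m by move=> md; rewrite /vec /= e2.
have lE a : lincomb (vec st') a d' = lincomb w a d'.
  by apply: eq_bigr => i _; rewrite vE.
have vI (P : nat -> V -> Prop) : (forall i, (i < N)%N -> P (d + i)%N (v i)) ->
    forall m, (d <= m < d')%N -> P m (vec st' m).
  move=> h m /andP[dm md]; rewrite vE // -(subnKC dm) wN; apply: h.
  by rewrite ltn_sub2r // (leq_ltn_trans dm md).
have Lam0 : 0 <= Lam by apply: le_trans Lam1.
have w00 : 0 <= w0.
  rewrite mulr_ge0 // ?addr_ge0 ?sumr_ge0 ?mulr_ge0 ?kappa_ge0 // => i _; exact: pnorm_ge0.
have big m j : (d <= m < d')%N -> (level st m <= j <= n)%N ->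
    forall t, (t < d')%N -> pi j (vec st' t) <= eta * pi j.+1 (vec st' m).
  move=> mI jI t td; move: jI; move: m mI.
  apply: (vI (fun m x => (level st m <= j <= n)%N ->
    pi j (vec st' t) <= eta * pi j.+1 x)) => i iN jI; have [h1 h2] := v2 i j iN jI.
  rewrite vE //; rewrite /w; case: ltnP => [to|dt].
    apply: le_trans h1; apply: le_trans (hM t to); apply: pi_le.
    by case/andP: jI.
  by apply: h2; rewrite ltn_sub2r // (leq_ltn_trans dt td).
split.
  split.
  - exact: leq_ltn_trans (leq0n d) dd'.
  - rewrite /= /ev_nu; have := g_nu gst; case: (st_que st) => [|_ _] //.
    by move/leqW.
  - exact: hU.
  - by move=> m md; exact: (ev_U_late gst md).
  - by move=> m md; rewrite vE //; apply: lt_le_trans (gw m md); exact: gam0.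
  - by exists B0 => a t td; rewrite lE; exact: hB0.
  - exact: sel_inter sel _ _ (g_cof gst) cG.
  - move=> a j y jn [_ Gy]; rewrite lE; exact: hG.
  - exact: hque'.
  - exact: B'0.
  - exact: eta0.
split=> //.
- by move=> y [].
- by apply: (vI (fun _ x => st_F st x)) => i iN; exact: Fv.
- move=> a j t jn; rewrite lE; move: t.
  apply: (vI (fun m x => modulus (a m) * pi j x <= _)) => i iN.
  exact: (hcoord a j i jn iN).
- by move=> m j t mI jI; exact: big.
- by apply: he; rewrite mem_head.
- move=> m j t tI jl mt.
  have md : (m < d')%N by case/andP: tI => _; exact: ltn_trans.
  move: t tI jl mt; apply: (vI (fun t x => (j <= level st t)%N -> (m < t)%N ->
    pi j x <= zeta * pi 0 (vec st' m))) => i iN jl mt.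
  have [h1 h2] := v3 i j iN jl; rewrite vE //= /w; case: ltnP => [mo|dm].
    by apply: le_trans h1 _; rewrite ler_pM2l // hb.
  by apply: h2; rewrite ltn_subLR.
- rewrite ltW //=; have := hz (rho R n / st_eta st); rewrite !inE eqxx !orbT => /(_ isT).
  have eta_gt := g_eta gst; have r0 := rho_gt0 R n.
  by rewrite mulrA ler_pdivrMr // mulrC ler_pM2l.
- by apply: hz; rewrite mem_head.
- by apply: hz; rewrite !inE eqxx orbT.
Qed.

End step.

(** * The sequence of events *)

Section history.
Variables (R : realType) (s : scalars).
Local Notation K := (scalar_field R s).
Variables (V : lmodType K) (pi : nat -> V -> R) (cof : set V -> Prop).
Hypothesis sel : selection_system pi cof.

Let hpi j : seminorm (pi j). Proof. exact: sel_seminorm sel j. Qed.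
Let pi_ge0 j x : 0 <= pi j x. Proof. exact: seminorm_ge0. Qed.

(** When a stage is in progress its queue is shortened. When one begins, the lower
    bounds of [next_exists] give a bound [A] of the polynomials that must be
    treated, [transfer_net] gives the bound [Bq] of the solutions, and after the
    choice of the vectors it gives the queue, with an accuracy adapted to these
    vectors. *)
Lemma step_exists (st : state V) : good pi cof st ->
  exists st', good pi cof st' /\ step pi st st'.
Proof.
move=> gst; have [gam [gam0 hn]] := next_exists sel gst.
case eq : (st_que st) => [|q0 l]; last first.
  have [e' [F' [eta' [zeta' [Lam' [_ [_ h]]]]]]] := hn _ (g_B gst).
  have [|||g' s'] := h l; last by eexists; split; [exact: g'|exact: s'].
  - move=> q ql; have [|h1 h2 h3] := g_que gst (q := q).
      by rewrite eq in_cons ql orbT.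
    by split=> //; apply: leq_trans h1 _; apply: ltnW; exact: d_lt_d' gst.
  - by rewrite eq.
  - by rewrite eq.
set d := st_d st in gam0 hn *; pose c := ev_c st; pose d' := ev_d st.
have d0 : (0 < d)%N := g_d gst.
have dc : (d <= c)%N := d_le_c st.
have cd' : (c <= d')%N := c_le_d' st.
have hU := ev_U_graded gst.
have nuE : ev_nu st = (st_nu st).+1 by rewrite /ev_nu eq.
pose nu : R := (ev_nu st)%:R; have nu0 : 0 < nu by rewrite /nu nuE.
have [La La1 hLa] := basis_expansion (N := d) (fun m _ => hU m).
have hLa' (x : nat -> K) : \sum_(t < d) modulus (x t) <= La * pnorm (\sum_(t < d) x t *: ev_U st t).
  have [y [exy hy]] := hLa _ (size_basis_sum x d hU).
  apply: le_trans hy; rewrite (eq_bigr (fun t : 'I_d => modulus (y t))) // => t _.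
  by rewrite (basis_unique hU exy).
have La0 : 0 < La by apply: lt_le_trans La1.
have dr : 0 < d%:R :> R by rewrite ltr0n.
(* If all the coefficients of [p] of degree less than [d] were smaller than [al],
   its coordinates on the first [d] basis elements would be smaller than nu^-1. *)
pose al := (nu * La * d%:R)^-1.
have al0 : 0 < al by rewrite invr_gt0 !mulr_gt0.
pose cc := 6 * kappa R (d' * (st_n st).+2).
have cc0 : 0 <= cc by rewrite mulr_ge0 // kappa_ge0.
have gamc m : (m < c)%N -> 0 < gam m.
  by move=> mc; apply: gam0; exact: leq_trans mc cd'.
pose A := \sum_(m < c) (cc * nu / gam m) * pnorm (ev_U st m) + nu.
have A0 : nu <= A.
  rewrite lerDr sumr_ge0 // => m _; rewrite mulr_ge0 ?pnorm_ge0 //.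
  apply: divr_ge0; last exact: ltW (gamc m (ltn_ord m)).
  by apply: mulr_ge0 => //; exact: ltW.
have A1 : 0 <= A by apply: le_trans A0; exact: ltW.
pose r := rho R (st_n st); have r0 : 0 < r := rho_gt0 R _.
have r2 : 0 < r / 2 by rewrite divr_gt0.
have pi_sum_gt0 k (u : nat -> V) : 0 < 1 + \sum_(l < k) pi (st_n st) (u l).
  by rewrite ltr_wpDr // sumr_ge0.
have [Bq Bq0 hnet] := transfer_net s (leq_trans d0 dc) dc (leq_trans d0 (leq_trans dc cd'))
  A1 (divr_gt0 r2 (pi_sum_gt0 d (st_e st))) al0.
have BA0 : 0 <= Bq * A by exact: mulr_ge0.
have B'0 : 0 <= Bq * A + A + Bq by exact: addr_ge0 (addr_ge0 BA0 A1) Bq0.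
have [e' [F' [eta' [zeta' [Lam' [he' [ee' h]]]]]]] := hn _ B'0.
have [l [hl1 hl2]] := hnet _ (divr_gt0 r2 (pi_sum_gt0 d' e')).
(* [Bq * A + A] bounds the remainders [D q] and [Bq] the elements of the queue. *)
have [|||g' s'] := h l; last by eexists; split; [exact: g'|exact: s'].
- move=> q /hl1[h1 h2 h3]; split=> //; lra.
- by rewrite eq.
move=> _ x f hx hnz hf.
set p := \sum_(m < ev_c st) x m *: ev_U st m.
have pA : pnorm p <= A.
  apply: le_trans (pnorm_sum _ _ _) _; apply: ler_wpDr; first exact: ltW.
  apply: ler_sum => m _; rewrite pnormZ ler_wpM2r ?pnorm_ge0 //.
  rewrite ler_pdivlMr ?gamc //; apply: le_trans (hx m (ltn_ord m)).
  by rewrite ler_wpM2l ?modulus_ge0 // he' // (leq_trans (ltn_ord m) cd').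
have pnz : exists2 i, (i < d)%N & al <= modulus p`_i.
  apply: contrapT => nex.
  have small i : (i < d)%N -> modulus p`_i < al.
    by move=> id; rewrite ltNge; apply/negP => h'; apply: nex; exists i.
  pose low := \sum_(t < d) x t *: ev_U st t.
  (* The basis elements of degree at least [d] and less than [c] are powers of
     ['X]. *)
  have plow i : (i < d)%N -> low`_i = p`_i.
    move=> id; rewrite /p /low -/c -(subnKC dc) big_split_ord /= coefD.
    rewrite [X in _ + X](_ : _ = 0) ?addr0 // coef_sum big1 // => m _.
    rewrite ev_U_old; last by have := ltn_ord m; rewrite ltn_subRL.
    rewrite (g_UX gst) ?leq_addr // coefZ coefXn ltn_eqF ?mulr0 //.
    exact: leq_trans id (leq_addr _ _).
  have lowsmall : pnorm low < d%:R * al.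
    rewrite (pnormE (size_basis_sum x d hU)).
    apply: (@lt_le_trans _ _ (\sum_(i < d) al)); last by rewrite sumr_const card_ord mulr_natl.
    apply: ltr_sum; first by apply/hasP; exists (Ordinal d0); rewrite // mem_index_enum.
    by move=> i _; rewrite plow // small.
  have [m md hm] := hnz.
  have := hLa' x; rewrite (bigD1 (Ordinal md)) //= => hm'.
  have s0 : 0 <= \sum_(i < d | i != Ordinal md) modulus (x i).
    by apply: sumr_ge0 => i _; exact: modulus_ge0.
  have : La * pnorm low < La * (d%:R * al) by rewrite ltr_pM2l.
  have -> : La * (d%:R * al) = nu^-1 by rewrite /al; field; rewrite !lt0r_neq0.
  by move: hm hm' s0; rewrite -/low -/nu; lra.
have [q ql hq] := hl2 p f pA pnz (le_trans hf A0); exists q => //.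
have [_ _ qB] := hl1 q ql; split.
  apply: le_trans (pnormB _ _) _; rewrite pnormMXn.
  have : pnorm (q * p) <= Bq * A.
    by apply: le_trans (pnormM _ _) _; apply: ler_pM => //; exact: pnorm_ge0.
  by move: (le_trans hf A0); lra.
set D := q * p - _.
apply: (@le_trans _ _ (\sum_(k < d') (if (k < d)%N then r / 2 / (1 + \sum_(l < d) pi (st_n st) (st_e st l)) * pi (st_n st) (st_e st k) else 0) + \sum_(k < d') r / 2 / (1 + \sum_(l < d') pi (st_n st) (e' l)) * pi (st_n st) (e' k))).
  rewrite -big_split /=; apply: ler_sum => k _.
  apply: le_trans (ler_wpM2r (pi_ge0 _ _) (hq k (ltn_ord k))) _.
  rewrite mulrDl lerD2r; case: ifP => [kd|_]; last by rewrite mul0r.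
  by rewrite (ee' k kd).
have half k (u : nat -> V) :
    \sum_(i < k) r / 2 / (1 + \sum_(l < k) pi (st_n st) (u l)) * pi (st_n st) (u i) <= r / 2.
  rewrite -mulr_sumr -mulrA ler_piMr ?(ltW r2) //.
  by rewrite mulrC ler_pdivrMr // mul1r lerDr.
rewrite -big_mkcond /= -(big_ord_widen d' (fun k => r / 2 / (1 + \sum_(l < d) pi (st_n st) (st_e st l)) * pi (st_n st) (st_e st k)) (leq_trans dc cd')).
by have := half d (st_e st); have := half d' e'; rewrite -/r; lra.
Qed.

Lemma initial_exists : exists st : state V, [/\ good pi cof st, st_n st = 0%N, st_d st = 1%N,
  st_nu st = 0%N & st_que st = [::]].
Proof.
have [w [_ w0 _ _]] := sel_select sel 0 0 (sel_setT sel) ltr01.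
have hB (a : nat -> K) t : (t < 1)%N ->
    modulus (a t) <= (pi 0 w)^-1 * pi 0 (lincomb (fun=> w) a 1).
  rewrite ltnS leqn0 => /eqP ->.
  rewrite /lincomb big_ord1 (seminormZ (hpi 0)) mulrCA mulVf ?mulr1 //.
  exact: lt0r_neq0.
have [G [cG hG]] := almost_orthogonal sel 1 hB.
pose st := State 0 1 0 [::] (fun=> w) (fun m => 'X^m) G 0 1 0 0 : state V.
have vE m : vec st m = w by rewrite /vec /= orbit_evalXn.
have lE a : lincomb (vec st) a 1 = lincomb (fun=> w) a 1.
  by apply: eq_bigr => i _; rewrite vE.
exists st; split=> //; split=> //.
- by move=> m /=; rewrite size_polyXn monicXn.
- by move=> m _; rewrite vE.
- by exists (pi 0 w)^-1 => a t t1; rewrite lE; exact: hB.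
- by move=> a j y j1 Gy; rewrite lE; exact: hG.
Qed.

Lemma history_exists : exists h : nat -> state V,
  [/\ forall n, good pi cof (h n) /\ step pi (h n) (h n.+1), forall n, st_n (h n) = n,
    st_d (h 0) = 1%N, st_nu (h 0) = 0%N & st_que (h 0) = [::]].
Proof.
have [st0 [g0 n0 d0 nu0 q0]] := initial_exists.
have /choice[f hf] : forall st : state V, exists st', good pi cof st ->
    good pi cof st' /\ step pi st st'.
  move=> st; have [g|ng] := pselect (good pi cof st); last by exists st.
  by have [st' h] := step_exists g; exists st'.
pose h := fix h n := if n is n'.+1 then f (h n') else st0.
have gh n : good pi cof (h n) by elim: n => [//|n IH]; case: (hf _ IH).
exists h; split=> //; first by move=> n; split => //; case: (hf _ (gh n)).
elim=> [//|n IH]; have [_ hs] := hf _ (gh n).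
by rewrite -[RHS]/(n.+1) (p_n hs) IH.
Qed.

End history.

(** * Estimates for the shift *)

Section orbit_estimates.
Variables (R : realType) (s : scalars).
Local Notation K := (scalar_field R s).
Variables (V : lmodType K) (pi : nat -> V -> R) (cof : set V -> Prop).
Hypothesis sel : selection_system pi cof.

Let hpi j : seminorm (pi j). Proof. exact: sel_seminorm sel j. Qed.
Let pi_ge0 j x : 0 <= pi j x. Proof. exact: seminorm_ge0. Qed.
Let pi_le i j x : (i <= j)%N -> pi i x <= pi j x.
Proof. exact: sel_nondecreasing sel i j x. Qed.

Variable h : nat -> state V.
Hypothesis h_good : forall n, good pi cof (h n).
Hypothesis h_step : forall n, step pi (h n) (h n.+1).
Hypothesis h_n : forall n, st_n (h n) = n.
Hypothesis h_d0 : st_d (h 0) = 1%N.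
Hypothesis h_nu0 : st_nu (h 0) = 0%N.
Hypothesis h_que0 : st_que (h 0) = [::].

Local Notation dn n := (st_d (h n)).
Local Notation cn n := (ev_c (h n)).
Local Notation sn n := (ev_s (h n)).

Lemma dnS n : dn n.+1 = ev_d (h n). Proof. exact: p_d (h_step n). Qed.
Lemma dn_gt0 n : (0 < dn n)%N. Proof. exact: g_d (h_good n). Qed.
Lemma dn_lt n : (dn n < dn n.+1)%N. Proof. by rewrite dnS; exact: d_lt_d' (h_good n). Qed.
Lemma dn2_cn n : (2 * dn n <= cn n)%N. Proof. exact: d_lt_c. Qed.
Lemma dn_cn n : (dn n <= cn n)%N. Proof. exact: d_le_c. Qed.
Lemma cn2_dn n : (2 * cn n <= dn n.+1)%N. Proof. by rewrite dnS; exact: c_lt_d'. Qed.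
Lemma cn_dn n : (cn n <= dn n.+1)%N. Proof. by rewrite dnS; exact: c_le_d'. Qed.
Lemma cn_gt0 n : (0 < cn n)%N. Proof. exact: c_gt0 (h_good n). Qed.

Lemma dn_le m n : (m <= n)%N -> (dn m <= dn n)%N.
Proof.
elim: n => [|n IH]; first by rewrite leqn0 => /eqP ->.
rewrite leq_eqVlt => /orP[/eqP -> //|/IH /leq_trans]; apply; exact: ltnW (dn_lt n).
Qed.

Lemma dn_gt n : (n < dn n)%N.
Proof. by elim: n => [|n IH]; [exact: dn_gt0|exact: leq_ltn_trans IH (dn_lt n)]. Qed.

(** The polynomial of degree [m] no longer changes after event [m], since
    [m < dn m]. *)
Definition basis m : {poly K} := st_U (h m) m.
Definition orb l : V := st_e (h l) l.
Local Notation Phi := (orbit_eval orb).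
Definition bvec m : V := Phi (basis m).

Lemma U_stable m n n' : (n <= n')%N -> (m < cn n)%N -> st_U (h n') m = st_U (h n) m.
Proof.
move=> nn mn; elim: n' nn => [|k IH]; first by rewrite leqn0 => /eqP ->.
rewrite leq_eqVlt => /orP[/eqP -> //|nk].
have mk : (m < cn k)%N.
  move: nk; rewrite ltnS leq_eqVlt => /orP[/eqP <- //|nk].
  apply: leq_trans mn _; apply: leq_trans (cn_dn n) _; apply: leq_trans (dn_cn k).
  exact: dn_le.
by rewrite (p_U (h_step k)) ev_U_old // IH // -ltnS.
Qed.

Lemma basisE m n : (m < cn n)%N -> basis m = st_U (h n) m.
Proof.
move=> mn; have [nm|/ltnW mn'] := leqP n m; first exact: U_stable.
by rewrite /basis (U_stable mn') //; exact: leq_trans (dn_gt m) (dn_cn m).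
Qed.

Lemma e_stable l n n' : (n <= n')%N -> (l < dn n)%N -> st_e (h n') l = st_e (h n) l.
Proof.
move=> nn ln; elim: n' nn => [|k IH]; first by rewrite leqn0 => /eqP ->.
rewrite leq_eqVlt => /orP[/eqP -> //|nk].
have nk' : (n <= k)%N by rewrite -ltnS.
rewrite (p_e (h_step k)); first exact: IH.
exact: leq_trans ln (dn_le nk').
Qed.

Lemma orbE l n : (l < dn n)%N -> orb l = st_e (h n) l.
Proof.
move=> ln; have [nl|/ltnW ln'] := leqP n l; first exact: e_stable.
by rewrite /orb (e_stable ln') // dn_gt.
Qed.

Lemma basis_graded : graded_basis basis.
Proof. by move=> m; exact: g_U (h_good m) m. Qed.

Lemma basis_X n m : (dn n <= m < cn n)%N -> basis m = 'X^m.
Proof. by move=> /andP[dm mc]; rewrite (basisE mc) (g_UX (h_good n)). Qed.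

Lemma basis_return n m : (cn n <= m < dn n.+1)%N ->
  basis m = 'X^(m - cn n) * ('X^(cn n) - ev_poly (h n)).
Proof.
move=> mI; have /andP[_ md] := mI.
by rewrite (basisE (leq_trans md (dn_cn _))) (p_U (h_step n)) /ev_U -dnS mI.
Qed.

Lemma bvecE n m : (m < dn n)%N -> vec (h n) m = bvec m.
Proof.
move=> mn; rewrite /vec /bvec -(basisE (leq_trans mn (dn_cn n))).
apply: (@orbit_eval_agree _ _ _ _ _ _ (dn n)); first by have [-> _] := basis_graded m.
by move=> l ln; rewrite (orbE ln).
Qed.

Lemma bvec_gt0 m : 0 < pi 0 (bvec m).
Proof. by rewrite -(bvecE (dn_gt m)); exact: g_pos (h_good m) _ (dn_gt m). Qed.

Lemma sn_le n : (sn n <= n)%N.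
Proof. by rewrite -{2}(h_n n); exact: ev_s_le (h_good n). Qed.

Definition eta n := st_eta (h n.+1).
Definition zeta n := st_zeta (h n.+1).
Definition Lam n := st_Lam (h n.+1).
Definition kap n := coord_const (h n.+1).
Definition gnorm n : R := 1 + \sum_(m < dn n.+1) pnorm (basis m).

Lemma weightE n : weight (h n.+1) = gnorm n * (kap n * (dn n.+1)%:R).
Proof.
rewrite /weight /gnorm; congr ((_ + _) * _); apply: eq_bigr => m _.
by rewrite -(basisE (leq_trans (ltn_ord m) (dn_cn _))).
Qed.

Lemma eta_gt0 n : 0 < eta n. Proof. exact: g_eta (h_good n.+1). Qed.
Lemma zeta_ge0 n : 0 <= zeta n. Proof. by have /andP[] := p_zeta_eta (h_step n). Qed.
Lemma zeta_eta n : zeta n.+1 <= eta n. Proof. by have /andP[] := p_zeta_eta (h_step n.+1). Qed.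
Lemma Lam_ge0 n : 0 <= Lam n. Proof. exact: p_Lam0 (h_step n). Qed.
Lemma kap_ge0 n : 0 <= kap n. Proof. by rewrite mulr_ge0 // kappa_ge0. Qed.

Lemma gnorm_ge1 n : 1 <= gnorm n.
Proof. by rewrite lerDl sumr_ge0 // => m _; exact: pnorm_ge0. Qed.

Lemma pnorm_basis n m : (m < dn n.+1)%N -> pnorm (basis m) <= gnorm n.
Proof.
move=> mn; rewrite /gnorm (bigD1 (Ordinal mn)) //= addrCA lerDl addr_ge0 // sumr_ge0 //.
by move=> i _; exact: pnorm_ge0.
Qed.

(** For [t] beyond the block, [bvec t] is tiny by the next event, as its level there
    is maximal for t < 2 * dn n.+1. *)
Lemma bvec_big n m j t : (dn n <= m < dn n.+1)%N -> (level (h n) m <= j <= n)%N ->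
  (t < 2 * dn n.+1)%N -> pi j (bvec t) <= eta n * pi j.+1 (bvec m).
Proof.
move=> mI jI t2; have /andP[dm md] := mI; have /andP[_ jn] := jI.
have [td|dt] := ltnP t (dn n.+1).
  rewrite -(bvecE td) -(bvecE md); apply: (p_big (h_step n)); rewrite -?dnS ?h_n //.
have tc : (t < cn n.+1)%N by exact: leq_trans t2 (dn2_cn _).
have td2 := leq_trans tc (cn_dn n.+1).
have := @p_tiny _ _ _ _ _ _ (h_step n.+1) m j t.
rewrite -dnS dt td2 => /(_ isT); rewrite /level tc h_n.
have -> : (t %/ dn n.+1 = 1)%N.
  by apply/eqP; rewrite eqn_leq -ltnS ltn_divLR ?dn_gt0 // t2 leq_divRL ?dn_gt0 // mul1n.
rewrite subn1 /= => /(_ (leqW jn) (leq_trans md dt)).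
rewrite (bvecE td2) (bvecE (ltn_trans md (dn_lt _))) => /le_trans; apply.
apply: ler_pM => //; [exact: zeta_ge0|exact: zeta_eta|].
exact: pi_le.
Qed.

Lemma bvec_tiny n m j t : (dn n <= t < dn n.+1)%N -> (j <= level (h n) t)%N -> (m < t)%N ->
  pi j (bvec t) <= zeta n * pi 0 (bvec m).
Proof.
move=> tI jl mt; have /andP[_ td] := tI.
rewrite -(bvecE td) -(bvecE (ltn_trans mt td)).
by apply: (p_tiny (h_step n)) => //; rewrite -dnS.
Qed.

Lemma seminorm_big n m j (P : {poly K}) : (dn n <= m < dn n.+1)%N -> (level (h n) m <= j <= n)%N ->
  (size P <= 2 * dn n.+1)%N ->
  pi j (Phi P) <= Lam n * pnorm P * (eta n * pi j.+1 (bvec m)).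
Proof.
move=> mI jI sP; rewrite dnS in sP; have [x [Px hx]] := p_Lam (h_step n) sP.
have {}Px : P = \sum_(t < 2 * dn n.+1) x t *: basis t.
  rewrite dnS {1}Px; apply: eq_bigr => t _; congr (_ *: _).
  by rewrite -(@basisE t n.+1) //; apply: leq_trans (dn2_cn _); rewrite dnS.
rewrite {1}Px orbit_eval_lincomb; apply: le_trans (pi_lincomb sel _ _ _ _) _.
apply: (@le_trans _ _ (\sum_(t < 2 * dn n.+1) modulus (x t) * (eta n * pi j.+1 (bvec m)))).
  by apply: ler_sum => t _; rewrite ler_wpM2l ?modulus_ge0 // bvec_big.
rewrite -mulr_suml dnS; apply: ler_wpM2r => //.
by rewrite mulr_ge0 // ltW // eta_gt0.
Qed.

Lemma divn_addl m i k : (0 < k)%N -> (i <= k)%N -> ((m + i) %/ k <= (m %/ k).+1)%N.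
Proof.
move=> k0 ik; rewrite -ltnS ltn_divLR // [(_.+2 * _)%N]mulSn addnC -addnS.
exact: leq_add ik (ltn_ceil m k0).
Qed.

(** The growth allowed by one event for the powers 1, ..., dn n of the shift: the
    first term serves for the products that are tiny basis elements, the second one
    for those that are dominated. *)
Definition shift_bound n : R := zeta n + Lam n * (gnorm n * eta n).

Lemma shift_bound_ge0 n : 0 <= shift_bound n.
Proof.
have g1 := gnorm_ge1 n; have e0 := eta_gt0 n; have l0 := Lam_ge0 n.
by rewrite addr_ge0 ?zeta_ge0 // !mulr_ge0 //; lra.
Qed.

(** If [j] is at least the level of [m], the vector [bvec m] dominates whatever
    polynomial appears. Otherwise ['X^i * basis m] is the basis element of degree
    [m + i], in the same part of the block and of level at least [j], hence tiny; it
    does not leave this part, since [m] would then have level 0. *)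
Lemma seminorm_shift n m i j : (dn n <= m < dn n.+1)%N -> (0 < i <= dn n)%N -> (j <= n)%N ->
  pi j (Phi ('X^i * basis m)) <= shift_bound n * pi j.+1 (bvec m).
Proof.
move=> mI /andP[i0 id] jn; have /andP[dm md] := mI.
(* First alternative: domination by [bvec m]. *)
have big : (level (h n) m <= j)%N -> pi j (Phi ('X^i * basis m)) <= shift_bound n * pi j.+1 (bvec m).
  move=> lj; have sP : (size ('X^i * basis m)%R <= 2 * dn n.+1)%N.
    have [sm mm] := basis_graded m.
    rewrite size_Mmonic ?monic_neq0 ?monicXn // size_polyXn sm addSn addnS /=.
    rewrite mul2n -addnn -addnS; apply: leq_add => //.
    exact: leq_trans id (ltnW (dn_lt n)).
  apply: le_trans (seminorm_big mI _ sP) _; first by rewrite lj.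
  rewrite pnormMXn /shift_bound mulrDl; apply: ler_wpDl.
    by rewrite mulr_ge0 // zeta_ge0.
  rewrite !mulrA; apply: ler_wpM2r => //; apply: ler_wpM2r; first exact: ltW (eta_gt0 n).
  by apply: ler_wpM2l; [exact: Lam_ge0|exact: pnorm_basis].
have [/big//|lj] := leqP (level (h n) m) j.
(* Second alternative: the product is a tiny basis element. *)
have shiftE : basis (m + i) = 'X^i * basis m -> (m + i < dn n.+1)%N ->
    (level (h n) m <= (level (h n) (m + i)).+1)%N ->
    pi j (Phi ('X^i * basis m)) <= shift_bound n * pi j.+1 (bvec m).
  move=> <- mid lmi.
  have := @bvec_tiny n m j (m + i)%N; rewrite mid (leq_trans dm) ?leq_addr //.
  move=> /(_ isT) /(_ (leq_trans lj lmi : (j < _.+1)%N)).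
  rewrite -[X in (X < _)%N]addn0 ltn_add2l => /(_ i0).
  move/le_trans; apply; apply: ler_pM => //; [exact: zeta_ge0| |exact: pi_le].
  rewrite lerDl; have := shift_bound_ge0 n; have g1 := gnorm_ge1 n.
  by have e0 := eta_gt0 n; have l0 := Lam_ge0 n => _; rewrite !mulr_ge0 //; lra.
have [mc|cm] := ltnP m (cn n).
  have [mic|cmi] := ltnP (m + i) (cn n).
    apply: shiftE; last 1 first.
    - rewrite /level mc mic h_n.
      have := divn_addl m (dn_gt0 n) id.
      by lia.
    - have -> : basis m = 'X^m by apply: (basis_X (n := n)); rewrite dm.
      have -> : basis (m + i) = 'X^(m + i).
        by apply: (basis_X (n := n)); rewrite mic (leq_trans dm) ?leq_addr.
      by rewrite exprD mulrC.
    - exact: leq_trans mic (cn_dn n).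
  apply: big; rewrite /level mc h_n.
  suff : (n.+1 <= m %/ dn n)%N by rewrite -subn_eq0 => /eqP ->.
  rewrite leq_divRL ?dn_gt0 // -(leq_add2r (dn n)) addnC -mulSn.
  apply: (@leq_trans (m + i)); last by rewrite leq_add2l.
  by move: cmi; rewrite /ev_c h_n.
have [mid|dmi] := ltnP (m + i) (dn n.+1).
  apply: shiftE => //.
    have -> : basis m = 'X^(m - cn n) * ('X^(cn n) - ev_poly (h n)).
      by apply: basis_return; rewrite cm.
    have -> : basis (m + i) = 'X^(m + i - cn n) * ('X^(cn n) - ev_poly (h n)).
      by apply: basis_return; rewrite mid (leq_trans cm) ?leq_addr.
    by rewrite mulrA -exprD addnC addnBA.
  rewrite /level !ltnNge cm (leq_trans cm) ?leq_addr //=.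
  have := divn_addl m (cn_gt0 n) (leq_trans id (dn_cn n)).
  by lia.
apply: big; rewrite /level ltnNge cm /=.
suff : ((sn n).+1 <= m %/ cn n)%N by rewrite -subn_eq0 => /eqP ->.
rewrite leq_divRL ?cn_gt0 // -(leq_add2r (cn n)) addnC -mulSn -[X in (X <= _)%N]dnS.
by apply: leq_trans dmi _; rewrite leq_add2l (leq_trans id) // dn_cn.
Qed.

Lemma seminorm_shift_poly n m j (q : {poly K}) : (dn n <= m < dn n.+1)%N -> (j <= n)%N ->
  (size q <= dn n)%N -> q`_0 = 0 ->
  pi j (Phi (q * basis m)) <= pnorm q * (shift_bound n * pi j.+1 (bvec m)).
Proof.
move=> mI jn sq q0; rewrite -{1}[q]coefK poly_def mulr_suml orbit_eval_sum.
apply: le_trans (seminorm_sum (hpi j) _ _ _) _; rewrite /pnorm mulr_suml.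
apply: ler_sum => i _; rewrite -scalerAl orbit_evalZ (seminormZ (hpi j)).
case: i => -[|i] iq /=; first by rewrite q0 modulus0 !mul0r.
rewrite ler_wpM2l ?modulus_ge0 // seminorm_shift //=.
exact: ltnW (leq_trans iq sq).
Qed.

(** On the first [cn n] basis vectors, the power [cn n] of the shift is almost the
    polynomial [ev_poly (h n)] of the shift: the differences are combinations of the
    vectors of degree [cn n], ..., 2 * cn n - 1, whose level is [sn n]. *)
Lemma seminorm_return n m (f : {poly K}) : (m < cn n)%N -> (size f <= cn n)%N ->
  pi (sn n) (Phi (f * ('X^(cn n) - ev_poly (h n)))) <= pnorm f * (zeta n * pi 0 (bvec m)).
Proof.
move=> mc sf; rewrite -{1}[f]coefK poly_def mulr_suml orbit_eval_sum.
apply: le_trans (seminorm_sum (hpi _) _ _ _) _; rewrite /pnorm mulr_suml.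
apply: ler_sum => l _; rewrite -scalerAl orbit_evalZ (seminormZ (hpi _)).
apply: ler_wpM2l; first exact: modulus_ge0.
have lc : (l < cn n)%N by exact: leq_trans (ltn_ord l) sf.
have ld : (l + cn n < dn n.+1)%N.
  by apply: leq_trans (cn2_dn n); rewrite mul2n -addnn ltn_add2r.
rewrite -[X in 'X^X](addnK (cn n)) -(basis_return (n := n)) ?leq_addl //.
apply: bvec_tiny.
- by rewrite ld andbT (leq_trans (dn_cn n)) // leq_addl.
- rewrite /level ltnNge leq_addl /=.
  have -> : ((l + cn n) %/ cn n = 1)%N by rewrite divnDr // divnn cn_gt0 divn_small.
  by rewrite subn1.
- by apply: leq_trans mc _; exact: leq_addl.
Qed.

Lemma zeta_small n : zeta n * (gnorm n * (kap n * (dn n.+1)%:R) * (st_B (h n) + 1)) <= rho R n.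
Proof. by have := p_zeta (h_step n); rewrite weightE h_n. Qed.

Lemma eta_small n : eta n * (Lam n * (gnorm n * (kap n * (dn n.+1)%:R) * (st_B (h n.+1) + 1)))
  <= rho R n.
Proof. by have := p_eta (h_step n); rewrite weightE h_n. Qed.

Lemma shift_bound_small n B : 0 <= B -> B <= st_B (h n) -> B <= st_B (h n.+1) ->
  (B + 1) * (shift_bound n * (kap n * (dn n.+1)%:R)) <= 2 * rho R n.
Proof.
move=> B0 B1 B2; have g1 := gnorm_ge1 n; have kd : 0 <= kap n * (dn n.+1)%:R.
  by rewrite mulr_ge0 // kap_ge0.
set w := kap n * _ in kd *.
have h1 : zeta n * (w * (B + 1)) <= rho R n.
  apply: le_trans (zeta_small n); apply: ler_wpM2l; first exact: zeta_ge0.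
  apply: ler_pM => //; [by lra|by rewrite -/w ler_peMl|by lra].
have h2 : eta n * (Lam n * (gnorm n * w * (B + 1))) <= rho R n.
  apply: le_trans (eta_small n); apply: ler_wpM2l; first exact: ltW (eta_gt0 n).
  apply: ler_wpM2l; first exact: Lam_ge0.
  by apply: ler_wpM2l; [rewrite mulr_ge0 //; lra|lra].
by rewrite /shift_bound; lra.
Qed.

(** The vectors of degree at least [dn n] lie in [st_F (h n)]. *)
Lemma mazur_basis (x : nat -> K) n k j : (n <= k)%N -> (j <= n.+1)%N ->
  pi j (lincomb bvec x (dn n)) <= 2 * pi j (lincomb bvec x (dn k)).
Proof.
move=> nk jn.
have Fle n1 n2 : (n1 <= n2)%N -> st_F (h n2) `<=` st_F (h n1).
  elim: n2 => [|m IH]; first by rewrite leqn0 => /eqP ->.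
  rewrite leq_eqVlt => /orP[/eqP -> //|/IH hh]; apply: subset_trans hh.
  exact: p_F (h_step m).
have vF m n2 : (n <= n2)%N -> (dn n <= m < dn n2)%N -> st_F (h n) (bvec m).
  elim: n2 => [|n2 IH] nn /andP[dm md].
    by move: nn md; rewrite leqn0 => /eqP <-; rewrite ltnNge dm.
  move: nn; rewrite leq_eqVlt => /orP[/eqP en|]; first by move: md; rewrite -en ltnNge dm.
  rewrite ltnS => nn; have [mn2|n2m] := ltnP m (dn n2); first by apply: IH; rewrite ?dm.
  apply: (Fle _ _ nn); rewrite -(bvecE md); apply: (p_uF (h_step n2)).
  by rewrite n2m -dnS.
have -> : lincomb bvec x (dn n) = lincomb (vec (h n)) x (dn n).
  by apply: eq_bigr => i _; rewrite bvecE.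
rewrite -(subnKC (dn_le nk)) lincomb_split.
have <- : lincomb (vec (h n)) x (dn n) = lincomb bvec x (dn n).
  by apply: eq_bigr => i _; rewrite bvecE.
apply: (g_mazur (h_good n)); first by rewrite h_n.
apply: (sel_lincomb sel); first exact: g_cof (h_good n).
move=> t tN; apply: (vF _ k) => //; rewrite leq_addr /=.
by rewrite -ltn_subRL.
Qed.

Lemma coord_basis (x : nat -> K) n k j m : (n < k)%N -> (j <= n.+1)%N ->
  (dn n <= m < dn n.+1)%N ->
  modulus (x m) * pi j (bvec m) <= kap n * pi j (lincomb bvec x (dn k)).
Proof.
move=> nk jn mI; have /andP[_ md] := mI.
have := @p_coord _ _ _ _ _ _ (h_step n) x j m; rewrite h_n -dnS => /(_ jn mI).
rewrite bvecE // (_ : lincomb (vec _) _ _ = lincomb bvec x (dn n.+1)); last first.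
  by apply: eq_bigr => i _; rewrite bvecE.
move/le_trans; apply.
have := mazur_basis x nk (leqW jn); have := kap_ge0 n; rewrite /kap => k0 hm.
have := ler_wpM2l (divr_ge0 k0 (ler0n R 2)) hm; lra.
Qed.

Lemma kap_le m n : (m <= n)%N -> kap m <= kap n.
Proof.
move=> mn; rewrite ler_pM2l //; apply: kappa_le; apply: leq_mul; first exact: dn_le.
by rewrite !h_n !ltnS.
Qed.

Lemma event_of m n : (0 < m < dn n)%N -> exists2 k, (k < n)%N & (dn k <= m < dn k.+1)%N.
Proof.
elim: n => [|n IH] /andP[m0 mn].
  by move: mn; rewrite h_d0 ltnS leqNgt m0.
have [mn'|nm] := ltnP m (dn n); last by exists n; rewrite ?nm.
by have [|k kn hk] := IH; [rewrite m0|exists k => //; exact: ltnW].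
Qed.

Lemma coord_basis0 (x : nat -> K) n k m : (n < k)%N -> (m < dn n.+1)%N ->
  modulus (x m) * pi 0 (bvec m) <= kap n * pi 0 (lincomb bvec x (dn k)).
Proof.
move=> nk mn; case: (posnP m) => [->|m0]; last first.
  have [|l ln ml] := @event_of m n.+1; first by rewrite m0.
  have lk : (l < k)%N by apply: leq_ltn_trans nk; rewrite -ltnS.
  apply: le_trans (coord_basis x lk (leq0n _) ml) _.
  by apply: ler_wpM2r => //; apply: kap_le; rewrite -ltnS.
have := mazur_basis x (leq0n k) (leq0n 1).
rewrite h_d0 {1}/lincomb big_ord1 (seminormZ (hpi 0)) => /le_trans; apply.
apply: ler_wpM2r => //.
have d1 : (1 <= dn n.+1 * (st_n (h n.+1)).+1)%N by rewrite muln_gt0 dn_gt0.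
have := kappa_le R d1; rewrite /kap /coord_const.
have -> : kappa R 1 = 3 by rewrite /kappa /= mulr0 add0r.
by lra.
Qed.

(** The contributions of the blocks [n0], [n0.+1], ... form a geometric series. *)
Lemma tail_sum (g : nat -> R) (M : R) n0 k : (n0 <= k)%N -> 0 <= M ->
  (forall m, (m < dn n0)%N -> g m = 0) ->
  (forall n m, (n0 <= n < k)%N -> (dn n <= m < dn n.+1)%N ->
    g m * (dn n.+1)%:R <= 2 * rho R n * M) ->
  \sum_(m < dn k) g m <= 4 * rho R n0 * M.
Proof.
move=> nk M0 g0 hg.
suff : forall k', (n0 <= k' <= k)%N -> \sum_(m < dn k') g m <= 4 * (rho R n0 - rho R k') * M.
  move=> /(_ k); rewrite nk leqnn => /(_ isT) /le_trans; apply.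
  by apply: ler_wpM2r => //; have := rho_gt0 R k; lra.
elim=> [|k' IH] /andP[nk' kk].
  move: nk'; rewrite leqn0 => /eqP en; rewrite en subrr mulr0 mul0r big1 // => i _.
  by apply: g0; rewrite en.
move: nk'; rewrite leq_eqVlt => /orP[/eqP en|nk'].
  by rewrite -en subrr mulr0 mul0r big1 // => i _; exact: g0.
have dk := ltnW (dn_lt k').
rewrite -(subnKC dk) big_split_ord /=.
have /IH IH' : (n0 <= k' <= k)%N by rewrite -ltnS nk' ltnW.
have dr : 0 < (dn k'.+1)%:R :> R by rewrite ltr0n dn_gt0.
have : \sum_(i < dn k'.+1 - dn k') g (dn k' + i)%N <= 2 * rho R k' * M.
  apply: (@le_trans _ _ (\sum_(i < dn k'.+1 - dn k') (2 * rho R k' * M) / (dn k'.+1)%:R)).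
    apply: ler_sum => i _; rewrite ler_pdivlMr //; apply: hg.
      by rewrite -ltnS nk' kk.
    by rewrite leq_addr /= -ltn_subRL.
  rewrite sumr_const card_ord -[leLHS]mulr_natl mulrCA.
  have M2 : 0 <= 2 * rho R k' * M by rewrite !mulr_ge0 // ltW // rho_gt0.
  apply: ler_piMr => //; rewrite ler_pdivrMr // mul1r ler_nat; exact: leq_subr.
have r4 : rho R k'.+1 = rho R k' / 4 by rewrite /rho exprS mulrC.
have r0 : 0 <= rho R k' * M by rewrite mulr_ge0 // ltW // rho_gt0.
by move: IH'; rewrite r4; lra.
Qed.

Lemma basis_expand (P : {poly K}) N : (size P <= N)%N ->
  exists x : nat -> K, P = \sum_(t < N) x t *: basis t.
Proof.
move=> sP; have [M _ hM] := basis_expansion (N := N) (fun m _ => basis_graded m).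
by have [x [Px _]] := hM P sP; exists x.
Qed.

Lemma B_ge0 n : 0 <= st_B (h n). Proof. exact: g_B (h_good n). Qed.

(** The blocks from [j] on are controlled by [seminorm_shift]; the remaining
    finitely many coordinates are bounded by a seminorm. *)
Lemma shift_continuous j : exists2 C, 0 <= C &
  forall P, pi j (Phi ('X * P)) <= C * pi j.+1 (Phi P).
Proof.
pose r m := pi j (Phi ('X * basis m)) / pi 0 (bvec m).
have r0 m : 0 <= r m by rewrite divr_ge0.
exists (\sum_(m < dn j) r m * kap j + 4).
  by rewrite addr_ge0 // sumr_ge0 // => m _; rewrite mulr_ge0 // kap_ge0.
move=> P; pose k := (maxn (size P) j).+1.
have jk : (j < k)%N by rewrite ltnS leq_maxr.
have sP : (size P <= dn k)%N.
  by apply: leq_trans (ltnW (dn_gt k)); rewrite leqW // leq_maxl.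
have [x Px] := basis_expand sP.
have PhiP : Phi P = lincomb bvec x (dn k) by rewrite {1}Px orbit_eval_lincomb.
have p0 := pi_ge0 j.+1 (Phi P).
pose g m := if (m < dn j)%N then 0 else modulus (x m) * pi j (Phi ('X * basis m)).
have tl : \sum_(m < dn k) g m <= 4 * rho R j * pi j.+1 (Phi P).
  apply: tail_sum => //; [exact: ltnW|by move=> m mj; rewrite /g mj|].
  move=> n m /andP[jn nk] mI; rewrite /g ltnNge (leq_trans (dn_le jn)) //=; last by case/andP: mI.
  have := @seminorm_shift n m 1 j mI; rewrite dn_gt0 => /(_ isT jn); rewrite expr1 => hs.
  have hc := coord_basis x nk (jn : (j.+1 <= n.+1)%N) mI; rewrite -PhiP in hc.
  have hb := shift_bound_small (lexx 0) (B_ge0 n) (B_ge0 n.+1); rewrite add0r mul1r in hb.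
  have b0 := shift_bound_ge0 n.
  apply: le_trans (ler_wpM2r p0 hb).
  have d0 : 0 <= (dn n.+1)%:R :> R by [].
  have e1 := ler_wpM2r d0 (ler_wpM2l (modulus_ge0 (x m)) hs).
  apply: le_trans e1 _.
  have e2 := ler_wpM2r d0 (ler_wpM2l b0 hc).
  by rewrite mulrCA; apply: le_trans e2 _; lra.
have hd : \sum_(m < dn j) modulus (x m) * pi j (Phi ('X * basis m)) <=
    (\sum_(m < dn j) r m * kap j) * pi j.+1 (Phi P).
  rewrite mulr_suml; apply: ler_sum => m _.
  have mj : (m < dn j.+1)%N by exact: ltn_trans (ltn_ord m) (dn_lt j).
  have hc := coord_basis0 x jk mj; rewrite -PhiP in hc.
  have -> : modulus (x m) * pi j (Phi ('X * basis m)) = r m * (modulus (x m) * pi 0 (bvec m)).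
    by rewrite /r; field; rewrite lt0r_neq0 // bvec_gt0.
  rewrite -mulrA; apply: ler_wpM2l => //; apply: le_trans hc _.
  by apply: ler_wpM2l; [exact: kap_ge0|exact: pi_le].
have -> : 'X * P = \sum_(m < dn k) x m *: ('X * basis m).
  by rewrite {1}Px mulr_sumr; apply: eq_bigr => m _; rewrite scalerAr.
rewrite orbit_eval_sum; apply: le_trans (seminorm_sum (hpi j) _ _ _) _.
rewrite (eq_bigr (fun m : 'I_(dn k) => (if (m < dn j)%N then
    modulus (x m) * pi j (Phi ('X * basis m)) else 0) + g m)); last first.
  move=> m _; rewrite orbit_evalZ (seminormZ (hpi j)) /g.
  by case: ifP; rewrite ?addr0 ?add0r.
rewrite big_split /= -big_mkcond /=.
rewrite -(big_ord_widen _ (fun m => modulus (x m) * pi j (Phi ('X * basis m))) (dn_le (ltnW jk))).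
have r1 : rho R j <= 1 by rewrite /rho exprn_ile1 // invf_le1 // ler1n.
have := ler_wpM2r p0 r1; move: tl hd; rewrite mulrDl; lra.
Qed.

(** Within a stage the queue is processed in order. *)
Lemma queue_run n i : (i <= size (st_que (h n.+1)))%N ->
  [/\ st_que (h (n.+1 + i)) = drop i (st_que (h n.+1)),
    st_nu (h (n.+1 + i)) = st_nu (h n.+1) & st_B (h (n.+1 + i)) = st_B (h n.+1)].
Proof.
elim: i => [|i IH] il; first by rewrite addn0 drop0.
have [q1 q2 q3] := IH (ltnW il); rewrite addnS.
have ne : st_que (h (n.+1 + i)) <> [::].
  by move=> e; have := congr1 size q1; rewrite e size_drop /= => /esym/eqP; rewrite subn_eq0 leqNgt il.
have [p1 p2] := p_que (h_step _) ne; rewrite p1 p2 q3 q1 (p_nu (h_step _)) /ev_nu.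
split=> //; first by rewrite -drop1 drop_drop add1n.
by move: ne; rewrite q2; case: (st_que _).
Qed.

Lemma stage_exists nu : exists n, st_que (h n) = [::] /\ st_nu (h n) = nu.
Proof.
elim: nu => [|nu [n [q0 e]]]; first by exists 0%N.
have [q1 q2 _] := queue_run (leqnn (size (st_que (h n.+1)))).
exists (n.+1 + size (st_que (h n.+1)))%N; split; first by rewrite q1 drop_size.
by rewrite q2 (p_nu (h_step n)) /ev_nu q0 e.
Qed.

Lemma rho_le m n : (m <= n)%N -> rho R n <= rho R m.
Proof.
move=> mn; rewrite /rho; by apply: ler_wiXn2l => //; rewrite invf_le1 // ler1n.
Qed.

Lemma rho_small (e : R) : 0 < e -> exists n, rho R n <= e.
Proof.
move=> /half_small[n hn]; exists n; apply: le_trans (ltW hn).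
by rewrite lerXn2r ?nnegrE ?invr_ge0 // lef_pV2 ?posrE // ler_nat.
Qed.

Lemma large_stage (sg N : nat) : exists nu, [/\ (N < nu)%N, (0 < nu)%N & logn 2 nu = sg].
Proof.
(* The second factor is odd. *)
exists (2 ^ sg * (2 * N).+1)%N.
have h1 : (0 < 2 ^ sg)%N by rewrite expn_gt0.
split; last 1 first.
- rewrite lognM // pfactorK // logn_coprime ?addn0 //.
  by rewrite coprime2n /= oddM.
- by apply: leq_trans (leq_pmull _ h1); rewrite ltnS leq_pmull.
- by rewrite muln_gt0 h1.
Qed.

Section one_stage.
Variables (n : nat) (q : {poly K}) (i : nat).
Hypothesis n_open : st_que (h n) = [::].
Hypothesis i_lt : (i < size (st_que (h n.+1)))%N.
Hypothesis q_nth : nth 0 (st_que (h n.+1)) i = q.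
Local Notation n1 := (n.+1 + i)%N.
Local Notation a := (cn n).
Local Notation c := (cn n1).
Local Notation B := (st_B (h n.+1)).

Let q_in : q \in st_que (h n.+1). Proof. by rewrite -q_nth mem_nth. Qed.

Let q_props : [/\ (size q <= dn n.+1)%N, q`_0 = 0 & pnorm q <= B].
Proof. exact: g_que (h_good n.+1) _ q_in. Qed.

Let q_ev : ev_poly (h n1) = q.
Proof.
have [q1 _ _] := queue_run (ltnW i_lt).
by rewrite /ev_poly q1 -q_nth -nth0 nth_drop addn0 (set_nth_default 0).
Qed.

Let sg_ev : sn n1 = sn n.
Proof.
have [q1 q2 _] := queue_run (ltnW i_lt).
have e : st_nu (h n.+1) = (st_nu (h n)).+1 by rewrite (p_nu (h_step n)) /ev_nu n_open.
rewrite /ev_s /ev_nu n_open q2 e; case e2: (st_que (h n1)) => [|//]; exfalso.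
have := congr1 size q1; rewrite e2 size_drop /= => /esym/eqP.
by rewrite subn_eq0 leqNgt i_lt.
Qed.

(** Domination of the image of one basis vector, multiplied by the bound of its
    coordinate. *)
Lemma coord_tail (x : nat -> K) k n' m j (Y E : R) : (n' < k)%N -> (j <= n')%N ->
  (dn n' <= m < dn n'.+1)%N -> 0 <= E -> Y <= E * pi j.+1 (bvec m) ->
  E * (kap n' * (dn n'.+1)%:R) <= 2 * rho R n' ->
  modulus (x m) * Y * (dn n'.+1)%:R <= 2 * rho R n' * pi j.+1 (lincomb bvec x (dn k)).
Proof.
move=> nk jn mI E0 hY hE; have hc := coord_basis x nk (jn : (j.+1 <= n'.+1)%N) mI.
have d0 : 0 <= (dn n'.+1)%:R :> R by [].
have p0 := pi_ge0 j.+1 (lincomb bvec x (dn k)).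
apply: le_trans (ler_wpM2r p0 hE).
apply: le_trans (ler_wpM2r d0 (ler_wpM2l (modulus_ge0 (x m)) hY)) _.
have := ler_wpM2r d0 (ler_wpM2l E0 hc).
by rewrite mulrCA => /le_trans; apply; lra.
Qed.

Let n_n1 : (n < n1)%N. Proof. by rewrite ltnS leq_addr. Qed.
Let sg_n : (sn n <= n)%N. Proof. exact: sn_le. Qed.
Let a_c : (a <= c)%N.
Proof.
apply: leq_trans (cn_dn n) _; apply: leq_trans (dn_cn n1); exact: dn_le.
Qed.

(** The replacement of ['X^c] by [q] on the part of degree less than [c]. *)
Lemma return_sum (x : nat -> K) k (A0 : R) : (n1 < k)%N ->
  pi 0 (lincomb bvec x (dn k)) <= A0 ->
  \sum_(m < c) modulus (x m) * pi (sn n) (Phi (basis m * ('X^c - q))) <= rho R n * A0.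
Proof.
move=> nk hA; have z0 := zeta_ge0 n1; have k0 := kap_ge0 n1; have g1 := gnorm_ge1 n1.
have A00 : 0 <= A0 by apply: le_trans hA.
apply: (@le_trans _ _ (rho R n1 * A0)); last first.
  by apply: ler_wpM2r => //; apply: rho_le; exact: ltnW.
apply: (@le_trans _ _ (\sum_(m < c) pnorm (basis m) * (zeta n1 * (kap n1 * A0)))).
  apply: ler_sum => m _; rewrite -sg_ev -q_ev.
  have mc := ltn_ord m.
  have sb : (size (basis m) <= c)%N by have [-> _] := basis_graded m.
  apply: le_trans (ler_wpM2l (modulus_ge0 (x m)) (seminorm_return mc sb)) _.
  rewrite mulrCA; apply: ler_wpM2l; first exact: pnorm_ge0.
  rewrite mulrCA; apply: ler_wpM2l => //.
  apply: le_trans (coord_basis0 x nk (leq_trans mc (cn_dn n1))) _.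
  exact: ler_wpM2l.
rewrite -mulr_suml.
have hs : \sum_(m < c) pnorm (basis m) <= gnorm n1.
  rewrite (big_ord_widen _ (fun m => pnorm (basis m)) (cn_dn n1)) big_mkcond.
  apply: ler_wpDl => //; apply: ler_sum => m _; case: ifP => // _; exact: pnorm_ge0.
have d1 : 1 <= (dn n1.+1)%:R :> R by rewrite ler1n dn_gt0.
have B0 := B_ge0 n1.
have zk : 0 <= zeta n1 * (kap n1 * A0) by exact: mulr_ge0 z0 (mulr_ge0 k0 A00).
apply: le_trans (ler_wpM2r zk hs) _; apply: le_trans (ler_wpM2r A00 (zeta_small n1)).
have -> : gnorm n1 * (zeta n1 * (kap n1 * A0)) = zeta n1 * (gnorm n1 * kap n1) * A0 by ring.
apply: ler_wpM2r => //; apply: ler_wpM2l => //.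
have -> : gnorm n1 * (kap n1 * (dn n1.+1)%:R) * (st_B (h n1) + 1) =
  gnorm n1 * kap n1 * ((dn n1.+1)%:R * (st_B (h n1) + 1)) by ring.
apply: ler_peMr; first by apply: mulr_ge0 => //; lra.
by rewrite -[leLHS]mulr1; apply: ler_pM => //; lra.
Qed.

(** What remains of degree at least [a] is negligible in [pi (sn n)] compared to the
    original vector in [pi (sn n).+1]. For degrees less than [c] the remaining
    operator is [q], which has size at most [dn n.+1] and no constant term. In the
    block of the first event of the stage, and in that of the event of [q] for
    ['X^c], the level from the return exponent on is at most [sn n], so that any
    polynomial is dominated; in the blocks in between or later the exponents are
    small enough for [seminorm_shift]. *)
Lemma tail_estimate (x : nat -> K) k : (n1 < k)%N ->
  \sum_(m < dn k) (if (m < a)%N then 0 else modulus (x m) *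
    pi (sn n) (Phi (if (m < c)%N then q * basis m else 'X^c * basis m))) <=
  4 * rho R n * pi (sn n).+1 (lincomb bvec x (dn k)).
Proof.
move=> nk; have [sq q0 qB] := q_props; have B0 := B_ge0 n.+1.
have nk' : (n < k)%N by exact: ltn_trans nk.
apply: (@tail_sum (fun m => if (m < a)%N then 0 else modulus (x m) *
    pi (sn n) (Phi (if (m < c)%N then q * basis m else 'X^c * basis m)))) => //.
- exact: ltnW.
- by move=> m mn; rewrite (leq_trans mn (dn_cn n)).
move=> n' m /andP[nn' n'k] mI; have /andP[dm md] := mI.
have r0 := ltW (rho_gt0 R n').
have [ma|am] := ltnP m a; first by rewrite mul0r !mulr_ge0.
have sgn' : (sn n <= n')%N by exact: leq_trans sg_n nn'.
have lev l : (cn l <= m)%N -> sn l = sn n -> (level (h l) m <= sn n)%N.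
  move=> clm e; rewrite /level ltnNge clm /= e.
  have : (0 < m %/ cn l)%N by rewrite divn_gt0 // cn_gt0.
  by case: (m %/ cn l)%N => // u _; rewrite subSS leq_subr.
have kd0 : 0 <= kap n' * (dn n'.+1)%:R by rewrite mulr_ge0 // kap_ge0.
have g1 := gnorm_ge1 n'; have L0 := Lam_ge0 n'; have e0 := ltW (eta_gt0 n').
have B'0 := B_ge0 n'.+1.
have sb := (basis_graded m).1.
have [mc|cm] := ltnP m c; last first.
  have [en|ln] := eqVneq n' n1.
    have mI1 : (dn n1 <= m < dn n1.+1)%N by rewrite -en.
    have cd : (c <= dn n'.+1)%N by rewrite en cn_dn.
    have sP : (size ('X^c * basis m)%R <= 2 * dn n'.+1)%N.
      apply: leq_trans (size_polyMleq _ _) _; rewrite size_polyXn sb.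
      by rewrite addSn addnS /= mul2n -addnn -addnS; exact: leq_add.
    rewrite /=; apply: (@coord_tail _ _ _ _ _ _ (Lam n' * gnorm n' * eta n')) => //.
    - by rewrite !mulr_ge0 //; lra.
    - apply: le_trans (seminorm_big mI _ sP) _; first by rewrite {1}en lev // ?sg_ev.
      rewrite pnormMXn mulrA; apply: ler_wpM2r => //; apply: ler_wpM2r => //.
      by apply: ler_wpM2l => //; exact: pnorm_basis.
    - apply: (@le_trans _ _ (rho R n')); last lra.
      apply: le_trans (eta_small n').
      rewrite (_ : _ * _ = eta n' * (Lam n' * (gnorm n' * (kap n' * (dn n'.+1)%:R) * 1))); last by ring.
      apply: ler_wpM2l => //; apply: ler_wpM2l => //; apply: ler_wpM2l; last lra.
      by rewrite mulr_ge0 //; lra.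
  have n1n' : (n1 < n')%N.
    rewrite ltn_neqAle eq_sym ln /= leqNgt; apply/negP => n'n1.
    by have := leq_trans md (leq_trans (dn_le n'n1) (dn_cn n1)); rewrite ltnNge cm.
  have cd : (c <= dn n')%N by exact: leq_trans (cn_dn n1) (dn_le n1n').
  rewrite /=; apply: (@coord_tail _ _ _ _ _ _ (shift_bound n')) => //.
  - exact: shift_bound_ge0.
  - by apply: seminorm_shift => //; rewrite cn_gt0.
  - by have := shift_bound_small (lexx 0) (B_ge0 n') (B_ge0 n'.+1); rewrite add0r mul1r.
have n'n1 : (n' <= n1)%N.
  rewrite leqNgt; apply/negP => ln; have := leq_trans (cn_dn n1) (dn_le ln) => cd.
  by have := leq_trans mc (leq_trans cd dm); rewrite ltnn.
move: nn'; rewrite leq_eqVlt => /orP[/eqP en|nn'].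
  have sP : (size (q * basis m)%R <= 2 * dn n'.+1)%N.
    apply: leq_trans (size_polyMleq _ _) _; rewrite sb addnS /= mul2n -addnn -en.
    by apply: leq_add => //; rewrite en ltnW.
  have qB' : pnorm (q * basis m) <= st_B (h n'.+1) * gnorm n'.
    apply: le_trans (pnormM _ _) _; apply: ler_pM; rewrite ?pnorm_ge0 //; first by rewrite -en.
    exact: pnorm_basis.
  rewrite /=; apply: (@coord_tail _ _ _ _ _ _ (Lam n' * (st_B (h n'.+1) * gnorm n') * eta n')) => //.
  - by rewrite !mulr_ge0 //; lra.
  - apply: le_trans (seminorm_big mI _ sP) _; first by rewrite -{1}en lev.
    by rewrite mulrA; apply: ler_wpM2r => //; apply: ler_wpM2r => //; exact: ler_wpM2l.
  - apply: (@le_trans _ _ (rho R n')); last lra.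
    apply: le_trans (eta_small n').
    rewrite (_ : _ * _ = eta n' * (Lam n' * (gnorm n' * (kap n' * (dn n'.+1)%:R) * st_B (h n'.+1)))); last by ring.
    apply: ler_wpM2l => //; apply: ler_wpM2l => //; apply: ler_wpM2l; last lra.
    by rewrite mulr_ge0 //; lra.
pose i' := (n' - n.+1)%N; have en : (n.+1 + i' = n')%N by rewrite subnKC.
have i'i : (i' <= i)%N by rewrite -(leq_add2l n.+1) en.
have [_ _ hB1] := queue_run (leq_trans i'i (ltnW i_lt)).
have [_ _ hB2] := queue_run (leq_ltn_trans i'i i_lt).
rewrite en in hB1; rewrite addnS en in hB2.
have sd : (size q <= dn n')%N by exact: leq_trans sq (dn_le nn').
have b0 := shift_bound_ge0 n'.
rewrite /=; apply: (@coord_tail _ _ _ _ _ _ (B * shift_bound n')) => //.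
- exact: mulr_ge0.
- apply: le_trans (seminorm_shift_poly mI sgn' sd q0) _; rewrite mulrA.
  by apply: ler_wpM2r => //; exact: ler_wpM2r.
- have := shift_bound_small B0 (_ : B <= st_B (h n')) (_ : B <= st_B (h n'.+1)).
  rewrite hB1 hB2 => /(_ (lexx _) (lexx _)) hb; apply: le_trans hb; rewrite -mulrA.
  by apply: ler_wpM2r; [rewrite mulr_ge0|lra].
Qed.

(** The part of degree less than [a]: [q] carries it close to ['X^a * f], by the
    choice of the queue, and the first event of the stage returns [f]. *)
Lemma head_estimate (x : nat -> K) (f : {poly K}) : (size f <= a)%N ->
  pnorm f <= (ev_nu (h n))%:R ->
  let D := q * \sum_(m < a) x m *: basis m - 'X^a * f in
  pnorm D <= B -> \sum_(l < dn n.+1) modulus D`_l * pi n (orb l) <= rho R n ->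
  pi (sn n) (Phi (q * \sum_(m < a) x m *: basis m - f)) <= 3 * rho R n.
Proof.
move=> sf fnu D DB Dlow; have [sq q0 qB] := q_props.
set P1 := \sum_(m < a) x m *: basis m in D DB Dlow *.
(* The polynomial of the first event of the stage is 1. *)
have -> : q * P1 - f = D + f * ('X^a - ev_poly (h n)).
  by rewrite /D /ev_poly n_open /= mulrBr mulr1 addrA [f * _]mulrC subrK.
rewrite orbit_evalD; apply: le_trans (seminormD (hpi _) _ _) _.
have B0 := B_ge0 n; have B1 := B_ge0 n.+1.
have hz0 m : zeta m * ((st_B (h m) + (ev_nu (h m))%:R) * pi 0 (bvec 0)) <= rho R m.
  by have := p_zeta0 (h_step m); rewrite (bvecE (dn_gt0 m)) h_n.
have e1 : pi (sn n) (Phi (f * ('X^a - ev_poly (h n)))) <= rho R n.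
  apply: le_trans (seminorm_return (cn_gt0 n) sf) _; apply: le_trans (hz0 n).
  rewrite mulrCA; apply: ler_wpM2l; first exact: zeta_ge0.
  by apply: ler_wpM2r => //; lra.
have sD : (size D <= 2 * dn n.+1)%N.
  rewrite mul2n -addnn; apply: leq_trans (size_polyD _ _) _; rewrite size_polyN geq_max.
  have sP1 : (size P1 <= a)%N by apply: size_basis_sum; exact: basis_graded.
  apply/andP; split; apply: leq_trans (size_polyMleq _ _) _; apply: leq_trans (leq_pred _) _.
    by apply: leq_add => //; exact: leq_trans sP1 (cn_dn n).
  rewrite size_polyXn; apply: leq_add; last exact: leq_trans sf (cn_dn n).
  by apply: leq_trans (cn2_dn n); rewrite mul2n -addnn -addn1 leq_add2l cn_gt0.
(* The degrees below [dn n.+1] were taken care of when the queue was chosen; the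
   vectors of the next degrees belong to a later block and are tiny. *)
have e2 : pi (sn n) (Phi D) <= 2 * rho R n.
  apply: le_trans (seminorm_orbit_eval _ (hpi _) sD) _.
  rewrite [(2 * _)%N]mul2n -addnn big_split_ord /=.
  rewrite (_ : 2 * rho R n = rho R n + rho R n); last by ring.
  apply: lerD.
    apply: le_trans Dlow; apply: ler_sum => l _.
    by apply: ler_wpM2l; [exact: modulus_ge0|exact: pi_le].
  apply: (@le_trans _ _ (\sum_(l < dn n.+1) modulus D`_(dn n.+1 + l) * (zeta n.+1 * pi 0 (bvec 0)))).
    apply: ler_sum => l _; apply: ler_wpM2l; first exact: modulus_ge0.
    have l2 : (dn n.+1 + l < 2 * dn n.+1)%N by rewrite mul2n -addnn ltn_add2l.
    have lc : (dn n.+1 + l < cn n.+1)%N by exact: leq_trans l2 (dn2_cn _).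
    have <- : bvec (dn n.+1 + l) = orb (dn n.+1 + l).
      by rewrite /bvec (basis_X (n := n.+1)) ?leq_addr ?lc // orbit_evalXn.
    apply: bvec_tiny.
    - by rewrite leq_addr (leq_trans lc) // cn_dn.
    - rewrite /level lc h_n.
      have -> : ((dn n.+1 + l) %/ dn n.+1 = 1)%N.
        by rewrite divnDl // divnn dn_gt0 divn_small ?addn0.
      by rewrite subn1 /= leqW.
    - by rewrite addn_gt0 dn_gt0.
  have z0 : 0 <= zeta n.+1 * pi 0 (bvec 0) by rewrite mulr_ge0 // zeta_ge0.
  rewrite -mulr_suml; apply: (@le_trans _ _ (B * (zeta n.+1 * pi 0 (bvec 0)))).
    apply: ler_wpM2r => //; apply: le_trans DB.
    rewrite (pnormE sD) [(2 * _)%N]mul2n -addnn big_split_ord /= lerDr sumr_ge0 // => l _.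
    exact: modulus_ge0.
  apply: le_trans (rho_le (leqnSn n)); apply: le_trans (hz0 n.+1).
  rewrite mulrCA; apply: ler_wpM2l; first exact: zeta_ge0.
  by apply: ler_wpM2r => //; rewrite lerDl.
by move: e1 e2; lra.
Qed.

Lemma stage_estimate (x : nat -> K) k (f : {poly K}) (A0 : R) : (n1 < k)%N ->
  (size f <= a)%N -> pnorm f <= (ev_nu (h n))%:R ->
  let D := q * \sum_(m < a) x m *: basis m - 'X^a * f in
  pnorm D <= B -> \sum_(l < dn n.+1) modulus D`_l * pi n (orb l) <= rho R n ->
  pi (sn n).+1 (lincomb bvec x (dn k)) <= A0 ->
  pi (sn n) (Phi ('X^c * \sum_(t < dn k) x t *: basis t - f)) <= rho R n * (5 * A0 + 3).
Proof.
move=> nk sf fnu D DB Dlow hA; set P1 := \sum_(m < a) x m *: basis m in D DB Dlow.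
have ck : (c <= dn k)%N by exact: leq_trans (cn_dn n1) (dn_le nk).
(* ['X^c] is replaced by [q] in the degrees less than [c], with the error [t1]; then
   the degrees less than [a] form the main part [t0] and the others the tail [t2]. *)
pose t1 m := if (m < c)%N then x m *: (basis m * ('X^c - q)) else 0.
pose t0 m := if (m < a)%N then x m *: (q * basis m) else 0.
pose t2 m := if (m < a)%N then 0 else x m *: (if (m < c)%N then q * basis m else 'X^c * basis m).
have -> : 'X^c * \sum_(t < dn k) x t *: basis t - f =
    \sum_(m < dn k) t1 m + (q * P1 - f) + \sum_(m < dn k) t2 m.
  have -> : q * P1 = \sum_(m < dn k) t0 m.
    rewrite /P1 mulr_sumr (big_ord_widen _ (fun m => q * (x m *: basis m)) (leq_trans a_c ck)).
    by rewrite big_mkcond; apply: eq_bigr => m _; rewrite /t0 scalerAr.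
  rewrite addrAC [RHS]addrAC addrA -!big_split /= mulr_sumr [RHS]addrAC; congr (_ - _).
  rewrite -!big_split; apply: eq_bigr => m _; rewrite /= /t1 /t0 /t2 -scalerAr.
  have [ma|am] := ltnP m a.
    by rewrite (leq_trans ma a_c) addr0 -scalerDr mulrBr [q * _]mulrC subrK mulrC.
  have [mc|cm] := ltnP m c; last by rewrite !add0r.
  by rewrite addr0 -scalerDr mulrBr [q * _]mulrC subrK mulrC.
rewrite orbit_evalD [X in X + _]orbit_evalD; apply: le_trans (seminormD (hpi _) _ _) _.
have h0 := head_estimate sf fnu DB Dlow.
have h1 : pi (sn n) (Phi (\sum_(m < dn k) t1 m)) <= rho R n * A0.
  rewrite orbit_eval_sum; apply: le_trans (seminorm_sum (hpi _) _ _ _) _.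
  have := return_sum nk (le_trans (pi_le _ (leq0n _)) hA).
  rewrite (big_ord_widen _ (fun m => modulus (x m) * pi (sn n) (Phi (basis m * ('X^c - q)))) ck).
  rewrite big_mkcond /=; apply: le_trans; apply: ler_sum => m _; rewrite /t1.
  by case: ifP => _; rewrite ?orbit_eval0 ?(seminorm0 (hpi _)) // orbit_evalZ (seminormZ (hpi _)).
have h2 : pi (sn n) (Phi (\sum_(m < dn k) t2 m)) <= 4 * rho R n * A0.
  rewrite orbit_eval_sum; apply: le_trans (seminorm_sum (hpi _) _ _ _) _.
  have r4 : 0 <= 4 * rho R n by rewrite mulr_ge0 // ltW // rho_gt0.
  apply: le_trans (ler_wpM2l r4 hA); apply: le_trans (tail_estimate x nk).
  apply: ler_sum => m _; rewrite /t2.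
  by case: ifP => _; rewrite ?orbit_eval0 ?(seminorm0 (hpi _)) // orbit_evalZ (seminormZ (hpi _)).
have := seminormD (hpi (sn n)) (Phi (\sum_(m < dn k) t1 m)) (Phi (q * P1 - f)).
by move: h0 h1 h2; rewrite -/P1; lra.
Qed.

End one_stage.

(** Every polynomial that is bounded and not negligible is carried close to a given
    [f] by one of finitely many powers of the shift, the exponents of the events of
    one late stage. *)
Lemma transitive_poly sg (e A0 al : R) N0 (f : {poly K}) : 0 < e -> 0 < al ->
  exists K0 c0, forall k (x : nat -> K), (K0 <= k)%N ->
    pi sg.+1 (lincomb bvec x (dn k)) <= A0 ->
    (exists2 m, (m < dn N0)%N & al <= modulus (x m)) ->
    exists2 c, (c <= c0)%N &
      pi sg (Phi ('X^c * \sum_(t < dn k) x t *: basis t - f)) <= e.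
Proof.
move=> e0 al0; pose A1 := Num.max 0 A0; have A10 : 0 <= A1 by rewrite le_max lexx.
have s0 : 0 < 5 * A1 + 3 by lra.
have [r hr] := rho_small (divr_gt0 e0 s0).
pose N := maxn (maxn r N0) (maxn (size f)
  (maxn (Num.truncn A1).+1 (maxn (Num.truncn al^-1).+1 (Num.truncn (pnorm f)).+1))).
have [nu [Nnu nu0 lognu]] := large_stage sg N.
have [n [q0 en]] := stage_exists nu.-1.
have nuE : ev_nu (h n) = nu by rewrite /ev_nu q0 en prednK.
have sgE : sn n = sg by rewrite /ev_s nuE.
have Nn : (N <= n)%N.
  by have := g_nu (h_good n); rewrite h_n en; apply: leq_trans; rewrite -ltnS prednK.
have natN (z : R) : 0 <= z -> ((Num.truncn z).+1 <= N)%N -> z <= nu%:R.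
  move=> z0 zN; have /andP[_ hz] := truncn_itv z0; apply: ltW; apply: lt_le_trans hz _.
  by rewrite ler_nat; exact: leq_trans zN (ltnW Nnu).
have [NA Nal Nf] : [/\ A1 <= nu%:R, al^-1 <= nu%:R & pnorm f <= nu%:R].
  split; apply: natN; rewrite ?pnorm_ge0 ?invr_ge0 ?(ltW al0) // /N !leq_max leqnn ?orbT //.
have [rn N0n sfn] : [/\ (r <= n)%N, (N0 <= n)%N & (size f <= n)%N].
  by split; apply: leq_trans Nn; rewrite /N !leq_max leqnn ?orbT.
pose L := size (st_que (h n.+1)).
exists (n.+1 + L).+1, (cn (n.+1 + L)) => k x hk hA [m mN0 hm].
have nk : (n < k)%N by apply: leq_trans hk; rewrite -addSn ltnS -addnS leq_addr.
have hA1 : pi sg.+1 (lincomb bvec x (dn k)) <= A1 by rewrite le_max hA orbT.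
have nur : 0 < nu%:R :> R by rewrite ltr0n.
have [|||q ql] := @p_net _ _ _ _ _ _ (h_step n) q0 x f.
- move=> l la; have ld := leq_trans la (cn_dn n).
  rewrite bvecE // nuE; apply: le_trans (coord_basis0 x nk ld) _.
  apply: ler_wpM2l; first exact: kap_ge0.
  by apply: le_trans NA; apply: le_trans hA1; exact: pi_le.
- exists m; first exact: leq_trans mN0 (dn_le N0n).
  by rewrite nuE; apply: le_trans hm; rewrite -[leRHS]invrK lef_pV2 ?posrE ?invr_gt0.
- by rewrite nuE.
rewrite h_n -dnS.
have -> : \sum_(m < cn n) x m *: st_U (h n.+1) m = \sum_(m < cn n) x m *: basis m.
  apply: eq_bigr => l _; rewrite (@basisE l n.+1) //.
  by apply: leq_trans (ltn_ord l) _; exact: leq_trans (cn_dn n) (dn_cn _).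
have -> : \sum_(l < dn n.+1) modulus (q * \sum_(m < cn n) x m *: basis m - 'X^(cn n) * f)`_l * pi n (st_e (h n.+1) l)
   = \sum_(l < dn n.+1) modulus (q * \sum_(m < cn n) x m *: basis m - 'X^(cn n) * f)`_l * pi n (orb l).
  by apply: eq_bigr => l _; rewrite (@orbE l n.+1).
move=> [DB Dlow].
pose i := index q (st_que (h n.+1)).
have iL : (i < L)%N by rewrite index_mem.
exists (cn (n.+1 + i)).
  apply: leq_trans (cn_dn _) _; apply: leq_trans (dn_cn _); apply: dn_le.
  by rewrite -addnS leq_add2l.
have n1k : (n.+1 + i < k)%N by apply: leq_trans hk; rewrite ltnS leq_add2l ltnW.
have := stage_estimate q0 iL (nth_index 0 ql) n1k _ _ DB Dlow.
rewrite nuE sgE => /(_ A1) hh; apply: le_trans (hh _ Nf hA1) _.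
  by apply: leq_trans sfn _; apply: leq_trans (ltnW (dn_gt n)) (dn_cn n).
apply: (@le_trans _ _ (e / (5 * A1 + 3) * (5 * A1 + 3))); last by rewrite divfK // lt0r_neq0.
by apply: ler_wpM2r; [exact: ltW|exact: le_trans (rho_le rn) hr].
Qed.

End orbit_estimates.

(** * The orbit *)

Section transitive_shift.
Variables (R : realType) (s : scalars).
Local Notation K := (scalar_field R s).
Variables (V : lmodType K) (pi : nat -> V -> R) (cof : set V -> Prop).
Hypothesis sel : selection_system pi cof.

Let hpi j : seminorm (pi j). Proof. exact: sel_seminorm sel j. Qed.
Let pi_ge0 j x : 0 <= pi j x. Proof. exact: seminorm_ge0. Qed.
Let pi_le i j x : (i <= j)%N -> pi i x <= pi j x.
Proof. exact: sel_nondecreasing sel i j x. Qed.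

(** The conditions on the orbit mention only the seminorms. In the last one the
    vector [x] of the closed span is not negligible, so that by almost orthogonality
    all polynomials near [x] have a coordinate of low index bounded from below, and
    the same stage works for all of them. *)
Lemma transitive_shift_exists : exists orb : nat -> V, [/\
  forall j, exists2 C, 0 <= C &
    forall P, pi j (orbit_eval orb ('X * P)) <= C * pi j.+1 (orbit_eval orb P),
  forall P, pi 0 (orbit_eval orb P) = 0 -> P = 0 &
  forall j x, (forall i (e : R), 0 < e -> exists P, pi i (orbit_eval orb P - x) < e) ->
    0 < pi j x -> forall i (e : R) f, 0 < e -> exists c0 l d, 0 < d /\
      forall P, pi l (orbit_eval orb P - x) < d ->
        exists2 c, (c <= c0)%N & pi i (orbit_eval orb ('X^c * P - f)) <= e].
Proof.
have [h [hgs hn hd0 hnu0 hq0]] := history_exists sel.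
have hg n : good pi cof (h n) by case: (hgs n).
have hs n : step pi (h n) (h n.+1) by case: (hgs n).
exists (orb h); split.
- exact: (shift_continuous sel hg hs hn hd0 hnu0).
- move=> P P0; have sP := ltnW (dn_gt hg hs (size P)).
  have [x Px] := basis_expand hg sP.
  have sk := dn_le hg hs (leqnSn (size P)).
  pose k := (size P).+1.
  pose y t := if (t < st_d (h (size P)))%N then x t else 0.
  have e : lincomb (bvec h) y (st_d (h k)) = orbit_eval (orb h) P.
    rewrite {1}Px orbit_eval_lincomb /lincomb -(subnKC sk) big_split_ord /= [X in _ + X]big1 ?addr0.
      by apply: eq_bigr => t _; rewrite /y ltn_ord.
    by move=> t _; rewrite /y ltnNge leq_addr scale0r.
  rewrite Px big1 // => t _.
  have tk : (t < st_d (h (size P).+1))%N by exact: leq_trans (ltn_ord t) sk.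
  have := coord_basis0 sel hg hs hn hd0 y (leqnn k) tk.
  rewrite e P0 mulr0 /y ltn_ord => ht.
  rewrite (@modulus_eq0 _ _ (x t)) ?scale0r //.
  apply/eqP; rewrite eq_le modulus_ge0 andbT.
  by rewrite -(ler_pM2r (bvec_gt0 hg hs t)) mul0r.
move=> j x hx xj i e f e0.
pose r := pi j x / 3; have r0 : 0 < r by rewrite divr_gt0.
have r4 : 0 < r / 4 by rewrite divr_gt0.
have [P0 hP0] := hx j _ r4.
pose N := maxn (size P0) j.
have sP0 : (size P0 <= st_d (h N))%N.
  by apply: leq_trans (ltnW (dn_gt hg hs N)); exact: leq_maxl.
have [y0 P0y] := basis_expand hg sP0.
pose S := 1 + \sum_(m < st_d (h N)) pi j (bvec h m).
have S0 : 0 < S by rewrite ltr_wpDr // sumr_ge0.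
have [K0 [c0 hT]] := transitive_poly sel hg hs hn hd0 hnu0 hq0 i (pi i.+1 x + 1) N f e0 (divr_gt0 r0 S0).
exists c0, (maxn j i.+1), (Num.min (r / 4) 1); split; first by rewrite lt_min r4 ltr01.
move=> P hP.
have hPj : pi j (orbit_eval (orb h) P - x) < r / 4.
  apply: le_lt_trans (pi_le _ (leq_maxl j i.+1)) _; apply: lt_le_trans hP _.
  by rewrite ge_min lexx.
have hPi : pi i.+1 (orbit_eval (orb h) P - x) < 1.
  apply: le_lt_trans (pi_le _ (leq_maxr j i.+1)) _; apply: lt_le_trans hP _.
  by rewrite ge_min lexx orbT.
pose k := maxn (maxn K0 N) (size P).
have sP : (size P <= st_d (h k))%N.
  by apply: leq_trans (ltnW (dn_gt hg hs k)); exact: leq_maxr.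
have Nk : (N <= k)%N by exact: leq_trans (leq_maxr K0 N) (leq_maxl _ _).
have [y Py] := basis_expand hg sP.
have PhiP : orbit_eval (orb h) P = lincomb (bvec h) y (st_d (h k)).
  by rewrite {1}Py orbit_eval_lincomb.
have [|||c cc0 hc] := hT k y.
- exact: leq_trans (leq_maxl K0 N) (leq_maxl _ _).
- rewrite -PhiP; have := seminorm_leB (hpi i.+1) (orbit_eval (orb h) P) x.
  by move: hPi; lra.
(* The coordinates of the difference of the two polynomials near [x]: cutting them
   at a low index at most doubles the seminorm. *)
- pose z t := y t - (if (t < st_d (h N))%N then y0 t else 0).
  have zN : lincomb (bvec h) z (st_d (h N)) =
      lincomb (bvec h) y (st_d (h N)) - orbit_eval (orb h) P0.
    rewrite P0y orbit_eval_lincomb /lincomb -sumrB; apply: eq_bigr => t _.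
    by rewrite /z ltn_ord scalerBl.
  have zk : lincomb (bvec h) z (st_d (h k)) = orbit_eval (orb h) P - orbit_eval (orb h) P0.
    rewrite PhiP {1}P0y orbit_eval_lincomb /lincomb.
    rewrite (big_ord_widen _ (fun t => y0 t *: orbit_eval (orb h) (basis h t)) (dn_le hg hs Nk)).
    rewrite [X in _ - X]big_mkcond -sumrB; apply: eq_bigr => t _.
    by rewrite /z; case: ifP => _; rewrite scalerBl // scale0r.
  have jN : (j <= N.+1)%N by rewrite leqW // leq_maxr.
  have := mazur_basis sel hg hs hn z Nk jN; rewrite zN zk => hm.
  have d1 : pi j (orbit_eval (orb h) P - orbit_eval (orb h) P0) <= r / 2.
    have := seminormB (hpi j) (orbit_eval (orb h) P - x) (orbit_eval (orb h) P0 - x).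
    by rewrite opprB addrA subrK; move: hPj hP0; lra.
  have d2 : r <= pi j (lincomb (bvec h) y (st_d (h N))).
    have := seminorm_leB (hpi j) (orbit_eval (orb h) P0) (lincomb (bvec h) y (st_d (h N))).
    rewrite (seminorm_distC (hpi j)).
    have := seminorm_leB (hpi j) x (orbit_eval (orb h) P0).
    rewrite (seminorm_distC (hpi j) x).
    have : pi j x = 3 * r by rewrite /r mulrC divfK.
    by move: hm d1 hP0; lra.
  apply: contrapT => nex.
  have small m : (m < st_d (h N))%N -> modulus (y m) <= r / S.
    by move=> mN; rewrite leNgt; apply/negP => hh; apply: nex; exists m => //; exact: ltW.
  move: d2; apply/negP; rewrite -ltNge.
  apply: le_lt_trans (pi_lincomb sel _ _ _ _) _.
  apply: (@le_lt_trans _ _ (\sum_(m < st_d (h N)) r / S * pi j (bvec h m))).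
    by apply: ler_sum => m _; apply: ler_wpM2r => //; exact: small.
  rewrite -mulr_sumr mulrAC ltr_pdivrMr // ltr_pM2l //.
  by rewrite /S ltrDr.
exists c => //; by rewrite Py.
Qed.

End transitive_shift.

(** * The shift on the closed span of the orbit *)

Section cyclic_operator.
Variables (R : realType) (s : scalars).
Local Notation K := (scalar_field R s).
Variables (X : topologicalLmodType K) (p : nat -> X -> R).
Hypothesis hX : frechet_space p.
Variable orb : nat -> X.
Local Notation Phi := (orbit_eval orb).

Let hp j : seminorm (p j). Proof. exact: frechet_seminorm hX j. Qed.
Let p_ge0 j x : 0 <= p j x. Proof. exact: seminorm_ge0. Qed.
Let p_le i j x : (i <= j)%N -> p i x <= p j x. Proof. exact: (frechet_le hX). Qed.

Hypothesis shift_cont : forall j, exists i C, 0 <= C /\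
  forall P, p j (Phi ('X * P)) <= C * p i (Phi P).

Definition orbit_span : set X :=
  [set x | forall j (e : R), 0 < e -> exists P, p j (Phi P - x) < e].

Lemma orbit_span_eval P : orbit_span (Phi P).
Proof. by move=> j e e0; exists P; rewrite subrr (seminorm0 (hp j)). Qed.

Lemma small_lin (a : K) (e : R) : 0 < e ->
  exists2 d, 0 < d & forall j (u v x y : X), p j (u - x) < d -> p j (v - y) < d ->
    p j ((a *: u + v) - (a *: x + y)) < e.
Proof.
move=> e0; have m0 : 0 < modulus a + 1 by have := modulus_ge0 a; lra.
exists (e / (modulus a + 1)) => [|j u v x y hu hv]; first exact: divr_gt0.
rewrite opprD addrACA -scalerBr; apply: le_lt_trans (seminormD (hp j) _ _) _.
rewrite (seminormZ (hp j)).
have := ler_wpM2l (modulus_ge0 a) (ltW hu).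
have -> : modulus a * (e / (modulus a + 1)) = e - e / (modulus a + 1).
  by field; rewrite lt0r_neq0.
by move: hv; lra.
Qed.

Lemma orbit_span_lin (a : K) x y : orbit_span x -> orbit_span y -> orbit_span (a *: x + y).
Proof.
move=> hx hy j e e0; have [d d0 hd] := small_lin a e0.
have [P hP] := hx j d d0; have [Q hQ] := hy j d d0.
by exists (a *: P + Q); rewrite orbit_eval_lin; exact: hd.
Qed.

Lemma orbit_span_closed : closed orbit_span.
Proof.
apply/(frechet_closedP hX) => x hx j e e0; have e2 : 0 < e / 2 by rewrite divr_gt0.
have [y hy hyx] := hx j _ e2; have [P hP] := hy j _ e2; exists P.
have -> : Phi P - x = (Phi P - y) + (y - x) by rewrite addrA subrK.
by apply: le_lt_trans (seminormD (hp j) _ _) _; move: hP hyx; lra.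
Qed.

(** The closure of the graph of the shift on the polynomials; it is the graph of an
    operator because the shift is bounded from one seminorm to another. *)
Definition shift_graph (x z : X) := forall j (e : R), 0 < e ->
  exists P, p j (Phi P - x) < e /\ p j (Phi ('X * P) - z) < e.

Lemma shift_graph_lin (a : K) x y z w : shift_graph x z -> shift_graph y w ->
  shift_graph (a *: x + y) (a *: z + w).
Proof.
move=> hx hy j e e0; have [d d0 hd] := small_lin a e0.
have [P [hP1 hP2]] := hx j d d0; have [Q [hQ1 hQ2]] := hy j d d0.
exists (a *: P + Q); rewrite mulrDr -scalerAr !orbit_eval_lin.
by split; exact: hd.
Qed.

Lemma shift_graph_bound j : exists i C, 0 <= C /\
  forall x z, shift_graph x z -> p j z <= C * p i x.
Proof.
have [i [C [C0 hC]]] := shift_cont j; exists i, C; split=> // x z hxz.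
rewrite -subr_le0; apply/ler_addgt0Pl => e e0; rewrite addr0.
have C1 : 0 < C + 1 by lra.
have [P [h1 h2]] := hxz (maxn i j) _ (divr_gt0 e0 C1).
have {}h1 := le_lt_trans (p_le _ (leq_maxl i j)) h1.
have {}h2 := le_lt_trans (p_le _ (leq_maxr i j)) h2.
have := seminorm_leB (hp j) z (Phi ('X * P)); rewrite (seminorm_distC (hp j)).
have := ler_wpM2l C0 (ltW h1); have := ler_wpM2l C0 (seminorm_leB (hp i) (Phi P) x).
have -> : C * (e / (C + 1)) = e - e / (C + 1) by field; rewrite lt0r_neq0.
by have := hC P; move: h2; lra.
Qed.

Lemma shift_graph0 z : shift_graph 0 z -> z = 0.
Proof.
move=> hz; apply: (frechet_separating hX) => j.
have [i [C [C0 hC]]] := shift_graph_bound j.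
have := hC _ _ hz; rewrite (seminorm0 (hp i)) mulr0 => h.
by apply/eqP; rewrite eq_le h p_ge0.
Qed.

Lemma shift_graph_uniq x z w : shift_graph x z -> shift_graph x w -> z = w.
Proof.
move=> hz hw; have := shift_graph_lin (-1) hz hw.
rewrite !scaleN1r addNr => /shift_graph0 /eqP; rewrite addrC subr_eq0 => /eqP.
by [].
Qed.

Lemma shift_graph_eval P : shift_graph (Phi P) (Phi ('X * P)).
Proof. by move=> j e e0; exists P; rewrite !subrr (seminorm0 (hp j)). Qed.

Lemma shift_graph_span x z : shift_graph x z -> orbit_span z.
Proof. by move=> h j e e0; have [P [_ hP]] := h j e e0; exists ('X * P). Qed.

Lemma shift_graph_total x : orbit_span x -> exists z, shift_graph x z.
Proof.
move=> hx.
have /choice[P hP] : forall k, exists P, p k (Phi P - x) < 2^-1 ^+ k.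
  by move=> k; apply: hx; rewrite exprn_gt0 // invr_gt0.
have half_le m n : (m <= n)%N -> 2^-1 ^+ n <= 2^-1 ^+ m :> R.
  by move=> mn; apply: ler_wiXn2l => //; rewrite invf_le1 // ler1n.
have near j m N : (j <= m)%N -> (N <= m)%N -> p j (Phi (P m) - x) < 2^-1 ^+ N.
  move=> jm Nm; apply: le_lt_trans (p_le _ jm) _; apply: lt_le_trans (hP m) _.
  exact: half_le.
have [z hz] : exists z, forall j (e : R), 0 < e -> exists N, forall n,
    (N <= n)%N -> p j (Phi ('X * P n) - z) < e.
  apply: (frechet_cauchy_cvg hX) => j e e0.
  have [i [C [C0 hC]]] := shift_cont j.
  have C1 : 0 < 2 * C + 1 by lra.
  have [N0 hN0] := half_small (divr_gt0 e0 C1).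
  exists (maxn i N0) => m n hm hn.
  have mi := leq_trans (leq_maxl i N0) hm; have ni := leq_trans (leq_maxl i N0) hn.
  have mN := leq_trans (leq_maxr i N0) hm; have nN := leq_trans (leq_maxr i N0) hn.
  rewrite -orbit_evalB -mulrBr; apply: le_lt_trans (hC _) _; rewrite orbit_evalB.
  have h1 : p i (Phi (P m) - Phi (P n)) <= 2 * (e / (2 * C + 1)).
    have := seminormB (hp i) (Phi (P m) - x) (Phi (P n) - x).
    rewrite opprB addrA subrK.
    have := near i m N0 mi mN; have := near i n N0 ni nN; lra.
  apply: le_lt_trans (ler_wpM2l C0 h1) _.
  have -> : C * (2 * (e / (2 * C + 1))) = e - e / (2 * C + 1).
    by field; rewrite lt0r_neq0.
  by rewrite gtrBl divr_gt0.
exists z => j e e0; have [N hN] := hz j e e0; have [N0 hN0] := half_small e0.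
pose m := maxn N (maxn j N0); exists (P m); split; last by apply: hN; exact: leq_maxl.
apply: lt_trans hN0; apply: near.
  exact: leq_trans (leq_maxl j N0) (leq_maxr _ _).
exact: leq_trans (leq_maxr j N0) (leq_maxr _ _).
Qed.

Lemma shift_operator : exists T : X -> X, [/\
  forall x, orbit_span x -> orbit_span (T x),
  forall (a : K) x y, orbit_span x -> orbit_span y -> T (a *: x + y) = a *: T x + T y,
  forall j, exists i C, 0 <= C /\ forall x, orbit_span x -> p j (T x) <= C * p i x &
  forall P, T (Phi P) = Phi ('X * P)].
Proof.
have /choice[T hT] : forall x, exists z, orbit_span x -> shift_graph x z.
  move=> x; have [hx|nx] := pselect (orbit_span x); last by exists 0.
  by have [z hz] := shift_graph_total hx; exists z.
exists T; split.
- by move=> x /hT; exact: shift_graph_span.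
- move=> a x y hx hy; apply: shift_graph_uniq (hT _ (orbit_span_lin a hx hy)) _.
  by apply: shift_graph_lin; exact: hT.
- move=> j; have [i [C [C0 hC]]] := shift_graph_bound j; exists i, C; split=> // x hx.
  by apply: hC; exact: hT.
- by move=> P; apply: shift_graph_uniq (hT _ (orbit_span_eval P)) (shift_graph_eval P).
Qed.

Section orbits.
Variable T : X -> X.
Hypothesis T_span : forall x, orbit_span x -> orbit_span (T x).
Hypothesis T_lin : forall (a : K) x y, orbit_span x -> orbit_span y ->
  T (a *: x + y) = a *: T x + T y.
Hypothesis T_bound : forall j, exists i C, 0 <= C /\
  forall x, orbit_span x -> p j (T x) <= C * p i x.
Hypothesis T_eval : forall P, T (Phi P) = Phi ('X * P).

Lemma iter_span c x : orbit_span x -> orbit_span (iter c T x).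
Proof. by move=> hx; elim: c => //= c; exact: T_span. Qed.

Lemma iter_bound c j : exists i C, 0 <= C /\
  forall x, orbit_span x -> forall P, p j (iter c T x - Phi ('X^c * P)) <= C * p i (x - Phi P).
Proof.
elim: c j => [|c IH] j.
  by exists j, 1; split=> // x _ P; rewrite mul1r expr0 mul1r.
have [i [C [C0 hC]]] := T_bound j; have [k [D [D0 hD]]] := IH i.
exists k, (C * D); split; first exact: mulr_ge0.
move=> x hx P /=; have hy := iter_span c hx.
have -> : Phi ('X^(c.+1) * P) = T (Phi ('X^c * P)) by rewrite T_eval mulrA -exprS.
have -> : T (iter c T x) - T (Phi ('X^c * P)) = T (iter c T x - Phi ('X^c * P)).
  rewrite [in RHS]addrC -(scaleN1r (Phi _)) T_lin // ?scaleN1r 1?addrC //.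
  exact: orbit_span_eval.
apply: le_trans (hC _ _) _.
  rewrite addrC -(scaleN1r (Phi _)); apply: orbit_span_lin => //; exact: orbit_span_eval.
by rewrite -mulrA; apply: ler_wpM2l => //; exact: hD.
Qed.

(** Finitely many powers are equicontinuous. *)
Lemma iter_bound_unif c0 j : exists i C, 0 <= C /\
  forall c x, (c <= c0)%N -> orbit_span x ->
  forall P, p j (iter c T x - Phi ('X^c * P)) <= C * p i (x - Phi P).
Proof.
elim: c0 => [|c0 [i [C [C0 hC]]]].
  have [i [C [C0 hC]]] := iter_bound 0 j; exists i, C; split=> // c x.
  by rewrite leqn0 => /eqP -> hx P; exact: hC.
have [i' [C' [C'0 hC']]] := iter_bound c0.+1 j.
exists (maxn i i'), (C + C'); split; first exact: addr_ge0.
move=> c x cc hx P; rewrite mulrDl; move: cc; rewrite leq_eqVlt => /orP[/eqP ->|cc].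
  apply: ler_wpDl; first exact: mulr_ge0.
  apply: le_trans (hC' x hx P) _; apply: ler_wpM2l => //; apply: p_le; exact: leq_maxr.
apply: ler_wpDr; first exact: mulr_ge0.
apply: le_trans (hC c x cc hx P) _; apply: ler_wpM2l => //; apply: p_le; exact: leq_maxl.
Qed.

Hypothesis trans : forall x, orbit_span x -> x <> 0 -> forall i (e : R) f, 0 < e ->
  exists c0 l d, 0 < d /\ forall P, p l (Phi P - x) < d ->
    exists2 c, (c <= c0)%N & p i (Phi ('X^c * P - f)) <= e.

(** A polynomial near [x] and one near [y] reduce the density of the orbit of [x] to
    the estimate for polynomials. *)
Lemma orbit_dense x y : orbit_span x -> orbit_span y -> x <> 0 ->
  forall j (e : R), 0 < e -> exists c, p j (iter c T x - y) < e.
Proof.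
move=> hx hy x0 j e e0; have e3 : 0 < e / 3 by rewrite divr_gt0.
have [f hf] := hy j _ e3.
have [c0 [l [d [d0 hd]]]] := trans hx x0 j f e3.
have [i [C [C0 hC]]] := iter_bound_unif c0 j.
have C1 : 0 < C + 1 by lra.
have [|P hP] := hx (maxn l i) (Num.min d (e / 3 / (C + 1))).
  by rewrite lt_min d0 divr_gt0.
have [|c cc hc] := hd P.
  apply: le_lt_trans (p_le _ (leq_maxl l i)) _; apply: lt_le_trans hP _.
  by rewrite ge_min lexx.
exists c.
have hi : p i (x - Phi P) <= e / 3 / (C + 1).
  rewrite (seminorm_distC (hp i)); apply: le_trans (p_le _ (leq_maxr l i)) _.
  by apply: le_trans (ltW hP) _; rewrite ge_min lexx orbT.
have h1 : p j (iter c T x - Phi ('X^c * P)) <= e / 3 - e / 3 / (C + 1).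
  apply: le_trans (hC c x cc hx P) _; apply: le_trans (ler_wpM2l C0 hi) _.
  by rewrite le_eqVlt; apply/orP; left; apply/eqP; field; rewrite lt0r_neq0.
have h3 : 0 < e / 3 / (C + 1) by rewrite divr_gt0.
have -> : iter c T x - y = (iter c T x - Phi ('X^c * P)) + (Phi ('X^c * P - f) + (Phi f - y)).
  by rewrite orbit_evalB (addrA (Phi _ - _)) subrK (addrA (iter c T x - _)) subrK.
apply: le_lt_trans (seminormD (hp j) _ _) _.
have := seminormD (hp j) (Phi ('X^c * P - f)) (Phi f - y).
by move: hf hc h1 h3; lra.
Qed.

End orbits.

End cyclic_operator.

Section subspace_topology.
Variables (R : realType) (s : scalars).
Local Notation K := (scalar_field R s).
Variables (X : topologicalLmodType K) (p : nat -> X -> R).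
Hypothesis hX : frechet_space p.
Variable E : submodClosed X.

Lemma linear_subspace_nbhsP (x : linear_subspace E) (A : set (linear_subspace E)) :
  nbhs x A <-> exists j (e : R), 0 < e /\
    forall y : linear_subspace E, p j (\val y - \val x) < e -> A y.
Proof.
split.
  move=> [_ [[B Bop <-] Bx BA]].
  have /(frechet_nbhsP hX)[j [e [e0 h]]] : nbhs (\val x) B by rewrite nbhsE; exists B.
  by exists j, e; split=> // y /h By; apply: BA.
move=> [j [e [e0 h]]].
have hb : nbhs (\val x) [set y | p j (y - \val x) < e].
  by apply/(frechet_nbhsP hX); exists j, e.
apply: (@filterS _ (nbhs x) _ (@linear_subspace_val _ _ E @^-1` [set y | p j (y - \val x) < e])).
  by move=> y; exact: h.
exact: (@initial_continuous _ _ (@linear_subspace_val _ _ E) x _ hb).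
Qed.

End subspace_topology.

(** The n + 1 coordinate rows of n + 1 vectors in the span of n vectors are
    dependent. *)
Lemma not_finite_dimensional (K : numFieldType) (V : lmodType K) (u : nat -> V) :
  (forall n (a : nat -> K), \sum_(i < n) a i *: u i = 0 -> forall i, (i < n)%N -> a i = 0) ->
  ~ finite_dimensional V.
Proof.
move=> hu [n [v hv]].
have /choice[a ha] : forall i : nat, exists a : 'I_n -> K, u i = \sum_k a k *: v k.
  by move=> i; exact: hv.
pose A := \matrix_(i < n.+1, k < n) a i k.
have rA : (\rank A <= n)%N by exact: rank_leq_col.
have kA : kermx A != 0.
  by rewrite kermx_eq0 /row_free neq_ltn ltnS rA.
have [i hi] : exists i, row i (kermx A) != 0.
  apply: contrapT => nex; move/eqP: kA; apply; apply/row_matrixP => i.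
  rewrite row0; apply/eqP; apply: contrapT => ne; apply: nex; exists i; exact/negP.
pose b t : K := if insub t is Some k then kermx A i k else 0.
have bE (t : 'I_n.+1) : b t = kermx A i t by rewrite /b valK.
have sb : \sum_(t < n.+1) b t *: u t = 0.
  transitivity (\sum_(k < n) (row i (kermx A) *m A) 0 k *: v k).
    transitivity (\sum_(t < n.+1) \sum_(k < n) (b t * a t k) *: v k).
      by apply: eq_bigr => t _; rewrite ha scaler_sumr; apply: eq_bigr => k _; rewrite scalerA.
    rewrite exchange_big; apply: eq_bigr => k _ /=; rewrite -scaler_suml; congr (_ *: _).
    by rewrite mxE; apply: eq_bigr => t _; rewrite bE [A t k]mxE [row _ _ _ _]mxE.
  rewrite -row_mul mulmx_ker row0 big1 // => k _; by rewrite mxE scale0r.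
move/eqP: hi; apply; apply/rowP => t; rewrite [row _ _ _ _]mxE [RHS]mxE -bE.
exact: hu sb _ (ltn_ord t).
Qed.

(** * Invariant subsets *)

Section selection_in_frechet.
Variables (R : realType) (s : scalars).
Local Notation K := (scalar_field R s).
Variables (X : topologicalLmodType K) (p : nat -> X -> R).
Hypothesis hX : frechet_space p.
Hypothesis hp : forall (j : nat) (E : submodClosed X),
  closed [set` E] -> finite_codimensional E -> ~ equivalent_on E (p j) (p j.+1).

Lemma frechet_selection : selection_system (fun j => p j.+1) (cofinite p).
Proof.
split.
- by move=> j; exact: frechet_seminorm hX _.
- by move=> i j x ij; apply: (frechet_le hX).
- exact: cofinite_setT.
- by move=> F G; exact: cofiniteI.
- by move=> F; exact: cofinite0.
- by move=> F a x y; exact: cofinite_lin.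
- move=> j w; have hq := frechet_seminorm hX j.+1.
  have [g [gl gle gw]] := norming_functional w hq.
  exists (setT `&` kernel g), g; split=> //.
  + by apply: (cofinite_kernel gl gle); exact: cofinite_setT.
  + by move=> y [_ hy]; have := hy 1; rewrite scale1r.
  + by case: gl.
  + by move=> x; exact: (real_linear_bounded _ hq gl).
- by move=> F i e M; exact: (cofinite_select hX hp).
Qed.

End selection_in_frechet.

Section subspace_operator.
Variables (R : realType) (s : scalars).
Local Notation K := (scalar_field R s).
Variables (X : topologicalLmodType K) (p : nat -> X -> R).
Hypothesis hX : frechet_space p.
Variable E : submodClosed X.

Lemma subspace_operator (T : X -> X) :
  (forall x, x \in E -> T x \in E) ->
  (forall (a : K) x y, x \in E -> y \in E -> T (a *: x + y) = a *: T x + T y) ->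
  (forall j, exists i C, 0 <= C /\ forall x, x \in E -> p j (T x) <= C * p i x) ->
  exists S : {linear linear_subspace E -> linear_subspace E},
    continuous S /\ forall x, \val (S x) = T (\val x).
Proof.
move=> TE Tl Tb.
pose S0 (x : linear_subspace E) : linear_subspace E := LinearSubspace (TE _ (valP x)).
have S0lin : linear S0.
  by move=> a x y; apply: val_inj; exact: (Tl a _ _ (valP x) (valP y)).
pose S := HB.pack_for {linear linear_subspace E -> linear_subspace E} S0
  (GRing.isLinear.Build _ _ _ _ S0 S0lin).
exists S; split=> // x A.
move=> /(linear_subspace_nbhsP hX)[j [e [e0 hA]]].
apply/(linear_subspace_nbhsP hX); have [i [C [C0 hC]]] := Tb j.
have C1 : 0 < C + 1 by lra.
exists i, (e / (C + 1)); split; first exact: divr_gt0.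
move=> y hy; apply: hA.
have -> : \val (S y) - \val (S x) = T (\val (y - x)).
  rewrite -[y - x]addrC -(scaleN1r x).
  transitivity (T (-1 *: \val x + \val y)); last by [].
  by rewrite Tl ?scaleN1r 1?addrC //; exact: valP.
apply: le_lt_trans (hC _ (valP _)) _.
rewrite raddfB /=; apply: le_lt_trans (ler_wpM2l C0 (ltW hy)) _.
have -> : C * (e / (C + 1)) = e - e / (C + 1) by field; rewrite lt0r_neq0.
by rewrite gtrBl divr_gt0.
Qed.

End subspace_operator.

Theorem theorem3p12 (R : realType) (s : scalars)
    (X : topologicalLmodType (scalar_field R s)) (p : nat -> X -> R)
    (hX : frechet_space p)
    (hp : forall (j : nat) (E : submodClosed X),
        closed [set` E] -> finite_codimensional E ->
        ~ equivalent_on E (p j) (p j.+1)) :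
  ~ hereditary_invariant_subset_property X.
Proof.
have [orb [hcont hinj htrans]] := transitive_shift_exists (frechet_selection hX hp).
pose Phi := orbit_eval orb.
have p_le i j x : (i <= j)%N -> p i x <= p j x by exact: (frechet_le hX).
have shift_cont j : exists i C, 0 <= C /\
    forall P, p j (Phi ('X * P)) <= C * p i (Phi P).
  have [C C0 hC] := hcont j; exists j.+2, C; split=> // P.
  by apply: le_trans (hC P); exact: p_le.
pose F : {pred X} := fun x => `[<orbit_span p orb x>].
have hF : GRing.submod_closed F.
  split; first by apply/asboolP; rewrite -(orbit_eval0 orb); exact: (orbit_span_eval hX).
  by move=> a x y /asboolP Fx /asboolP Fy; apply/asboolP; exact: (orbit_span_lin hX).
pose E := HB.pack_for (submodClosed X) F (GRing.isSubmodClosed.Build _ X F hF).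
have memE x : (x \in E) <-> orbit_span p orb x by split=> /asboolP.
have PhiE P : Phi P \in E by apply/memE; exact: (orbit_span_eval hX).
have [T [T_span T_lin T_bound T_eval]] := shift_operator hX shift_cont.
have dense (x y : linear_subspace E) : x <> 0 ->
    forall j (e : R), 0 < e -> exists c, p j (iter c T (\val x) - \val y) < e.
  move=> x0; have hx := (memE _).1 (valP x); have hy := (memE _).1 (valP y).
  apply: (orbit_dense hX T_span T_lin T_bound T_eval _ hx hy) => [z hz z0 i e f e0|].
    have [j pj] : exists j, 0 < p j z.
      apply: contrapT => nex; apply: z0; apply: (frechet_separating hX) => j.
      apply/eqP; rewrite eq_le (seminorm_ge0 (frechet_seminorm hX j)) andbT leNgt.
      by apply/negP => h; apply: nex; exists j.
    have [|c0 [l [d [d0 hd]]]] := htrans j z (fun i => hz i.+1) _ i e f e0.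
      by apply: lt_le_trans pj _; exact: p_le.
    exists c0, l.+1, d; split=> // P hP; have [c cc hc] := hd P hP.
    by exists c => //; apply: le_trans hc; exact: p_le.
  by move=> vx; apply: x0; exact: val_inj.
have Ec : closed [set` E].
  rewrite (_ : [set` E] = orbit_span p orb); first exact: (orbit_span_closed hX).
  by rewrite predeqE => x; exact: memE.
have Einf : ~ finite_dimensional (linear_subspace E).
  apply: (@not_finite_dimensional _ _ (fun i => LinearSubspace (PhiE 'X^i))) => n a.
  move=> /(congr1 val) ha i ni.
  have h0 : Phi (\sum_(i < n) a i *: 'X^i) = 0.
    rewrite raddf_sum /= in ha; apply: etrans ha; rewrite /Phi orbit_eval_sum.
    by apply: eq_bigr => k _; rewrite orbit_evalZ.
  have := hinj (\sum_(i < n) a i *: 'X^i).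
  rewrite -/Phi h0 (seminorm0 (frechet_seminorm hX _)) => /(_ erefl) /polyP /(_ i).
  by rewrite -(poly_def n a) coef_poly ni coef0.
have [| | |S [Sc hS]] := subspace_operator hX (E := E) (T := T).
- by move=> x /memE /T_span /memE.
- by move=> a x y /memE hx /memE hy; exact: T_lin.
- move=> j; have [i [C [C0 hC]]] := T_bound j; exists i, C; split=> // x /memE.
  exact: hC.
move=> /(_ E Ec Einf S Sc)[M [[m Mm] Mc M0 MT SM]].
have [x [Mx x0]] : exists x, M x /\ x <> 0.
  apply: contrapT => nex; apply: M0; rewrite predeqE => y.
  have all0 z : M z -> z = 0 by move=> Mz; apply: contrapT => nz; apply: nex; exists z.
  by split=> [/all0|->] //; rewrite -(all0 _ Mm).
have Mi c : M (iter c S x) by elim: c => //= c IH; apply: SM; exists (iter c S x).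
have Si c : \val (iter c S x) = iter c T (\val x) by elim: c => //= c <-; exact: hS.
apply: MT; rewrite predeqE => y; split=> // _; apply: Mc => A.
move=> /(linear_subspace_nbhsP hX)[j [e [e0 hA]]].
have [c hc] := dense x y x0 j e e0.
by exists (iter c S x); split=> //; apply: hA; rewrite Si.
Qed.
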